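(* Let $(A,\Delta)$ be a multiplier Hopf $^*$-algebra with positive integrals, $\psi$ a positive right integral on $A$, and let $M$ be the von Neumann algebra generated by $A$ acting on the associated GNS Hilbert space $\mathcal H$. Define $\psi_1(x)$ for $x\in M$, $x\ge0$, by $$\psi_1(x)=\sup\{\langle x\eta,\eta\rangle\mid\eta\in\mathcal H\text{ is right bounded and }\|\pi_r(\eta)\|\le1\}.$$ Then $\psi_1$ is a faithful normal semi-finite weight on the von Neumann algebra $M$. If $a\in A$, then $\psi_1(a^*a)=\psi(a^*a)$.
   Context: A multiplier Hopf $^*$-algebra $(A,\Delta)$ is a $^*$-algebra $A$ over $\mathbb C$ with non-degenerate product (possibly without unit), with multiplier algebra $M(A)$, and a coassociative $^*$-homomorphism $\Delta:A\to M(A\otimes A)$ (algebraic tensor product) such that $a\otimes a'\mapsto\Delta(a)(1\otimes a')$ and $a\otimes a'\mapsto(a\otimes1)\Delta(a')$ are bijections of $A\otimes A$ onto itself. A left (respectively right) integral is a non-zero linear functional $\varphi$ (respectively $\psi$) with $(\iota\otimes\varphi)\Delta(a)=\varphi(a)1$ (respectively $(\psi\otimes\iota)\Delta(a)=\psi(a)1$) in $M(A)$ for all $a\in A$. ''With positive integrals'' means that positive left and right integrals exist ($\omega$ is positive if $\omega(a^*a)\ge 0$ for all $a$). Integrals are faithful. $\mathcal H$ is the Hilbert space completion of $A$ for the scalar product $\langle a',a\rangle=\psi(a^*a')$, and $\Lambda:A\to\mathcal H$ the canonical injection. $A$ acts faithfully by bounded operators on $\mathcal H$ via $a\Lambda(x)=\Lambda(ax)$,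 and is identified with its image; $M$ is the weak closure of $A$. A vector $\eta\in\mathcal H$ is right bounded if there is a (necessarily unique) bounded operator $\pi_r(\eta)$ on $\mathcal H$ with $\pi_r(\eta)\Lambda(a)=a\eta$ for all $a\in A$. *)

(* Defs.v *)
From HB Require Import structures.
From mathcomp Require Import all_boot all_order all_algebra generic_quotient.
From mathcomp Require Import complex.
From mathcomp Require Import all_classical all_reals all_analysis.

Set Implicit Arguments.
Unset Strict Implicit.
Unset Printing Implicit Defensive.

Import Order.TTheory GRing.Theory Num.Theory.
Import numFieldNormedType.Exports.
Local Open Scope classical_set_scope.
Local Open Scope quotient_scope.
Local Open Scope ring_scope.

Notation bilinear_map f := (bilinear_for *:%R *:%R f).

(** [tensor U V] is the set of formal sums of pairs [(u, v)], two sums being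
    identified when every bilinear map takes the same value on them; by
    [tlift_tens] and [tlift_unique] it has the universal property. *)
Section Tensor.
Variables (K : comNzRingType) (U V : lmodType K).

Definition formal_sum (Z : lmodType K) (f : U -> V -> Z) (s : seq (U * V)) : Z :=
  \sum_(p <- s) f p.1 p.2.

Definition tensor_rel : rel (seq (U * V)) := fun s t =>
  `[< forall (Z : lmodType K) (f : U -> V -> Z),
        bilinear_map f -> formal_sum f s = formal_sum f t >].

Lemma tensor_rel_refl : reflexive tensor_rel.
Proof. by move=> s; apply/asboolP. Qed.

Lemma tensor_rel_sym : symmetric tensor_rel.
Proof.
by move=> s t; apply/asboolP/asboolP => st Z f bf; rewrite (st Z f bf).
Qed.

Lemma tensor_rel_trans : transitive tensor_rel.
Proof.
move=> t s r /asboolP st /asboolP tr; apply/asboolP => Z f bf.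
by rewrite (st _ _ bf) (tr _ _ bf).
Qed.

Canonical tensor_equiv :=
  EquivRel tensor_rel tensor_rel_refl tensor_rel_sym tensor_rel_trans.

Definition tensor := {eq_quot tensor_equiv}.
HB.instance Definition _ := Choice.on tensor.
HB.instance Definition _ := EqQuotient.on tensor.

Definition tscal (c : K) (s : seq (U * V)) : seq (U * V) :=
  [seq (c *: p.1, p.2) | p <- s].

Lemma formal_sum_cat (Z : lmodType K) (f : U -> V -> Z) s t :
  formal_sum f (s ++ t) = formal_sum f s + formal_sum f t.
Proof. by rewrite /formal_sum big_cat. Qed.

Lemma formal_sum_scal (Z : lmodType K) (f : U -> V -> Z) c s :
  bilinear_map f -> formal_sum f (tscal c s) = c *: formal_sum f s.
Proof.
move=> bf; rewrite /formal_sum big_map scaler_sumr; apply: eq_bigr => p _ /=.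
have lin := bf.1 p.2.
exact: (scalable_linear lin).
Qed.

Lemma tensor_eqP (s t : seq (U * V)) :
  (forall (Z : lmodType K) (f : U -> V -> Z),
     bilinear_map f -> formal_sum f s = formal_sum f t) <->
  \pi_tensor s = \pi_tensor t.
Proof.
split=> [st|/eqmodP/asboolP//]; apply/eqmodP/asboolP; exact: st.
Qed.

Definition tensor0 : tensor := \pi_tensor [::].
Definition tensorD (x y : tensor) : tensor := \pi_tensor (repr x ++ repr y).
Definition tensorZ (c : K) (x : tensor) : tensor := \pi_tensor (tscal c (repr x)).
Definition tensorN (x : tensor) : tensor := tensorZ (- 1) x.

Lemma formal_sum_repr (Z : lmodType K) (f : U -> V -> Z) s :
  bilinear_map f -> formal_sum f (repr (\pi_tensor s)) = formal_sum f s.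
Proof.
by move=> bf; apply: (tensor_eqP _ _).2 bf; rewrite reprK.
Qed.

Lemma tensor_repr_eq (x y : tensor) :
  (forall (Z : lmodType K) (f : U -> V -> Z),
     bilinear_map f -> formal_sum f (repr x) = formal_sum f (repr y)) -> x = y.
Proof. by move=> /tensor_eqP; rewrite !reprK. Qed.

Lemma tensorDA : associative tensorD.
Proof.
move=> x y z; apply: tensor_repr_eq => Z f bf.
by rewrite !(formal_sum_repr, formal_sum_cat)// addrA.
Qed.

Lemma tensorDC : commutative tensorD.
Proof.
move=> x y; apply: tensor_repr_eq => Z f bf.
by rewrite !(formal_sum_repr, formal_sum_cat)// addrC.
Qed.

Lemma tensor0D : left_id tensor0 tensorD.
Proof.
move=> x; apply: tensor_repr_eq => Z f bf.
by rewrite !(formal_sum_repr, formal_sum_cat)// /formal_sum big_nil add0r.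
Qed.

Lemma tensorND : left_inverse tensor0 tensorN tensorD.
Proof.
move=> x; apply: tensor_repr_eq => Z f bf.
rewrite !(formal_sum_repr, formal_sum_cat, formal_sum_scal)// scaleN1r addNr.
by rewrite /formal_sum big_nil.
Qed.

HB.instance Definition _ :=
  GRing.isZmodule.Build tensor tensorDA tensorDC tensor0D tensorND.

Lemma tensorZA (a b : K) (x : tensor) :
  tensorZ a (tensorZ b x) = tensorZ (a * b) x.
Proof.
apply: tensor_repr_eq => Z f bf.
by rewrite !(formal_sum_repr, formal_sum_scal)// scalerA.
Qed.

Lemma tensor1Z : left_id 1 tensorZ.
Proof.
move=> x; apply: tensor_repr_eq => Z f bf.
by rewrite !(formal_sum_repr, formal_sum_scal)// scale1r.
Qed.

Lemma tensorZDr : right_distributive tensorZ +%R.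
Proof.
move=> c x y; apply: tensor_repr_eq => Z f bf.
by rewrite !(formal_sum_repr, formal_sum_cat, formal_sum_scal)// scalerDr.
Qed.

Lemma tensorZDl (x : tensor) : {morph tensorZ^~ x : a b / a + b}.
Proof.
move=> a b; apply: tensor_repr_eq => Z f bf.
by rewrite !(formal_sum_repr, formal_sum_cat, formal_sum_scal)// scalerDl.
Qed.

HB.instance Definition _ := GRing.Zmodule_isLmodule.Build K tensor
  tensorZA tensor1Z tensorZDr tensorZDl.

Definition tens (u : U) (v : V) : tensor := \pi_tensor [:: (u, v)].

(* Only meaningful for bilinear [f]. *)
Definition tlift (Z : lmodType K) (f : U -> V -> Z) (x : tensor) : Z :=
  formal_sum f (repr x).

Lemma tens_bilinear : bilinear_map tens.
Proof.
split=> [v|u] c x y; apply: tensor_repr_eq => Z f bf;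
  rewrite !(formal_sum_repr, formal_sum_cat, formal_sum_scal)//;
  rewrite /formal_sum !big_seq1 /=.
  by rewrite (bf.1 v).
by rewrite (bf.2 u).
Qed.

Lemma tlift_linear (Z : lmodType K) (f : U -> V -> Z) :
  bilinear_map f -> linear (tlift f).
Proof.
move=> bf c x y; rewrite /tlift.
by rewrite !(formal_sum_repr, formal_sum_cat, formal_sum_scal).
Qed.

Lemma tlift_tens (Z : lmodType K) (f : U -> V -> Z) (u : U) (v : V) :
  bilinear_map f -> tlift f (tens u v) = f u v.
Proof. by move=> bf; rewrite /tlift formal_sum_repr// /formal_sum big_seq1. Qed.

Lemma tensorE (x : tensor) : x = \sum_(p <- repr x) tens p.1 p.2.
Proof.
rewrite -{1}[x]reprK; elim: (repr x) => [|[u v] s IHs]; first by rewrite big_nil.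
rewrite big_cons -IHs; apply: tensor_repr_eq => Z f bf.
rewrite !(formal_sum_repr, formal_sum_cat)//.
by rewrite -formal_sum_cat.
Qed.

Lemma tensor_ind (P : tensor -> Prop) :
  (forall u v, P (tens u v)) -> P 0 -> (forall x y, P x -> P y -> P (x + y)) ->
  forall x, P x.
Proof.
move=> Pt P0 PD x; rewrite (tensorE x).
by elim: (repr x) => [|p s IHs]; rewrite (big_nil, big_cons)//; apply: PD.
Qed.

Lemma tlift_unique (Z : lmodType K) (f : U -> V -> Z) (g : tensor -> Z) :
  bilinear_map f -> linear g -> (forall u v, g (tens u v) = f u v) ->
  g = tlift f.
Proof.
move=> bf lg gf; apply/funext; apply: tensor_ind => [u v||x y gx gy].
- by rewrite gf tlift_tens.
- have := lg (- 1) 0 0; have := tlift_linear bf (- 1) 0 0.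
  by rewrite !scaler0 !addr0 !scaleN1r !addNr => -> ->.
- have := lg 1 x y; have := tlift_linear bf 1 x y.
  by rewrite !scale1r => -> ->; rewrite gx gy.
Qed.

End Tensor.

Arguments tens {K U V} u v.

Definition tmap (K : comNzRingType) (U V U' V' : lmodType K)
    (f : U -> U') (g : V -> V') : tensor U V -> tensor U' V' :=
  tlift (fun u v => tens (f u) (g v)).

Definition tassocr (K : comNzRingType) (U V W : lmodType K) :
    tensor (tensor U V) W -> tensor U (tensor V W) :=
  tlift (fun x w => tlift (fun u v => tens u (tens v w)) x).

Definition tassocl (K : comNzRingType) (U V W : lmodType K) :
    tensor U (tensor V W) -> tensor (tensor U V) W :=
  tlift (fun u y => tlift (fun v w => tens (tens u v) w) y).

(* [V] with the conjugate scalar multiplication. *)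
Section ConjugateModule.
Variables (K : numClosedFieldType) (V : lmodType K).

Definition conj_module : Type := V.
HB.instance Definition _ := GRing.Zmodule.on conj_module.

Definition conj_scale (c : K) (x : conj_module) : conj_module := c^* *: (x : V).

Lemma conj_scaleA a b x : conj_scale a (conj_scale b x) = conj_scale (a * b) x.
Proof. by rewrite /conj_scale scalerA rmorphM. Qed.

Lemma conj_scale1 : left_id 1 conj_scale.
Proof. by move=> x; rewrite /conj_scale rmorph1 scale1r. Qed.

Lemma conj_scaleDr : right_distributive conj_scale +%R.
Proof. by move=> c x y; rewrite /conj_scale scalerDr. Qed.

Lemma conj_scaleDl x : {morph conj_scale^~ x : a b / a + b}.
Proof. by move=> a b; rewrite /conj_scale rmorphD scalerDl. Qed.

HB.instance Definition _ := GRing.Zmodule_isLmodule.Build K conj_module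
  conj_scaleA conj_scale1 conj_scaleDr conj_scaleDl.

End ConjugateModule.

(* There may be no unit, hence no [algType]. *)
Record star_algebra (K : numClosedFieldType) := StarAlgebra {
  sa_sort :> lmodType K;
  sa_mul : sa_sort -> sa_sort -> sa_sort;
  sa_star : sa_sort -> sa_sort;
  sa_mul_bilinear : bilinear_map sa_mul;
  sa_mulA : associative sa_mul;
  sa_star_antilinear : forall (c : K) x y,
    sa_star (c *: x + y) = c^* *: sa_star x + sa_star y;
  sa_starM : forall x y, sa_star (sa_mul x y) = sa_mul (sa_star y) (sa_star x);
  sa_starK : involutive sa_star }.

Arguments sa_mul {K s} x y.
Arguments sa_star {K s} x.

Declare Scope star_scope.
Delimit Scope star_scope with star.
Notation "x ** y" := (sa_mul x y)
  (at level 40, left associativity) : star_scope.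
Notation "x ^!" := (sa_star x) : star_scope.
Local Open Scope star_scope.

Definition nondegenerate_product (K : numClosedFieldType) (A : star_algebra K) :=
  (forall a : A, (forall b, a ** b = 0) -> a = 0) /\
  (forall a : A, (forall b, b ** a = 0) -> a = 0).

Section TensorStarAlgebra.
Variables (K : numClosedFieldType) (A B : star_algebra K).
Local Notation AB := (tensor A B).

Let tensDl (u u' : A) (v : B) c : tens (c *: u + u') v = c *: tens u v + tens u' v.
Proof. exact: (tens_bilinear A B).1. Qed.
Let tensDr (u : A) (v v' : B) c : tens u (c *: v + v') = c *: tens u v + tens u v'.
Proof. exact: (tens_bilinear A B).2. Qed.

Definition tensor_mul (x y : AB) : AB :=
  tlift (fun a b => tlift (fun a' b' => tens (a ** a') (b ** b')) y) x.

Definition tensor_star (x : AB) : AB :=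
  tlift (fun a b => tens a^! b^! : conj_module AB) x.

Let mul_bil a b : bilinear_map (fun (a' : A) (b' : B) => tens (a ** a') (b ** b')).
Proof.
split=> [v|u] c x y.
  by rewrite ((sa_mul_bilinear A).2 a) tensDl.
by rewrite ((sa_mul_bilinear B).2 b) tensDr.
Qed.

Let mul_bil2 y : bilinear_map
  (fun (a : A) (b : B) => tlift (fun a' b' => tens (a ** a') (b ** b')) y).
Proof.
split=> [v|u] c x x'; rewrite /tlift /formal_sum /= scaler_sumr -big_split /=;
  apply: eq_bigr => p _.
  by rewrite ((sa_mul_bilinear A).1 p.1) tensDl.
by rewrite ((sa_mul_bilinear B).1 p.2) tensDr.
Qed.

Lemma tensor_mul_tens a b a' b' :
  tensor_mul (tens a b) (tens a' b') = tens (a ** a') (b ** b').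
Proof. by rewrite /tensor_mul tlift_tens// tlift_tens. Qed.

Lemma tensor_mul_bilinear : bilinear_map tensor_mul.
Proof.
split=> [y|x] c z z'; first by rewrite /tensor_mul (tlift_linear (mul_bil2 y)).
rewrite /tensor_mul {1 3 5}/tlift /formal_sum /= scaler_sumr -big_split /=.
by apply: eq_bigr => p _; rewrite (tlift_linear (mul_bil p.1 p.2)).
Qed.

Let mul0x x : tensor_mul 0 x = 0.
Proof.
have := tensor_mul_bilinear.1 x (- 1) 0 0.
by rewrite /= !scaler0 !addr0 !scaleN1r !addNr.
Qed.
Let mulx0 x : tensor_mul x 0 = 0.
Proof.
have := tensor_mul_bilinear.2 x (- 1) 0 0.
by rewrite /= !scaler0 !addr0 !scaleN1r !addNr.
Qed.
Let mulDl x y z : tensor_mul (x + y) z = tensor_mul x z + tensor_mul y z.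
Proof. by have := tensor_mul_bilinear.1 z 1 x y; rewrite /= !scale1r. Qed.
Let mulDr x y z : tensor_mul z (x + y) = tensor_mul z x + tensor_mul z y.
Proof. by have := tensor_mul_bilinear.2 z 1 x y; rewrite /= !scale1r. Qed.

Lemma tensor_mulA : associative tensor_mul.
Proof.
move=> x y z; move: x; apply: tensor_ind => [a b||x x' IHx IHx'].
- move: y; apply: tensor_ind => [a' b'||y y' IHy IHy'].
  + move: z; apply: tensor_ind => [a'' b''||z z' IHz IHz'].
    * by rewrite !tensor_mul_tens !sa_mulA.
    * by rewrite !mulx0.
    * by rewrite !mulDr IHz IHz'.
  + by rewrite !(mul0x, mulx0).
  + by rewrite mulDl !mulDr mulDl IHy IHy'.
- by rewrite !mul0x.
- by rewrite !mulDl IHx IHx'.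
Qed.

Let star_bil : bilinear_map (fun (a : A) (b : B) => tens a^! b^! : conj_module AB).
Proof.
by split=> [v|u] c x y; rewrite sa_star_antilinear (tensDl, tensDr).
Qed.

Lemma tensor_star_tens a b : tensor_star (tens a b) = tens a^! b^!.
Proof. by rewrite /tensor_star tlift_tens. Qed.

Lemma tensor_star_antilinear (c : K) x y :
  tensor_star (c *: x + y) = c^* *: tensor_star x + tensor_star y.
Proof. exact: (tlift_linear star_bil). Qed.

Let starD x y : tensor_star (x + y) = tensor_star x + tensor_star y.
Proof.
by have := tensor_star_antilinear 1 x y; rewrite rmorph1 !scale1r.
Qed.
Let star0 : tensor_star 0 = 0.
Proof.
have := tensor_star_antilinear (- 1) 0 0.
by rewrite rmorphN rmorph1 !scaler0 !addr0 !scaleN1r !addNr.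
Qed.

Lemma tensor_starM x y :
  tensor_star (tensor_mul x y) = tensor_mul (tensor_star y) (tensor_star x).
Proof.
move: x; apply: tensor_ind => [a b||x x' IHx IHx'].
- move: y; apply: tensor_ind => [a' b'||y y' IHy IHy'].
  + by rewrite tensor_mul_tens !tensor_star_tens tensor_mul_tens !sa_starM.
  + by rewrite mulx0 star0 mul0x.
  + by rewrite mulDr !starD mulDl IHy IHy'.
- by rewrite mul0x star0 mulx0.
- by rewrite mulDl !starD mulDr IHx IHx'.
Qed.

Lemma tensor_starK : involutive tensor_star.
Proof.
apply: tensor_ind => [a b||x y IHx IHy].
- by rewrite !tensor_star_tens !sa_starK.
- by rewrite !star0.
- by rewrite !starD IHx IHy.
Qed.

Definition tensor_algebra : star_algebra K := StarAlgebra
  tensor_mul_bilinear tensor_mulA tensor_star_antilinear tensor_starM tensor_starK.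

End TensorStarAlgebra.

(** A multiplier [m] is given by its two actions [b |-> m b] and [b |-> b m]. *)
Record multiplier (K : numClosedFieldType) (B : star_algebra K) := Multiplier {
  lmult : B -> B;
  rmult : B -> B;
  lmult_linear : linear lmult;
  rmult_linear : linear rmult;
  multP : forall a b : B, rmult a ** b = a ** lmult b }.

Lemma multiplier_eq (K : numClosedFieldType) (B : star_algebra K)
    (m n : multiplier B) : lmult m =1 lmult n -> rmult m =1 rmult n -> m = n.
Proof.
case: m n => [l r ll rl P] [l' r' ll' rl' P'] /= /funext el /funext er.
by case: _ / el ll' P' => ll' P'; case: _ / er rl' P' => rl' P';
  congr Multiplier; exact: Prop_irrelevance.
Qed.

Section MultiplierAlgebra.
Variables (K : numClosedFieldType) (B : star_algebra K).
Implicit Types m n : multiplier B.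

Let lin_comp (f g : B -> B) : linear f -> linear g -> linear (f \o g).
Proof. by move=> lf lg c x y /=; rewrite lg lf. Qed.

Let lin_star (f : B -> B) : linear f -> linear (fun b => (f b^!)^!).
Proof. by move=> lf c x y; rewrite sa_star_antilinear lf sa_star_antilinear conjCK. Qed.

Definition membed (a : B) : multiplier B := @Multiplier K B (sa_mul a) (sa_mul^~ a)
  ((sa_mul_bilinear B).2 a) ((sa_mul_bilinear B).1 a)
  (fun b c => esym (sa_mulA b a c)).

Lemma mscalar_multP (c : K) (a b : B) : (c *: a) ** b = a ** (c *: b).
Proof.
rewrite (scalable_linear ((sa_mul_bilinear B).1 b)).
by rewrite (scalable_linear ((sa_mul_bilinear B).2 a)).
Qed.

Lemma mscalar_linear (c : K) : linear (fun b : B => c *: b).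
Proof. by move=> k x y; rewrite scalerDr !scalerA mulrC. Qed.

Definition mscalar (c : K) : multiplier B :=
  Multiplier (mscalar_linear c) (mscalar_linear c) (mscalar_multP c).

Definition mone : multiplier B := mscalar 1.

Lemma mmul_multP m n (a b : B) :
  (rmult n \o rmult m) a ** b = a ** (lmult m \o lmult n) b.
Proof. by rewrite /= multP multP. Qed.

Definition mmul m n : multiplier B := Multiplier
  (lin_comp (lmult_linear m) (lmult_linear n))
  (lin_comp (rmult_linear n) (rmult_linear m)) (mmul_multP m n).

Lemma mstar_multP m (a b : B) : (lmult m a^!)^! ** b = a ** (rmult m b^!)^!.
Proof. by rewrite -[b in LHS]sa_starK -sa_starM -multP sa_starM sa_starK. Qed.

Definition mstar m : multiplier B := Multiplier
  (lin_star (rmult_linear m)) (lin_star (lmult_linear m)) (mstar_multP m).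

Lemma mlincomb_linear (c : K) (f g : B -> B) :
  linear f -> linear g -> linear (fun b => c *: f b + g b).
Proof.
move=> lf lg k x y; rewrite lf lg !scalerDr !scalerA mulrC -!addrA.
by congr (_ + _); rewrite addrCA.
Qed.

Lemma mlincomb_multP (c : K) m n (a b : B) :
  (c *: rmult m a + rmult n a) ** b = a ** (c *: lmult m b + lmult n b).
Proof.
by rewrite ((sa_mul_bilinear B).1 b) ((sa_mul_bilinear B).2 a) !multP.
Qed.

Definition mlincomb (c : K) m n : multiplier B := Multiplier
  (mlincomb_linear c (lmult_linear m) (lmult_linear n))
  (mlincomb_linear c (rmult_linear m) (rmult_linear n)) (mlincomb_multP c m n).

End MultiplierAlgebra.

Arguments mone {K B}.

Section MultiplierTensor.
Variables (K : numClosedFieldType) (A B : star_algebra K).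

Lemma tmap_bilinear (f : A -> A) (g : B -> B) : linear f -> linear g ->
  bilinear_map (fun a b => tens (f a) (g b)).
Proof.
move=> lf lg; split=> [v|u] c x y.
  by rewrite lf (tens_bilinear A B).1.
by rewrite lg (tens_bilinear A B).2.
Qed.

Lemma tmap_linear (f : A -> A) (g : B -> B) : linear f -> linear g ->
  linear (tmap f g).
Proof. by move=> lf lg; apply/tlift_linear/tmap_bilinear. Qed.

Lemma mtensor_multP (m : multiplier A) (n : multiplier B) (x y : tensor_algebra A B) :
  (tmap (rmult m) (rmult n) x : tensor_algebra A B) ** y =
  x ** (tmap (lmult m) (lmult n) y : tensor_algebra A B).
Proof.
have ll := tmap_linear (lmult_linear m) (lmult_linear n).
have lr := tmap_linear (rmult_linear m) (rmult_linear n).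
have bl := tmap_bilinear (lmult_linear m) (lmult_linear n).
have br := tmap_bilinear (rmult_linear m) (rmult_linear n).
have D0 (Z : lmodType K) (f : tensor A B -> Z) : linear f -> f 0 = 0.
  move=> lf; have := lf (- 1) 0 0.
  by rewrite !scaler0 !addr0 !scaleN1r !addNr.
have DD (Z : lmodType K) (f : tensor A B -> Z) : linear f ->
    forall u v, f (u + v) = f u + f v.
  by move=> lf u v; have := lf 1 u v; rewrite !scale1r.
have M := tensor_mul_bilinear A B; rewrite /sa_mul /=.
move: x; apply: tensor_ind => [a b||x x' IHx IHx'].
- move: y; apply: tensor_ind => [a' b'||y y' IHy IHy'].
  + by rewrite /tmap !tlift_tens// !tensor_mul_tens !multP.
  + by rewrite (D0 _ _ ll) !(D0 _ _ (M.2 _)).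
  + by rewrite (DD _ _ ll) !(DD _ _ (M.2 _)) IHy IHy'.
- by rewrite (D0 _ _ lr) !(D0 _ _ (M.1 _)).
- by rewrite (DD _ _ lr) !(DD _ _ (M.1 _)) IHx IHx'.
Qed.

Definition mtensor (m : multiplier A) (n : multiplier B) :
    multiplier (tensor_algebra A B) :=
  @Multiplier K (tensor_algebra A B) _ _
    (tmap_linear (lmult_linear m) (lmult_linear n))
    (tmap_linear (rmult_linear m) (rmult_linear n)) (mtensor_multP m n).

End MultiplierTensor.

(* [mh_T1] and [mh_T2] are the maps [a (x) b |-> Delta(a) (1 (x) b)] and
   [a (x) b |-> (a (x) 1) Delta(b)] of [A (x) A] onto itself. Coassociativity is
   [(a (x) 1 (x) 1) (Delta (x) id)(Delta(b) (1 (x) c)) =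
    (id (x) Delta)((a (x) 1) Delta(b)) (1 (x) 1 (x) c)], where both members are
   elements of [A (x) A (x) A]. *)
Record multiplier_hopf_star_algebra (K : numClosedFieldType) := MultiplierHopf {
  mh_alg :> star_algebra K;
  mh_nondegenerate : nondegenerate_product mh_alg;
  mh_Delta : mh_alg -> multiplier (tensor_algebra mh_alg mh_alg);
  mh_Delta_linear : forall (c : K) a b,
    mh_Delta (c *: a + b) = mlincomb c (mh_Delta a) (mh_Delta b);
  mh_DeltaM : forall a b, mh_Delta (a ** b) = mmul (mh_Delta a) (mh_Delta b);
  mh_Delta_star : forall a, mh_Delta a^! = mstar (mh_Delta a);
  mh_T1 : tensor mh_alg mh_alg -> tensor mh_alg mh_alg;
  mh_T1_linear : linear mh_T1;
  mh_T1_bij : bijective mh_T1;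
  mh_T1E : forall a b, membed (mh_T1 (tens a b) : tensor_algebra mh_alg mh_alg) =
    mmul (mh_Delta a) (mtensor mone (membed b));
  mh_T2 : tensor mh_alg mh_alg -> tensor mh_alg mh_alg;
  mh_T2_linear : linear mh_T2;
  mh_T2_bij : bijective mh_T2;
  mh_T2E : forall a b, membed (mh_T2 (tens a b) : tensor_algebra mh_alg mh_alg) =
    mmul (mtensor (membed a) mone) (mh_Delta b);
  mh_coassoc : forall a b c,
    tassocr (tmap mh_T2 idfun (tassocl (tens a (mh_T1 (tens b c))))) =
    tmap idfun mh_T1 (tassocr (tens (mh_T2 (tens a b)) c)) }.

Section Integrals.
Variables (K : numClosedFieldType) (A : multiplier_hopf_star_algebra K).
Local Notation AA := (tensor_algebra A A).

Definition slice_left (omega : A -> K) : AA -> A :=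
  tlift (fun a b => omega a *: b).
Definition slice_right (omega : A -> K) : AA -> A :=
  tlift (fun a b => omega b *: a).

(* [(iota (x) omega)(m) = n] in [M(A)], for [m] such that [m (b (x) 1)] and
   [(b (x) 1) m] are in [A (x) A] for all [b] in [A]. *)
Definition is_right_slice (omega : A -> K) (m : multiplier AA) (n : multiplier A) :=
  forall b : A,
    (exists2 y : AA, membed y = mmul m (mtensor (membed b) mone) &
                     slice_right omega y = lmult n b) /\
    (exists2 y : AA, membed y = mmul (mtensor (membed b) mone) m &
                     slice_right omega y = rmult n b).

(* [(omega (x) iota)(m) = n] *)
Definition is_left_slice (omega : A -> K) (m : multiplier AA) (n : multiplier A) :=
  forall b : A,
    (exists2 y : AA, membed y = mmul m (mtensor mone (membed b)) &
                     slice_left omega y = lmult n b) /\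
    (exists2 y : AA, membed y = mmul (mtensor mone (membed b)) m &
                     slice_left omega y = rmult n b).

Definition left_integral (phi : {scalar A}) :=
  (exists a, phi a != 0) /\
  forall a, is_right_slice phi (mh_Delta a) (mscalar A (phi a)).

Definition right_integral (psi : {scalar A}) :=
  (exists a, psi a != 0) /\
  forall a, is_left_slice psi (mh_Delta a) (mscalar A (psi a)).

Definition positive_functional (omega : A -> K) := forall a, 0 <= omega (a^! ** a).

End Integrals.

(* [hdot] is linear in its first argument. *)
Record hilbert (R : realType) := Hilbert {
  hilbert_sort :> completeNormedModType R[i];
  hdot : {dot hilbert_sort for @Num.conj R[i]};
  hdotE : forall x, `|x| ^+ 2 = hdot x x }.

Section Operators.
Variables (R : realType) (H : hilbert R).
Local Notation C := R[i].
Implicit Types (S T : H -> H) (M : set (H -> H)).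

Definition bounded_operator T :=
  linear T /\ exists k : C, forall x, `|T x| <= k * `|x|.

Definition opnorm T : R :=
  sup [set complex.Re `|T x| | x in [set x : H | `|x| <= 1]].

Definition positive_operator T := forall x, 0 <= hdot H (T x) x.

Definition operator_le S T := positive_operator (T - S).

Definition weak_operator_closure M : set (H -> H) := [set T | bounded_operator T /\
  forall (n : nat) (x y : 'I_n -> H) (e : C), 0 < e ->
    exists2 S, M S & forall i, `|hdot H (T (x i)) (y i) - hdot H (S (x i)) (y i)| < e].

Definition linear_span M : set (H -> H) := [set T |
  exists (n : nat) (c : 'I_n -> C) (S : 'I_n -> H -> H),
    (forall i, M (S i)) /\ T = \sum_(i < n) c i *: S i].

Definition positive_part M := [set T | M T /\ positive_operator T].

Local Open Scope ereal_scope.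

Definition is_weight M (w : (H -> H) -> \bar R) :=
  [/\ forall T, positive_part M T -> 0 <= w T,
      forall S T, positive_part M S -> positive_part M T -> w (S + T)%R = w S + w T
    & forall (c : R) T, (0 <= c)%R -> positive_part M T ->
        w (c%:C%C *: T)%R = c%:E * w T].

Definition faithful_weight M (w : (H -> H) -> \bar R) :=
  forall T, positive_part M T -> w T = 0 -> T = 0%R.

(* [D] plays the role of a bounded increasing net with supremum [T]. *)
Definition normal_weight M (w : (H -> H) -> \bar R) :=
  forall (D : set (H -> H)) T,
    D !=set0 -> D `<=` positive_part M ->
    (forall S1 S2, D S1 -> D S2 ->
       exists2 S, D S & operator_le S1 S /\ operator_le S2 S) ->
    positive_part M T -> (forall S, D S -> operator_le S T) ->
    (forall T', positive_part M T' -> (forall S, D S -> operator_le S T') ->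
       operator_le T T') ->
    w T = ereal_sup [set w S | S in D].

(* The positive elements of finite weight generate [M]; their span is a
   star-subalgebra, so it is weakly dense if and only if it is sigma-weakly dense. *)
Definition semifinite_weight M (w : (H -> H) -> \bar R) :=
  weak_operator_closure (linear_span [set T | positive_part M T /\ w T < +oo]) = M.

End Operators.

Section GNS.
Variables (R : realType) (A : star_algebra R[i]) (psi : A -> R[i]).
Variables (H : hilbert R) (Lambda : {linear A -> H}).

Definition gns_completion :=
  (forall a a', hdot H (Lambda a') (Lambda a) = psi (a^! ** a')) /\
  dense (range Lambda).

(* When [psi] is a positive right integral, the extension of left
   multiplication exists (and is unique by density): the default is not used. *)
Definition gns_rep (a : A) : H -> H :=
  xget (fun=> 0) [set T | bounded_operator T /\
                          forall x, T (Lambda x) = Lambda (a ** x)].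

Definition gns_vN_algebra : set (H -> H) := weak_operator_closure (range gns_rep).

Definition is_pi_r (eta : H) (T : H -> H) :=
  bounded_operator T /\ forall a, T (Lambda a) = gns_rep a eta.

Definition gns_weight (T : H -> H) : \bar R :=
  ereal_sup [set (complex.Re (hdot H (T eta) eta))%:E | eta in
    [set eta | exists2 P, is_pi_r eta P & opnorm P <= 1]].

End GNS.

(* Main.v *)
(** The proof replaces Tomita-Takesaki theory by two explicit minimization
    problems in Hilbert space.

    Algebra. The map [x (x) y |-> Delta(x) (1 (x) y)] is isometric for
    [psi (x) psi], hence left multiplication by a slice
    [(psi (x) iota)((x'^* (x) 1) Delta(x))] is bounded; such slices span [A], so
    [A] acts by bounded operators. Moreover every [b] admits [b'] such that
    [psi(x b) = psi(b'^* x)] for all [x], because [psi(- b)] is a sum of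
    functionals [(psi(- w) (x) phi(v -)) Delta], with [phi] a left integral,
    and each of these has the form [psi(d -)]. Therefore the right
    multiplication [Q] by [b] has a densely defined adjoint, which extends the
    right multiplication by [b'].

    Right bounded vectors. [(1 + t^2 Q Q^* )^-1 (Lambda b)] is right bounded and
    tends to [Lambda b] as [t] tends to 0. If the [eta_i] are right bounded with
    [T_i = pi_r(eta_i)], the minimizer [zeta] of
    [s sum_i |eta_i - T_i zeta|^2 + |zeta|^2] satisfies [|pi_r(zeta)| <= 1], and
    [T_i zeta] tends to [eta_i] as [s] tends to infinity.

    Weight. For [x >= 0] in [M] and contractive [T_i] in the commutant,
    [<x T_i zeta, T_i zeta> <= <x zeta, zeta>]; with the preceding approximation
    this makes the family of functionals [<x eta, eta>] directed enough for
    [psi_1] to be additive. Taking for [eta_i] the vectors of the first kind gives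
    [pi_r(zeta) (Lambda a) -> Lambda a], whence [psi_1(a^* a) = psi(a^* a)]. *)
Require Import Defs.
From mathcomp Require Import all_boot all_order all_algebra.
From mathcomp Require Import complex.
From mathcomp Require Import all_classical all_reals all_analysis.
From mathcomp Require Import ring lra.

Set Implicit Arguments.
Unset Strict Implicit.
Unset Printing Implicit Defensive.

Import Order.TTheory GRing.Theory Num.Theory.
Import numFieldNormedType.Exports.
Local Open Scope classical_set_scope.
Local Open Scope ring_scope.
Local Open Scope star_scope.

(** * Functionals and slices *)

(** No antipode is constructed: all that is used of it is the injectivity or surjectivity of the
    canonical maps. Without a unit, Sweedler expressions have no literal meaning; identities between
    them are proved by multiplying with an arbitrary tensor or by slicing a leg with functionals,
    and then using non-degeneracy.

    On the analytic side, no functional calculus and no theory of unbounded operators is set up.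
    With [G] the sum of the [T_i^* T_i], the minimizer [zeta] has [pi_r(zeta) = s G (1 + s G)^-1],
    the usual approximate unit of a left ideal; and [(1 + t^2 Q Q^* )^-1] is read off from the
    projection onto the closure of a graph. Both are instances of one projection lemma in finite
    powers of [H], which also yields strong approximation of the elements of [M]. The inequality
    between [T] at [P z] and [T] at [z], for [P] a contraction commuting with [T >= 0], is obtained
    from an expansion into squares instead of a square root. *)

Section LinearPredicate.
Variables (K : comNzRingType) (U V W : lmodType K).
Implicit Type f : U -> V.

Lemma lin0 f : linear f -> f 0 = 0.
Proof. by move=> lf; have := lf (-1) 0 0;
  rewrite scaler0 addr0 scaleN1r addNr. Qed.

Lemma linD f x y : linear f -> f (x + y) = f x + f y.
Proof. by move=> lf; have := lf 1 x y; rewrite !scale1r. Qed.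

Lemma linZ f c x : linear f -> f (c *: x) = c *: f x.
Proof. by move=> lf; rewrite -[c *: x]addr0 lf lin0// addr0. Qed.

Lemma linB f x y : linear f -> f (x - y) = f x - f y.
Proof. by move=> lf; rewrite linD// -scaleN1r linZ// scaleN1r. Qed.

Lemma lin_sum f (I : Type) (s : seq I) (P : pred I) (c : I -> U) : linear f ->
  f (\sum_(i <- s | P i) c i) = \sum_(i <- s | P i) f (c i).
Proof. by move=> lf; apply: (big_morph f) => [x y|];
  [exact: linD|exact: lin0]. Qed.

Lemma lin_comp (g : V -> W) f : linear g -> linear f -> linear (fun x => g (f x)).
Proof. by move=> lg lf c x y; rewrite lf lg. Qed.

Lemma linear_inverse f (g : V -> U) : linear f -> cancel f g -> cancel g f
  -> linear g.
Proof. by move=> lf fK gK c x y; rewrite -[RHS]fK lf !gK. Qed.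

Lemma lin_id : linear (fun x : U => x).
Proof. by []. Qed.

End LinearPredicate.

Section Functionals.
Variables (K : fieldType) (V : lmodType K).

(* A maximal subspace avoiding [p] is a hyperplane complementary to [p]. *)
Lemma functional_separates (p : V) : p != 0 ->
  exists f : V -> K^o, linear f /\ f p = 1.
Proof.
move=> p0.
pose sub (N : set V) := forall c x y, N x -> N y -> N (c *: x + y).
have [N [[sN Np] maxN]] := @Zorn_bigcup V
  (fun N => sub N /\ ~ N p) (fun F FP tF => conj
   (fun c x y '(ex_intro2 X FX Xx) '(ex_intro2 Y FY Yy) =>
      match tF X Y FX FY with
      | or_introl XY => ex_intro2 _ _ Y FY ((FP Y FY).1 c x y (XY _ Xx) Yy)
      | or_intror YX => ex_intro2 _ _ X FX ((FP X FX).1 c x y Xx (YX _ Yy))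
      end)
   (fun '(ex_intro2 X FX Xp) => (FP X FX).2 Xp)).
(* [sub] holds vacuously of the empty set, which lets the union of the empty chain through; that [N]
   contains 0 therefore has to come from maximality. *)
have N0 : N 0.
  apply: contrapT => N0; apply: (maxN (N `|` [set 0])).
    split=> [x|]; first by left.
    by move=> /(_ 0)/(_ (or_intror erefl)).
  split=> [c x y [Nx|->] [Ny|->]|[]//].
  - by left; apply: sN.
  - by case: N0; have := sN (-1) x x Nx Nx; rewrite scaleN1r addNr.
  - by left; rewrite scaler0 add0r.
  - by right; rewrite scaler0 addr0.
  - by move/eqP; rewrite (negPf p0).
have NZ c x : N x -> N (c *: x) by move=> Nx; rewrite -[_ *: _]addr0; apply: sN.
have ND x y : N x -> N y -> N (x + y).
  by move=> Nx Ny; rewrite -[x]scale1r; apply: sN.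
have NB x y : N x -> N y -> N (x - y).
  by move=> Nx Ny; rewrite addrC -scaleN1r; apply: sN.
have dec x : exists c, N (x - c *: p).
  have [Nx|Nx] := pselect (N x); first by exists 0; rewrite scale0r subr0.
  apply: contrapT => noc.
  apply: (maxN [set y | exists c n, N n /\ y = n + c *: x]).
    split=> [y Ny|sub']; first by exists 0, y; rewrite scale0r addr0.
    by apply: Nx; apply: sub'; exists 1, 0; rewrite scale1r add0r.
  split=> [c y z [a [n [Nn ->]]] [b [m [Nm ->]]]|[c [n [Nn pE]]]].
    exists (c * a + b), (c *: n + m); split; first exact: sN.
    by rewrite scalerDr scalerA scalerDl !addrA; congr (_ + _); rewrite addrAC.
  have c0 : c != 0.
    by apply: contraPneq Np => c0; rewrite pE c0 scale0r addr0; apply.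
  apply: noc; exists c^-1; rewrite {1}pE scalerDr scalerA mulVf// scale1r.
  by rewrite opprD addrCA subrr addr0 -scaleNr; apply: NZ.
have [f fP] := choice dec.
have uni c x : N (x - c *: p) -> f x = c.
  move=> Nc; apply: contrapT => /eqP; rewrite -subr_eq0 => ne.
  have := NB _ _ Nc (fP x).
  rewrite opprD opprK addrACA subrr add0r addrC -scaleNr -scalerDl.
  move=> /(NZ (f x - c)^-1); rewrite scalerA mulVf// scale1r.
  exact: Np.
exists f; split; last by apply: uni; rewrite scale1r subrr.
move=> c x y; apply: uni.
rewrite scalerDl opprD addrACA; apply: ND (fP y).
by rewrite -scalerA -scalerBr; apply: NZ.
Qed.

Lemma functional_eq (x y : V) :
  (forall f : V -> K^o, linear f -> f x = f y) -> x = y.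
Proof.
move=> h; apply: contrapT => /eqP; rewrite -subr_eq0 => /functional_separates[f].
move=> [lf]; rewrite linB// (h f lf) subrr => /eqP.
by rewrite eq_sym oner_eq0.
Qed.

End Functionals.

Section TensorSlices.
Variables (K : comNzRingType) (U V : lmodType K).
Local Notation UV := (tensor U V).

Lemma tensor_ext (Z : lmodType K) (g h : UV -> Z) : linear g -> linear h ->
  (forall u v, g (tens u v) = h (tens u v)) -> forall X, g X = h X.
Proof.
move=> lg lh gh; apply: tensor_ind => // [|x y gx gy].
  by rewrite !lin0.
by rewrite !linD// gx gy.
Qed.

Lemma tensor_sum (X : UV) : exists s : seq (U * V), X = \sum_(p
  <- s) tens p.1 p.2.
Proof. by exists (repr X); exact: tensorE. Qed.

Lemma tensDl (u u' : U) (v : V) : tens (u + u') v = tens u v + tens u' v.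
Proof. exact: linD ((tens_bilinear U V).1 v). Qed.
Lemma tensDr (u : U) (v v' : V) : tens u (v + v') = tens u v + tens u v'.
Proof. exact: linD ((tens_bilinear U V).2 u). Qed.
Lemma tensZl c (u : U) (v : V) : tens (c *: u) v = c *: tens u v.
Proof. exact: linZ ((tens_bilinear U V).1 v). Qed.
Lemma tensZr c (u : U) (v : V) : tens u (c *: v) = c *: tens u v.
Proof. exact: linZ ((tens_bilinear U V).2 u). Qed.
Lemma tens0l (v : V) : tens 0 v = 0 :> UV.
Proof. exact: lin0 ((tens_bilinear U V).1 v). Qed.

Definition lslice (f : U -> K) : UV -> V := tlift (fun u v => f u *: v).
Definition rslice (g : V -> K) : UV -> U := tlift (fun u v => g v *: u).

Lemma lslice_bil (f : U -> K^o) : linear f ->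
  bilinear_map (fun u (v : V) => f u *: v).
Proof.
move=> lf; split=> [v|u] c x y /=; first by rewrite lf scalerDl scalerA.
by rewrite scalerDr !scalerA mulrC.
Qed.

Lemma rslice_bil (g : V -> K^o) : linear g ->
  bilinear_map (fun (u : U) v => g v *: u).
Proof.
move=> lg; split=> [v|u] c x y /=; last by rewrite lg scalerDl scalerA.
by rewrite scalerDr !scalerA mulrC.
Qed.

Lemma lslice_linear (f : U -> K^o) : linear f -> linear (lslice f).
Proof. by move=> lf; apply/tlift_linear/lslice_bil. Qed.
Lemma lslice_tens (f : U -> K^o) u v : linear f -> lslice f (tens u v) = f u *: v.
Proof. by move=> lf; rewrite /lslice tlift_tens//; exact: lslice_bil. Qed.
Lemma rslice_linear (g : V -> K^o) : linear g -> linear (rslice g).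
Proof. by move=> lg; apply/tlift_linear/rslice_bil. Qed.
Lemma rslice_tens (g : V -> K^o) u v : linear g -> rslice g (tens u v) = g v *: u.
Proof. by move=> lg; rewrite /rslice tlift_tens//; exact: rslice_bil. Qed.

Lemma slices_comm (f : U -> K^o) (g : V -> K^o) (X : UV) : linear f -> linear g ->
  f (rslice g X) = g (lslice f X).
Proof.
move=> lf lg; move: X; apply: (@tensor_ext K^o) => [||u v].
- by apply: lin_comp => //; exact: rslice_linear.
- by apply: lin_comp => //; exact: lslice_linear.
- by rewrite rslice_tens// lslice_tens// linZ// linZ// /GRing.scale/= mulrC.
Qed.

End TensorSlices.

Section TensorSeparation.
Variables (K : fieldType) (U V : lmodType K).
Local Notation UV := (tensor U V).

(** Induction on the number of terms of a representing sum. If [f u = 1], the vanishing of the slice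
    by [f] writes [v] as a combination of the other second legs; substituting it leaves a sum with
    one term less. No basis is chosen. *)
Lemma tensor_eq0 (X : UV) :
  (forall f : U -> K^o, linear f -> lslice f X = 0) -> X = 0.
Proof.
have [s ->] := tensor_sum X.
have [n] := ubnP (size s); elim: n s => // n IH [|[u v] s];
  first by rewrite big_nil.
rewrite /= ltnS => sn; rewrite big_cons /=.
have [->|/functional_separates[f [lf fu]]] := eqVneq u 0.
  by rewrite tens0l add0r; exact: IH.
move=> h; have := h f lf.
have ll := lslice_linear (V := V) lf.
rewrite (linD _ _ ll) lslice_tens// fu scale1r (lin_sum _ _ _ ll).
move/eqP; rewrite addr_eq0 => /eqP vE.
have E : tens u v + \sum_(p <- s) tens p.1 p.2 =
    \sum_(p <- [seq (p.1 - f p.1 *: u, p.2) | p <- s]) tens p.1 p.2 :> UV.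
  rewrite big_map /= vE -sumrN.
  rewrite (lin_sum _ _ _ ((tens_bilinear U V).2 u)) -big_split /=.
  apply: eq_bigr => p _.
  by rewrite lslice_tens// -scaleNr tensZr tensDl -scaleNr tensZl addrC.
move: h; rewrite E; apply: IH; by rewrite size_map.
Qed.

Lemma tensor_eq (X Y : UV) :
  (forall f : U -> K^o, linear f -> lslice f X = lslice f Y) -> X = Y.
Proof.
move=> h; apply/eqP; rewrite -subr_eq0; apply/eqP/tensor_eq0 => f lf.
by rewrite (linB _ _ (lslice_linear lf)) h// subrr.
Qed.

End TensorSeparation.

(** * Multipliers of the tensor square *)

Section Nondegenerate.
Variables (K : numClosedFieldType) (B : star_algebra K).
Hypothesis ndB : nondegenerate_product B.

Lemma sa_mulDl (x y z : B) : (x + y) ** z = x ** z + y ** z.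
Proof. exact: linD ((sa_mul_bilinear B).1 z). Qed.
Lemma sa_mulDr (x y z : B) : z ** (x + y) = z ** x + z ** y.
Proof. exact: linD ((sa_mul_bilinear B).2 z). Qed.
Lemma sa_mulBl (x y z : B) : (x - y) ** z = x ** z - y ** z.
Proof. exact: linB ((sa_mul_bilinear B).1 z). Qed.
Lemma sa_mulBr (x y z : B) : z ** (x - y) = z ** x - z ** y.
Proof. exact: linB ((sa_mul_bilinear B).2 z). Qed.
Lemma sa_mulZl c (x z : B) : (c *: x) ** z = c *: (x ** z).
Proof. exact: linZ ((sa_mul_bilinear B).1 z). Qed.
Lemma sa_mulZr c (x z : B) : z ** (c *: x) = c *: (z ** x).
Proof. exact: linZ ((sa_mul_bilinear B).2 z). Qed.
Lemma sa_mul0l (z : B) : 0 ** z = 0.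
Proof. exact: lin0 ((sa_mul_bilinear B).1 z). Qed.
Lemma sa_mul0r (z : B) : z ** 0 = 0.
Proof. exact: lin0 ((sa_mul_bilinear B).2 z). Qed.
Lemma linmul_l (z : B) : linear (fun x : B => z ** x).
Proof. exact: (sa_mul_bilinear B).2 z. Qed.
Lemma linmul_r (z : B) : linear (fun x : B => x ** z).
Proof. exact: (sa_mul_bilinear B).1 z. Qed.
Lemma starD (x y : B) : (x + y)^! = x^! + y^!.
Proof. by have := sa_star_antilinear 1 x y; rewrite rmorph1 !scale1r. Qed.
Lemma star0 : (0 : B)^! = 0.
Proof.
have := sa_star_antilinear (-1) (0 : B) 0.
by rewrite rmorphN rmorph1 scaler0 addr0 scaleN1r addNr.
Qed.
Lemma starZ c (x : B) : (c *: x)^! = c^* *: x^!.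
Proof. by rewrite -[_ *: x]addr0 sa_star_antilinear star0 addr0. Qed.
Lemma star_sum (I : Type) (s : seq I) (F : I -> B) :
  (\sum_(i <- s) F i)^! = \sum_(i <- s) (F i)^!.
Proof. by apply: (big_morph (@sa_star K B)); [exact: starD|exact: star0]. Qed.

Lemma nondeg_eql (x y : B) : (forall z, x ** z = y ** z) -> x = y.
Proof.
move=> h; apply/eqP; rewrite -subr_eq0; apply/eqP/ndB.1 => z.
by rewrite sa_mulBl h subrr.
Qed.

Lemma nondeg_eqr (x y : B) : (forall z, z ** x = z ** y) -> x = y.
Proof.
move=> h; apply/eqP; rewrite -subr_eq0; apply/eqP/ndB.2 => z.
by rewrite sa_mulBr h subrr.
Qed.

(** Non-degeneracy turns the mere compatibility [multP] of the two actions into module-map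
    properties; [DeltaLM] and [DeltaRM] rest on this one and on its mirror image. *)
Lemma lmultM (m : multiplier B) x y : lmult m (x ** y) = lmult m x ** y.
Proof. by apply: nondeg_eqr => z; rewrite -multP !sa_mulA multP. Qed.

Lemma rmultM (m : multiplier B) x y : rmult m (x ** y) = x ** rmult m y.
Proof. by apply: nondeg_eql => z; rewrite multP -!sa_mulA multP. Qed.

Lemma membed_inj (x y : B) : membed x = membed y -> x = y.
Proof. by move=> xy; apply: nondeg_eql => z;
  have := congr1 (@lmult _ _ ^~ z) xy. Qed.

End Nondegenerate.

Section TensorMap.
Variables (K : comNzRingType) (U V U' V' : lmodType K).
Variables (f : U -> U') (g : V -> V').
Hypotheses (lf : linear f) (lg : linear g).

Lemma tens_comp_bil : bilinear_map (fun a b => tens (f a) (g b)).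
Proof.
split=> [v|u] c x y /=.
  by rewrite lf tensDl tensZl.
by rewrite lg tensDr tensZr.
Qed.
Lemma linear_tmap : linear (tmap f g).
Proof. exact/tlift_linear/tens_comp_bil. Qed.
Lemma tmap_tens u v : tmap f g (tens u v) = tens (f u) (g v).
Proof. by rewrite /tmap tlift_tens//; exact: tens_comp_bil. Qed.

End TensorMap.

Section OneLeg.
Variables (K : numClosedFieldType) (A : star_algebra K).
Local Notation AA := (tensor A A).
Local Notation "X *t Y" := (tensor_mul X Y) (at level 40, left associativity).

(** Without a unit, [a (x) 1] is not an element of [tensor A A]; these four maps are its one-sided
    multiplications and those of [1 (x) b]. *)
Definition leg1l (a : A) : AA -> AA := tmap (fun x => a ** x) (fun y : A => y).
Definition leg1r (a : A) : AA -> AA := tmap (fun x => x ** a) (fun y : A => y).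
Definition leg2l (b : A) : AA -> AA := tmap (fun x : A => x) (fun y => b ** y).
Definition leg2r (b : A) : AA -> AA := tmap (fun x : A => x) (fun y => y ** b).

Lemma leg1l_lin a : linear (leg1l a).
Proof. exact: linear_tmap (linmul_l a) (@lin_id _ _). Qed.
Lemma leg1r_lin a : linear (leg1r a).
Proof. exact: linear_tmap (linmul_r a) (@lin_id _ _). Qed.
Lemma leg2l_lin a : linear (leg2l a).
Proof. exact: linear_tmap (@lin_id _ _) (linmul_l a). Qed.
Lemma leg2r_lin a : linear (leg2r a).
Proof. exact: linear_tmap (@lin_id _ _) (linmul_r a). Qed.
Lemma leg1l_tens a x y : leg1l a (tens x y) = tens (a ** x) y.
Proof. exact: tmap_tens (linmul_l a) (@lin_id _ _) _ _. Qed.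
Lemma leg1r_tens a x y : leg1r a (tens x y) = tens (x ** a) y.
Proof. exact: tmap_tens (linmul_r a) (@lin_id _ _) _ _. Qed.
Lemma leg2l_tens a x y : leg2l a (tens x y) = tens x (a ** y).
Proof. exact: tmap_tens (@lin_id _ _) (linmul_l a) _ _. Qed.
Lemma leg2r_tens a x y : leg2r a (tens x y) = tens x (y ** a).
Proof. exact: tmap_tens (@lin_id _ _) (linmul_r a) _ _. Qed.
Definition leg_tens := (leg1l_tens, leg1r_tens, leg2l_tens, leg2r_tens).

Lemma tmul_linl (Y : AA) : linear (fun X => X *t Y).
Proof. exact: (tensor_mul_bilinear A A).1 Y. Qed.
Lemma tmul_linr (X : AA) : linear (fun Y => X *t Y).
Proof. exact: (tensor_mul_bilinear A A).2 X. Qed.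

Lemma tensor_ext2 (Z : lmodType K) (g h : AA -> AA -> Z) :
  (forall Y, linear (g^~ Y)) -> (forall Y, linear (h^~ Y)) ->
  (forall X, linear (g X)) -> (forall X, linear (h X)) ->
  (forall a b a' b', g (tens a b) (tens a' b') = h (tens a b) (tens a' b')) ->
  forall X Y, g X Y = h X Y.
Proof.
move=> gl hl gr hr gh X Y.
apply: (tensor_ext (gl Y) (hl Y)) X => a b.
by apply: (tensor_ext (gr _) (hr _)) Y => a' b'.
Qed.

Lemma leg1lM a X Y : leg1l a X *t Y = leg1l a (X *t Y).
Proof.
apply: (tensor_ext2 (g := fun X Y => leg1l a X *t Y)
  (h := fun X Y => leg1l a (X *t Y))) X Y => [Y|Y|X|X|*].
- exact: lin_comp (tmul_linl Y) (leg1l_lin a).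
- exact: lin_comp (leg1l_lin a) (tmul_linl Y).
- exact: tmul_linr.
- exact: lin_comp (leg1l_lin a) (tmul_linr X).
- by rewrite /= !(leg_tens, tensor_mul_tens) ?sa_mulA.
Qed.
Lemma leg2lM a X Y : leg2l a X *t Y = leg2l a (X *t Y).
Proof.
apply: (tensor_ext2 (g := fun X Y => leg2l a X *t Y)
  (h := fun X Y => leg2l a (X *t Y))) X Y => [Y|Y|X|X|*].
- exact: lin_comp (tmul_linl Y) (leg2l_lin a).
- exact: lin_comp (leg2l_lin a) (tmul_linl Y).
- exact: tmul_linr.
- exact: lin_comp (leg2l_lin a) (tmul_linr X).
- by rewrite /= !(leg_tens, tensor_mul_tens) ?sa_mulA.
Qed.
Lemma leg1rl a X Y : leg1r a X *t Y = X *t leg1l a Y.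
Proof.
apply: (tensor_ext2 (g := fun X Y => leg1r a X *t Y)
  (h := fun X Y => X *t leg1l a Y)) X Y => [Y|Y|X|X|*].
- exact: lin_comp (tmul_linl Y) (leg1r_lin a).
- exact: tmul_linl.
- exact: tmul_linr.
- exact: lin_comp (tmul_linr X) (leg1l_lin a).
- by rewrite /= !(leg_tens, tensor_mul_tens) ?sa_mulA.
Qed.
Lemma leg2rl a X Y : leg2r a X *t Y = X *t leg2l a Y.
Proof.
apply: (tensor_ext2 (g := fun X Y => leg2r a X *t Y)
  (h := fun X Y => X *t leg2l a Y)) X Y => [Y|Y|X|X|*].
- exact: lin_comp (tmul_linl Y) (leg2r_lin a).
- exact: tmul_linl.
- exact: tmul_linr.
- exact: lin_comp (tmul_linr X) (leg2l_lin a).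
- by rewrite /= !(leg_tens, tensor_mul_tens) ?sa_mulA.
Qed.
Lemma leg12l a b X : leg1l a (leg2l b X) = tens a b *t X.
Proof.
apply: (tensor_ext (g := fun X => leg1l a (leg2l b X))
  (h := fun X => tens a b *t X)) X => [||x y].
- exact: lin_comp (leg1l_lin a) (leg2l_lin b).
- exact: tmul_linr.
- by rewrite /= !(leg_tens, tensor_mul_tens).
Qed.
Lemma leg21l a b X : leg2l b (leg1l a X) = tens a b *t X.
Proof.
apply: (tensor_ext (g := fun X => leg2l b (leg1l a X))
  (h := fun X => tens a b *t X)) X => [||x y].
- exact: lin_comp (leg2l_lin b) (leg1l_lin a).
- exact: tmul_linr.
- by rewrite /= !(leg_tens, tensor_mul_tens).
Qed.
Lemma leg21r a b X : leg2r b (leg1r a X) = X *t tens a b.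
Proof.
apply: (tensor_ext (g := fun X => leg2r b (leg1r a X))
  (h := fun X => X *t tens a b)) X => [||x y].
- exact: lin_comp (leg2r_lin b) (leg1r_lin a).
- exact: tmul_linl.
- by rewrite /= !(leg_tens, tensor_mul_tens).
Qed.

Section LegSlices.
Variable f : A -> K^o.
Hypothesis lf : linear f.
Let lsl := lslice_linear (V := A) lf.
Let rsl := rslice_linear (U := A) lf.

Lemma lslice2l b X : lslice f (leg2l b X) = b ** lslice f X.
Proof.
apply: (tensor_ext (g := fun X => lslice f (leg2l b X))
  (h := fun X => b ** lslice f X)) X => [||x y].
- exact: lin_comp lsl (leg2l_lin b).
- exact: lin_comp (linmul_l b) lsl.
- by rewrite leg_tens !lslice_tens// sa_mulZr.
Qed.
Lemma lslice2r b X : lslice f (leg2r b X) = lslice f X ** b.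
Proof.
apply: (tensor_ext (g := fun X => lslice f (leg2r b X))
  (h := fun X => lslice f X ** b)) X => [||x y].
- exact: lin_comp lsl (leg2r_lin b).
- exact: lin_comp (linmul_r b) lsl.
- by rewrite leg_tens !lslice_tens// sa_mulZl.
Qed.
Lemma rslice1r b X : rslice f (leg1r b X) = rslice f X ** b.
Proof.
apply: (tensor_ext (g := fun X => rslice f (leg1r b X))
  (h := fun X => rslice f X ** b)) X => [||x y].
- exact: lin_comp rsl (leg1r_lin b).
- exact: lin_comp (linmul_r b) rsl.
- by rewrite leg_tens !rslice_tens// sa_mulZl.
Qed.
Lemma linear_fmull a : linear (fun x => f (a ** x)).
Proof. exact: lin_comp lf (linmul_l a). Qed.
Lemma linear_fmulr a : linear (fun x => f (x ** a)).
Proof. exact: lin_comp lf (linmul_r a). Qed.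
Lemma lslice1l a X : lslice f (leg1l a X) = lslice (fun x => f (a ** x)) X.
Proof.
apply: (tensor_ext (g := fun X => lslice f (leg1l a X))
  (h := fun X => lslice (fun x => f (a ** x)) X)) X => [||x y].
- exact: lin_comp lsl (leg1l_lin a).
- exact: lslice_linear (linear_fmull a).
- rewrite leg_tens lslice_tens// (lslice_tens (f := fun x => f (a ** x)))//.
  exact: linear_fmull.
Qed.
Lemma lslice1r a X : lslice f (leg1r a X) = lslice (fun x => f (x ** a)) X.
Proof.
apply: (tensor_ext (g := fun X => lslice f (leg1r a X))
  (h := fun X => lslice (fun x => f (x ** a)) X)) X => [||x y].
- exact: lin_comp lsl (leg1r_lin a).
- exact: lslice_linear (linear_fmulr a).
- rewrite leg_tens lslice_tens// (lslice_tens (f := fun x => f (x ** a)))//.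
  exact: linear_fmulr.
Qed.
End LegSlices.

Hypothesis ndA : nondegenerate_product A.

(** Multiplying [X] by [tens c e] and slicing the first leg by [f] gives the slice of [X] by
    [f(- c)], times [e]. Non-degeneracy of [A] then removes [e] from the second leg and [c] from the
    first, and functionals separate what remains. *)
Lemma tensor_nondegl (X : AA) : (forall Y, X *t Y = 0) -> X = 0.
Proof.
move=> X0.
have H1 f c : linear (f : A -> K^o) -> lslice (fun x => f (x ** c)) X = 0.
  move=> lf; apply: ndA.1 => e; rewrite -lslice1r// -lslice2r//.
  by rewrite leg21r X0 (lin0 (lslice_linear lf)).
have H2 g : linear (g : A -> K^o) -> rslice g X = 0.
  move=> lg; apply: ndA.1 => c; apply: functional_eq => f lf.
  rewrite (slices_comm (f := fun x => f
    (x ** c)) X _ lg) ?H1 ?(lin0 lf) ?(lin0 lg)//.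
  exact: linear_fmulr.
apply: tensor_eq0 => f lf; apply: functional_eq => g lg.
by rewrite -slices_comm// H2// (lin0 lf) (lin0 lg).
Qed.

Lemma tensor_nondeg : nondegenerate_product (tensor_algebra A A).
Proof.
split=> X X0; first exact: tensor_nondegl.
rewrite -[X]tensor_starK -[RHS](star0 (tensor_algebra A A)) /sa_star /=;
  congr tensor_star.
apply: tensor_nondegl => Y.
rewrite -[Y]tensor_starK -tensor_starM; have := X0 (tensor_star Y).
rewrite /sa_mul /= => ->.
exact: (star0 (tensor_algebra A A)).
Qed.

End OneLeg.

(** * The four canonical maps *)

Section HopfIdentities.
Variables (K : numClosedFieldType) (A : multiplier_hopf_star_algebra K).
Local Notation AA := (tensor A A).
Local Notation "X *t Y" := (tensor_mul X Y) (at level 40, left associativity).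
Local Notation T1 := (@mh_T1 K A).
Local Notation T2 := (@mh_T2 K A).
Implicit Types (a b c x y z : A) (X Y Z : AA).
Let ndA : nondegenerate_product A := mh_nondegenerate A.
Let ndAA : nondegenerate_product (tensor_algebra A A) := tensor_nondeg ndA.

Definition DeltaL (a : A) : AA -> AA := lmult (mh_Delta a).
Definition DeltaR (a : A) : AA -> AA := rmult (mh_Delta a).
(* [hopf_T3 a b] is [Delta(a) (b (x) 1)], [hopf_T4 a b] is [(1 (x) b) Delta(a)]. *)
Definition hopf_T3 (a b : A) : AA := tensor_star (T2 (tens b^! a^!)).
Definition hopf_T4 (a b : A) : AA := tensor_star (T1 (tens a^! b^!)).
Local Notation T3 := hopf_T3.
Local Notation T4 := hopf_T4.

Lemma DeltaL_lin a : linear (DeltaL a).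
Proof. exact: (lmult_linear (mh_Delta a)). Qed.
Lemma DeltaR_lin a : linear (DeltaR a).
Proof. exact: (rmult_linear (mh_Delta a)). Qed.
Lemma DeltaLM a X Y : DeltaL a (X *t Y) = DeltaL a X *t Y.
Proof. exact: (lmultM ndAA). Qed.
Lemma DeltaRM a X Y : DeltaR a (X *t Y) = X *t DeltaR a Y.
Proof. exact: (rmultM ndAA). Qed.
Lemma DeltaRL a X Y : DeltaR a X *t Y = X *t DeltaL a Y.
Proof. exact: (multP (mh_Delta a)). Qed.
Lemma DeltaL_mul a b X : DeltaL (a ** b) X = DeltaL a (DeltaL b X).
Proof. by rewrite /DeltaL mh_DeltaM. Qed.
Lemma DeltaR_mul a b X : DeltaR (a ** b) X = DeltaR b (DeltaR a X).
Proof. by rewrite /DeltaR mh_DeltaM. Qed.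
Lemma DeltaL_star a X : DeltaL a^! X = tensor_star (DeltaR a (tensor_star X)).
Proof. by rewrite /DeltaL mh_Delta_star. Qed.
Lemma DeltaR_star a X : DeltaR a^! X = tensor_star (DeltaL a (tensor_star X)).
Proof. by rewrite /DeltaR mh_Delta_star. Qed.

Lemma nondegAA_l (X Y : AA) : (forall Z, X *t Z = Y *t Z) -> X = Y.
Proof. exact: (nondeg_eql ndAA). Qed.
Lemma nondegAA_r (X Y : AA) : (forall Z, Z *t X = Z *t Y) -> X = Y.
Proof. exact: (nondeg_eqr ndAA). Qed.

Let scale1_eq (f : A -> A) (X : AA) : linear f ->
  tmap (fun b : A => 1 *: b) f X = tmap (fun b => b) f X.
Proof.
move=> lf; congr tmap.
by apply/funext => b; rewrite scale1r.
Qed.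
Let eq_scale1 (f : A -> A) (X : AA) : linear f ->
  tmap f (fun b : A => 1 *: b) X = tmap f (fun b => b) X.
Proof.
move=> lf; congr tmap.
by apply/funext => b; rewrite scale1r.
Qed.

Lemma T1mull a b X : T1 (tens a b) *t X = DeltaL a (leg2l b X).
Proof.
have := congr1 (fun m : multiplier (tensor_algebra A A) => lmult m X)
  (mh_T1E a b).
by rewrite /= /sa_mul /= scale1_eq//; exact: linmul_l.
Qed.
Lemma T1mulr a b X : X *t T1 (tens a b) = leg2r b (DeltaR a X).
Proof.
have := congr1 (fun m : multiplier (tensor_algebra A A) => rmult m X)
  (mh_T1E a b).
by rewrite /= /sa_mul /= scale1_eq//; exact: linmul_r.
Qed.
Lemma T2mull a b X : T2 (tens a b) *t X = leg1l a (DeltaL b X).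
Proof.
have := congr1 (fun m : multiplier (tensor_algebra A A) => lmult m X)
  (mh_T2E a b).
by rewrite /= /sa_mul /= eq_scale1//; exact: linmul_l.
Qed.
Lemma T2mulr a b X : X *t T2 (tens a b) = DeltaR b (leg1r a X).
Proof.
have := congr1 (fun m : multiplier (tensor_algebra A A) => rmult m X)
  (mh_T2E a b).
by rewrite /= /sa_mul /= eq_scale1//; exact: linmul_r.
Qed.

Lemma tstar0 : tensor_star (0 : AA) = 0.
Proof. exact: (star0 (tensor_algebra A A)). Qed.
Lemma tstarD X Y : tensor_star (X + Y) = tensor_star X + tensor_star Y.
Proof. exact: (@starD K (tensor_algebra A A)). Qed.
Lemma tstar_sum (I : Type) (s : seq I) (F : I -> AA) :
  tensor_star (\sum_(i <- s) F i) = \sum_(i <- s) tensor_star (F i).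
Proof. exact: (@star_sum K (tensor_algebra A A)). Qed.

Lemma leg1_star a X : tensor_star (leg1l a X) = leg1r a^! (tensor_star X).
Proof.
move: X; apply: tensor_ind => [x y||X Y IHX IHY].
- by rewrite leg_tens !tensor_star_tens leg_tens sa_starM.
- by rewrite (lin0 (leg1l_lin _)) tstar0 (lin0 (leg1r_lin _)).
- by rewrite (linD _ _ (leg1l_lin _)) !tstarD (linD _ _ (leg1r_lin _)) IHX IHY.
Qed.
Lemma leg2_star a X : tensor_star (leg2l a X) = leg2r a^! (tensor_star X).
Proof.
move: X; apply: tensor_ind => [x y||X Y IHX IHY].
- by rewrite leg_tens !tensor_star_tens leg_tens sa_starM.
- by rewrite (lin0 (leg2l_lin _)) tstar0 (lin0 (leg2r_lin _)).
- by rewrite (linD _ _ (leg2l_lin _)) !tstarD (linD _ _ (leg2r_lin _)) IHX IHY.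
Qed.
Lemma leg1_star' a X : tensor_star (leg1r a X) = leg1l a^! (tensor_star X).
Proof. by rewrite -[leg1l _ _]tensor_starK leg1_star sa_starK tensor_starK. Qed.
Lemma leg2_star' a X : tensor_star (leg2r a X) = leg2l a^! (tensor_star X).
Proof. by rewrite -[leg2l _ _]tensor_starK leg2_star sa_starK tensor_starK. Qed.

Let DeltaLs a X : tensor_star (DeltaL a X) = DeltaR a^! (tensor_star X).
Proof. by rewrite DeltaR_star tensor_starK. Qed.
Let DeltaRs a X : tensor_star (DeltaR a X) = DeltaL a^! (tensor_star X).
Proof. by rewrite DeltaL_star tensor_starK. Qed.

Lemma T3mull a b X : T3 a b *t X = DeltaL a (leg1l b X).
Proof.
rewrite -[LHS]tensor_starK tensor_starM tensor_starK T2mulr DeltaRs leg1_star'.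
by rewrite tensor_starK !sa_starK.
Qed.
Lemma T4mull a b X : T4 a b *t X = leg2l b (DeltaL a X).
Proof.
rewrite -[LHS]tensor_starK tensor_starM tensor_starK T1mulr leg2_star' DeltaRs.
by rewrite tensor_starK !sa_starK.
Qed.
Lemma T4mulr a b X : X *t T4 a b = DeltaR a (leg2r b X).
Proof.
rewrite -[LHS]tensor_starK tensor_starM tensor_starK T1mull DeltaLs leg2_star.
by rewrite tensor_starK !sa_starK.
Qed.

Lemma T1_lin : linear T1. Proof. exact: mh_T1_linear. Qed.
Lemma T2_lin : linear T2. Proof. exact: mh_T2_linear. Qed.
Lemma T1_surj X : exists Y, T1 Y = X.
Proof. by have [g _ gK] := mh_T1_bij A; exists (g X). Qed.
Lemma T2_surj X : exists Y, T2 Y = X.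
Proof. by have [g _ gK] := mh_T2_bij A; exists (g X). Qed.

Lemma T3_bil : bilinear_map T3.
Proof.
have h (c : K) X Y : tensor_star (c^* *: X + Y) = c *: tensor_star X
  + tensor_star Y :> AA.
  by rewrite tensor_star_antilinear conjCK.
split=> [b|a] c x y; rewrite /T3 sa_star_antilinear.
  by rewrite tensDr tensZr T2_lin h.
by rewrite tensDl tensZl T2_lin h.
Qed.

Lemma T4_span X : exists s : seq (A * A), X = \sum_(p <- s) T4 p.1 p.2.
Proof.
have [Y YE] := T1_surj (tensor_star X).
have [s sE] := tensor_sum Y.
exists [seq (p.1^!, p.2^!) | p <- s].
rewrite big_map /= -[X]tensor_starK -YE sE (lin_sum _ _ _ T1_lin).
rewrite tstar_sum; apply: eq_bigr => p _.
by rewrite /T4 !sa_starK.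
Qed.

(** Both members are [(c (x) 1) Delta(a) (1 (x) b)]. This and the next two identities trade one
    canonical map for another, so that a slice of the first becomes a slice of the second times an
    element of [A]. *)
Lemma leg1l_T1 a b c : leg1l c (T1 (tens a b)) = leg2r b (T2 (tens c a)).
Proof. by apply: nondegAA_l => Z; rewrite leg1lM T1mull leg2rl T2mull. Qed.
Lemma leg1r_T1 a b c : leg1r c (T1 (tens a b)) = leg2r b (T3 a c).
Proof.
apply: nondegAA_l => Z.
by rewrite leg1rl T1mull leg2rl T3mull leg21l leg12l.
Qed.
Lemma leg2l_T3 a b c : leg2l c (T3 a b) = leg1r b (T4 a c).
Proof. by apply: nondegAA_l => Z; rewrite leg2lM T3mull leg1rl T4mull. Qed.

Lemma DeltaL_T1 a b c : DeltaL a (T1 (tens b c)) = T1 (tens (a ** b) c).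
Proof. by apply: nondegAA_l => Z; rewrite -DeltaLM !T1mull DeltaL_mul. Qed.
Lemma DeltaL_T3 a b c : DeltaL a (T3 b c) = T3 (a ** b) c.
Proof. by apply: nondegAA_l => Z; rewrite -DeltaLM !T3mull DeltaL_mul. Qed.
Lemma DeltaR_T2 a b c : DeltaR a (T2 (tens b c)) = T2 (tens b (c ** a)).
Proof. by apply: nondegAA_r => Z; rewrite -DeltaRM !T2mulr DeltaR_mul. Qed.
Lemma DeltaR_T4 a b c : DeltaR a (T4 b c) = T4 (b ** a) c.
Proof. by apply: nondegAA_r => Z; rewrite -DeltaRM !T4mulr DeltaR_mul. Qed.
Lemma DeltaL_tens1 a x y : DeltaL a (tens x y) = leg1r x (T1 (tens a y)).
Proof.
by apply: nondegAA_l => Z; rewrite -DeltaLM leg1rl T1mull leg21l.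
Qed.
Lemma DeltaL_tens3 a x y : DeltaL a (tens x y) = leg2r y (T3 a x).
Proof. by rewrite DeltaL_tens1 leg1r_T1. Qed.

Lemma T2_leg1l a X : T2 (leg1l a X) = leg1l a (T2 X).
Proof.
move: X; apply: (tensor_ext (g := fun X => T2 (leg1l a X))
  (h := fun X => leg1l a (T2 X))) => [||x y].
- exact: lin_comp T2_lin (leg1l_lin a).
- exact: lin_comp (leg1l_lin a) T2_lin.
apply: nondegAA_l => Z; rewrite leg_tens leg1lM !T2mull.
move: (DeltaL y Z) => {}Z.
apply: (tensor_ext (g := fun Z => leg1l (a ** x) Z)
  (h := fun Z => leg1l a (leg1l x Z))) Z => [||z t].
- exact: leg1l_lin.
- exact: lin_comp (leg1l_lin a) (leg1l_lin x).
- by rewrite !leg_tens sa_mulA.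
Qed.
Lemma leg1r_T2 x y z : leg1r z (T2 (tens x y)) = leg1l x (T3 y z).
Proof. by apply: nondegAA_l => Z; rewrite leg1rl T2mull leg1lM T3mull. Qed.

(** Expand [tens a0 x] as a sum of [T1 (tens a b)]. Multiplying the first leg by [c] and slicing
    gives [f(c a0) x] on one side and, by [leg1l_T1], a sum of products on the other; [c] and [f]
    are chosen with [f(c a0) = 1]. *)
Lemma mul_span (a0 : A) (x : A) : a0 != 0 ->
  exists s : seq (A * A), x = \sum_(p <- s) p.1 ** p.2.
Proof.
move=> a0n.
have [c ca0] : exists c, c ** a0 != 0.
  apply: contrapT => h; move/eqP: a0n; apply; apply: ndA.2 => c.
  by apply: contrapT => /eqP ?; apply: h; exists c.
have [f [lf f1]] := functional_separates ca0.
have [Y YE] := T1_surj (tens a0 x); have [s sE] := tensor_sum Y.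
exists [seq (lslice f (T2 (tens c p.1)), p.2) | p <- s].
rewrite big_map /=; transitivity (lslice f (leg1l c (tens a0 x))).
  by rewrite leg_tens lslice_tens// f1 scale1r.
rewrite -YE sE (lin_sum _ _ _ T1_lin) (lin_sum _ _ _ (leg1l_lin c)).
rewrite (lin_sum _ _ _ (lslice_linear lf)); apply: eq_bigr => p _.
by rewrite leg1l_T1 lslice2r.
Qed.

Section Invariance.
Variable psi : A -> K^o.
Hypothesis lpsi : linear psi.

Lemma right_integral_T1 a b :
  is_left_slice psi (mh_Delta a) (mscalar A (psi a)) ->
  lslice psi (T1 (tens a b)) = psi a *: b.
Proof.
move=> /(_ b)[[Y YE YS] _]; rewrite -[RHS]YS.
by congr lslice; apply: (membed_inj ndAA); rewrite YE mh_T1E.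
Qed.
Lemma right_integral_T4 a b :
  is_left_slice psi (mh_Delta a) (mscalar A (psi a)) ->
  lslice psi (T4 a b) = psi a *: b.
Proof.
move=> /(_ b)[_ [Y YE YS]]; rewrite -[RHS]YS.
congr lslice; apply: nondegAA_l => Z.
have := congr1 (fun m : multiplier (tensor_algebra A A) => lmult m Z) YE.
rewrite T4mull /= /sa_mul /= scale1_eq; last exact: linmul_l.
by move=> ->.
Qed.
Lemma left_integral_T2 a b :
  is_right_slice psi (mh_Delta a) (mscalar A (psi a)) ->
  rslice psi (T2 (tens b a)) = psi a *: b.
Proof.
move=> /(_ b)[_ [Y YE YS]]; rewrite -[RHS]YS.
by congr rslice; apply: (membed_inj ndAA); rewrite YE mh_T2E.
Qed.
End Invariance.

End HopfIdentities.

(** * The opposite multiplier Hopf algebra *)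

Section TensorAssoc.
Variables (K : comNzRingType) (U V W : lmodType K).

Lemma tassocr_bil1 (w : W) :
  bilinear_map (fun (u : U) (v : V) => tens u (tens v w)).
Proof.
split=> [v|u] c x y /=; first by rewrite tensDl tensZl.
by rewrite tensDl tensZl tensDr tensZr.
Qed.
Lemma tassocr_bil :
  bilinear_map (fun (X : tensor U V) (w : W) =>
    tlift (fun u v => tens u (tens v w)) X).
Proof.
split=> [w|X] c x y /=; first exact: (tlift_linear (tassocr_bil1 w)).
apply: (tensor_ext (g := fun X => tlift (fun u v => tens u (tens v (c *: x
  + y))) X)
  (h := fun X => c *: tlift (fun u v => tens u (tens v x)) X
                 + tlift (fun u v => tens u (tens v y)) X)) X => [||u v].
- exact: (tlift_linear (tassocr_bil1 _)).
- move=> d X Y; rewrite !(tlift_linear (tassocr_bil1 _)) !scalerDr !scalerA mulrC.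
  by rewrite -!addrA; congr (_ + _); rewrite addrCA.
- rewrite !(tlift_tens _ _ (tassocr_bil1 _)).
  by rewrite tensDr tensZr tensDr tensZr.
Qed.
Lemma tassocr_lin : linear (@tassocr K U V W).
Proof. exact: (tlift_linear tassocr_bil). Qed.
Lemma tassocr_tens u v w : tassocr (tens (tens u v) w) = tens u
  (tens v w) :> tensor U (tensor V W).
Proof.
by rewrite /tassocr (tlift_tens _ _ tassocr_bil) (tlift_tens _ _
  (tassocr_bil1 _)).
Qed.

Lemma tassocl_bil1 (u : U) :
  bilinear_map (fun (v : V) (w : W) => tens (tens u v) w).
Proof.
split=> [w|v] c x y /=; last by rewrite tensDr tensZr.
by rewrite tensDr tensZr tensDl tensZl.
Qed.
Lemma tassocl_bil :
  bilinear_map (fun (u : U) (X : tensor V W) =>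
    tlift (fun v w => tens (tens u v) w) X).
Proof.
split=> [X|u] c x y /=; last exact: (tlift_linear (tassocl_bil1 u)).
apply: (tensor_ext (g := fun X => tlift (fun v w => tens (tens (c *: x
  + y) v) w) X)
  (h := fun X => c *: tlift (fun v w => tens (tens x v) w) X
                 + tlift (fun v w => tens (tens y v) w) X)) X => [||v w].
- exact: (tlift_linear (tassocl_bil1 _)).
- move=> d X Y; rewrite !(tlift_linear (tassocl_bil1 _)) !scalerDr !scalerA mulrC.
  by rewrite -!addrA; congr (_ + _); rewrite addrCA.
- rewrite !(tlift_tens _ _ (tassocl_bil1 _)).
  by rewrite tensDl tensZl tensDl tensZl.
Qed.
Lemma tassocl_lin : linear (@tassocl K U V W).
Proof. exact: (tlift_linear tassocl_bil). Qed.
Lemma tassocl_tens u v w : tassocl (tens u (tens v w)) = tens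
  (tens u v) w :> tensor (tensor U V) W.
Proof.
by rewrite /tassocl (tlift_tens _ _ tassocl_bil) (tlift_tens _ _
  (tassocl_bil1 _)).
Qed.

Lemma tens_linl (v : V) : linear (fun u : U => tens u v).
Proof. exact: (tens_bilinear U V).1 v. Qed.
Lemma tens_linr (u : U) : linear (fun v : V => tens u v).
Proof. exact: (tens_bilinear U V).2 u. Qed.

End TensorAssoc.

Section Flip.
Variables (K : comNzRingType) (U V : lmodType K).

Lemma tflip_bil : bilinear_map (fun (u : U) (v : V) => tens v u).
Proof.
split=> [v|u] c x y /=; first by rewrite tensDr tensZr.
by rewrite tensDl tensZl.
Qed.
Definition tflip : tensor U V -> tensor V U := tlift (fun u v => tens v u).
Lemma tflip_lin : linear tflip. Proof. exact: (tlift_linear tflip_bil). Qed.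
Lemma tflip_tens u v : tflip (tens u v) = tens v u.
Proof. exact: (tlift_tens _ _ tflip_bil). Qed.
End Flip.

Lemma tflipK (K : comNzRingType) (U V : lmodType K) (X : tensor U V) :
  tflip (tflip X) = X.
Proof.
apply: (tensor_ext (g := fun X => tflip (tflip X))
  (h := fun X => X)) X => // [|u v].
  exact: lin_comp (@tflip_lin _ _ _) (@tflip_lin _ _ _).
by rewrite !tflip_tens.
Qed.

Lemma lslice_tflip (K : comNzRingType) (U V : lmodType K) (f : V -> K^o)
  (X : tensor U V) : linear f -> lslice f (tflip X) = rslice f X.
Proof.
move=> lf; apply: (tensor_ext (g := fun X => lslice f (tflip X))
  (h := fun X => rslice f X)) X => [||u v].
- exact: lin_comp (lslice_linear lf) (@tflip_lin _ _ _).
- exact: rslice_linear.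
- by rewrite tflip_tens lslice_tens// rslice_tens.
Qed.

Section OppositeAlgebra.
Variables (K : numClosedFieldType) (A : star_algebra K).

Lemma op_mul_bilinear : bilinear_map (fun x y : A => y ** x).
Proof. by split=> [v|u]; [exact: linmul_l|exact: linmul_r]. Qed.
Lemma op_mulA : associative (fun x y : A => y ** x).
Proof. by move=> x y z; rewrite sa_mulA. Qed.
Lemma op_starM (x y : A) : (y ** x)^! = x^! ** y^!.
Proof. by rewrite sa_starM. Qed.

Definition op_algebra : star_algebra K := @StarAlgebra K A (fun x y => y ** x)
  (@sa_star K A) op_mul_bilinear op_mulA (@sa_star_antilinear K A) op_starM
  (@sa_starK K A).

Lemma op_nondegenerate : nondegenerate_product A
  -> nondegenerate_product op_algebra.
Proof. by case=> h1 h2; split=> a ha; [exact: h2|exact: h1]. Qed.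

Local Notation AA := (tensor A A).

Lemma op_tensor_mul (X Y : AA) :
  @tensor_mul K op_algebra op_algebra X Y = tensor_mul Y X.
Proof.
apply: (tensor_ext2 (A := A) (g := fun X Y
  => @tensor_mul K op_algebra op_algebra X Y)
  (h := fun X Y => tensor_mul Y X)) X Y => [Y|Y|X|X|*].
- exact: (@tmul_linl K op_algebra).
- exact: tmul_linr.
- exact: (@tmul_linr K op_algebra).
- exact: tmul_linl.
- by rewrite (@tensor_mul_tens K op_algebra op_algebra) tensor_mul_tens.
Qed.

Lemma op_tensor_star (X : AA) :
  @tensor_star K op_algebra op_algebra X = tensor_star X.
Proof. by []. Qed.

Lemma tflip_mul (X Y : AA) :
  tflip (tensor_mul X Y) = tensor_mul (tflip X) (tflip Y).
Proof.
apply: (tensor_ext2 (A := A) (g := fun X Y => tflip (tensor_mul X Y))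
  (h := fun X Y => tensor_mul (tflip X) (tflip Y))) X Y => [Y|Y|X|X|*].
- exact: lin_comp (@tflip_lin _ _ _) (tmul_linl Y).
- exact: lin_comp (tmul_linl _) (@tflip_lin _ _ _).
- exact: lin_comp (@tflip_lin _ _ _) (tmul_linr X).
- exact: lin_comp (tmul_linr _) (@tflip_lin _ _ _).
- by rewrite tensor_mul_tens !tflip_tens tensor_mul_tens.
Qed.

Lemma tflip_leg2r b (X : AA) : tflip (leg2r b X) = leg1r b (tflip X).
Proof.
apply: (tensor_ext (g := fun X => tflip (leg2r b X))
  (h := fun X => leg1r b (tflip X))) X => [||x y].
- exact: lin_comp (@tflip_lin _ _ _) (leg2r_lin b).
- exact: lin_comp (leg1r_lin b) (@tflip_lin _ _ _).
- by rewrite leg_tens !tflip_tens leg_tens.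
Qed.
Lemma tflip_leg2l b (X : AA) : tflip (leg2l b X) = leg1l b (tflip X).
Proof.
apply: (tensor_ext (g := fun X => tflip (leg2l b X))
  (h := fun X => leg1l b (tflip X))) X => [||x y].
- exact: lin_comp (@tflip_lin _ _ _) (leg2l_lin b).
- exact: lin_comp (leg1l_lin b) (@tflip_lin _ _ _).
- by rewrite leg_tens !tflip_tens leg_tens.
Qed.
Lemma tflip_leg1l b (X : AA) : tflip (leg1l b X) = leg2l b (tflip X).
Proof. by rewrite -[X in LHS]tflipK -tflip_leg2l tflipK. Qed.

Lemma tflip_star (X : AA) : tflip (tensor_star X) = tensor_star (tflip X).
Proof.
move: X; apply: tensor_ind => [x y||X Y IHX IHY].
- by rewrite tensor_star_tens !tflip_tens tensor_star_tens.
- rewrite (lin0 (@tflip_lin _ _ _)).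
  by have := star0 (tensor_algebra A A); rewrite /sa_star /= => ->;
    rewrite (lin0 (@tflip_lin _ _ _)).
- rewrite (linD _ _ (@tflip_lin _ _ _)).
  have := @starD _ (tensor_algebra A A); rewrite /sa_star /= => sD.
  by rewrite !sD (linD _ _ (@tflip_lin _ _ _)) IHX IHY.
Qed.

End OppositeAlgebra.

(* The mirror image [(A^op, Delta^cop)], which exchanges left and right
   integrals. *)
Section OppositeHopf.
Variables (K : numClosedFieldType) (A : multiplier_hopf_star_algebra K).
Local Notation AA := (tensor A A).
Local Notation B := (op_algebra A).
Let lF := @tflip_lin K A A.

Definition op_DeltaL (a : A) (X : AA) : AA := tflip (DeltaR a (tflip X)).
Definition op_DeltaR (a : A) (X : AA) : AA := tflip (DeltaL a (tflip X)).
Lemma op_DeltaL_lin a : linear (op_DeltaL a).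
Proof. by apply: lin_comp lF _; apply: lin_comp lF; exact: DeltaR_lin. Qed.
Lemma op_DeltaR_lin a : linear (op_DeltaR a).
Proof. by apply: lin_comp lF _; apply: lin_comp lF; exact: DeltaL_lin. Qed.
Lemma op_Delta_multP a (X Y : tensor_algebra B B) :
  (op_DeltaR a X : tensor_algebra B B) ** Y = X **
    (op_DeltaL a Y : tensor_algebra B B).
Proof.
rewrite /sa_mul /= !op_tensor_mul -[Y in LHS]tflipK -[X in RHS]tflipK.
by rewrite -!tflip_mul DeltaRL.
Qed.
Definition op_Delta (a : B) : multiplier (tensor_algebra B B) :=
  @Multiplier K (tensor_algebra B B) (op_DeltaL a) (op_DeltaR a)
    (op_DeltaL_lin a) (op_DeltaR_lin a) (op_Delta_multP a).

Definition op_T1 (X : AA) : AA := tflip (mh_T2 (tflip X)).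
Definition op_T2 (X : AA) : AA := tflip (mh_T1 (tflip X)).

Lemma op_Delta_linear (c : K) (a b : B) :
  op_Delta (c *: a + b) = mlincomb c (op_Delta a) (op_Delta b).
Proof.
apply: multiplier_eq => X /=.
  by rewrite /op_DeltaL /DeltaR mh_Delta_linear /= lF.
by rewrite /op_DeltaR /DeltaL mh_Delta_linear /= lF.
Qed.
Lemma op_DeltaM (a b : B) : op_Delta (a ** b) = mmul (op_Delta a) (op_Delta b).
Proof.
apply: multiplier_eq => X /=.
  by rewrite /op_DeltaL tflipK -DeltaR_mul.
by rewrite /op_DeltaR tflipK -DeltaL_mul.
Qed.
Lemma op_Delta_star (a : B) : op_Delta a^! = mstar (op_Delta a).
Proof.
apply: multiplier_eq => X /=; rewrite /sa_star /= !op_tensor_star.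
  by rewrite /op_DeltaL DeltaR_star /op_DeltaR tflip_star !tflip_star.
by rewrite /op_DeltaR DeltaL_star /op_DeltaL !tflip_star.
Qed.
Lemma op_T1_linear : linear op_T1.
Proof. by apply: lin_comp lF _; apply: lin_comp lF; exact: mh_T2_linear. Qed.
Lemma op_T2_linear : linear op_T2.
Proof. by apply: lin_comp lF _; apply: lin_comp lF; exact: mh_T1_linear. Qed.
Lemma op_T1_bij : bijective op_T1.
Proof.
have [g gK Kg] := mh_T2_bij A; exists (fun X => tflip (g (tflip X))) => X.
  by rewrite /op_T1 tflipK gK tflipK.
by rewrite /op_T1 tflipK Kg tflipK.
Qed.
Lemma op_T2_bij : bijective op_T2.
Proof.
have [g gK Kg] := mh_T1_bij A; exists (fun X => tflip (g (tflip X))) => X.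
  by rewrite /op_T2 tflipK gK tflipK.
by rewrite /op_T2 tflipK Kg tflipK.
Qed.

Let scale1 : (fun b : A => 1 *: b) = (fun b => b).
Proof. by apply/funext => b; rewrite scale1r. Qed.

Lemma op_T1E (a b : B) : membed (op_T1 (tens a b) : tensor_algebra B B) =
  mmul (op_Delta a) (mtensor mone (membed b)).
Proof.
apply: multiplier_eq => X /=;
  rewrite /sa_mul /= op_tensor_mul /op_T1 tflip_tens scale1.
  rewrite -[X in LHS]tflipK -tflip_mul T2mulr /op_DeltaL.
  by congr (tflip (DeltaR a _)); rewrite -tflip_leg2r.
rewrite -[X in LHS]tflipK -tflip_mul T2mull /op_DeltaR tflip_leg1l.
by [].
Qed.
Lemma op_T2E (a b : B) : membed (op_T2 (tens a b) : tensor_algebra B B) =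
  mmul (mtensor (membed a) mone) (op_Delta b).
Proof.
apply: multiplier_eq => X /=;
  rewrite /sa_mul /= op_tensor_mul /op_T2 tflip_tens scale1.
  by rewrite -[X in LHS]tflipK -tflip_mul T1mulr /op_DeltaL tflip_leg2r.
rewrite -[X in LHS]tflipK -tflip_mul T1mull /op_DeltaR.
by congr (tflip (DeltaL b _)); rewrite -tflip_leg1l.
Qed.

Let flip3_bil : bilinear_map (fun (x : A) (Y : AA) =>
  tassocr (tens (tflip Y) x)).
Proof.
split=> [Y|x].
  exact: lin_comp (@tassocr_lin _ _ _ _) (@tens_linr _ _ _ _).
by apply: lin_comp (@tassocr_lin _ _ _ _) _;
  apply: lin_comp (@tens_linl _ _ _ _) lF.
Qed.
(** The reversal [x (x) (y (x) z) |-> z (x) (y (x) x)] of three legs. It carries the two members of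
    coassociativity for [A] to those for the opposite algebra, exchanged. *)
Let flip3 : tensor A AA -> tensor A AA := tlift (fun x Y => tassocr (tens
  (tflip Y) x)).
Let flip3_lin : linear flip3. Proof. exact: tlift_linear flip3_bil. Qed.
Let flip3_tens x Y : flip3 (tens x Y) = tassocr (tens (tflip Y) x).
Proof. exact: tlift_tens flip3_bil. Qed.
Let flip3_assoc X d : flip3 (tassocr (tens X d)) = tens d (tflip X).
Proof.
apply: (tensor_ext (g := fun X => flip3 (tassocr (tens X d)))
  (h := fun X => tens d (tflip X))) X => [||x y].
- apply: lin_comp flip3_lin _; apply: lin_comp (@tassocr_lin _ _ _ _) _.
  exact: tens_linl.
- exact: lin_comp (@tens_linr _ _ _ _) lF.
- by rewrite tassocr_tens flip3_tens !tflip_tens tassocr_tens.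
Qed.

Lemma op_coassoc (a b c : B) :
  tassocr (tmap op_T2 idfun (tassocl (tens a (op_T1 (tens b c))))) =
  tmap idfun op_T1 (tassocr (tens (op_T2 (tens a b)) c)).
Proof.
have lid : linear (@idfun A) by [].
have H1 : tassocr (tmap op_T2 idfun (tassocl (tens a (op_T1 (tens b c))))) =
    flip3 (tmap idfun (@mh_T1 K A) (tassocr (tens (mh_T2 (tens c b)) a))).
  rewrite /op_T1 tflip_tens; move: (mh_T2 _) => X.
  apply: (tensor_ext
    (g := fun X => tassocr (tmap op_T2 idfun (tassocl (tens a (tflip X)))))
    (h := fun X => flip3 (tmap idfun (@mh_T1 K A) (tassocr (tens X a))))) X
      => [||x y].
  - apply: lin_comp (@tassocr_lin _ _ _ _) _.
    apply: lin_comp (linear_tmap op_T2_linear lid) _.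
    apply: lin_comp (@tassocl_lin _ _ _ _) _.
    exact: lin_comp (@tens_linr _ _ _ _) lF.
  - apply: lin_comp flip3_lin _.
    apply: lin_comp (linear_tmap lid (@T1_lin K A)) _.
    exact: lin_comp (@tassocr_lin K A A A) (@tens_linl K AA A a).
  - rewrite tflip_tens tassocl_tens (tmap_tens op_T2_linear lid).
    rewrite tassocr_tens (tmap_tens lid (@T1_lin K A)) flip3_tens.
    by rewrite /op_T2 tflip_tens.
have H2 : tmap idfun op_T1 (tassocr (tens (op_T2 (tens a b)) c)) =
    flip3 (tassocr (tmap (@mh_T2 K A) idfun (tassocl (tens c (mh_T1
      (tens b a)))))).
  rewrite /op_T2 tflip_tens; move: (mh_T1 _) => X.
  apply: (tensor_ext
    (g := fun X => tmap idfun op_T1 (tassocr (tens (tflip X) c)))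
    (h := fun X => flip3 (tassocr (tmap (@mh_T2 K A) idfun (tassocl
      (tens c X)))))) X => [||x y].
  - apply: lin_comp (linear_tmap lid op_T1_linear) _.
    apply: lin_comp (@tassocr_lin _ _ _ _) _.
    exact: lin_comp (@tens_linl K AA A c) lF.
  - apply: lin_comp flip3_lin _.
    apply: lin_comp (@tassocr_lin _ _ _ _) _.
    apply: lin_comp (linear_tmap (@T2_lin K A) lid) _.
    exact: lin_comp (@tassocl_lin K A A A) (@tens_linr K A AA c).
  - rewrite tflip_tens tassocr_tens (tmap_tens lid op_T1_linear).
    rewrite tassocl_tens (tmap_tens (@T2_lin K A) lid) flip3_assoc.
    by rewrite /op_T1 tflip_tens.
by rewrite H1 H2 mh_coassoc.
Qed.

Definition op_hopf : multiplier_hopf_star_algebra K :=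
  @MultiplierHopf K B (op_nondegenerate (mh_nondegenerate A)) op_Delta
    op_Delta_linear op_DeltaM op_Delta_star
    op_T1 op_T1_linear op_T1_bij op_T1E op_T2 op_T2_linear op_T2_bij op_T2E
    op_coassoc.

Lemma op_T3E (a b : A) : @hopf_T3 K op_hopf a b = tflip (@hopf_T4 K A a b).
Proof.
by rewrite /hopf_T3 /hopf_T4 /= op_tensor_star /op_T2 tflip_tens -tflip_star.
Qed.

End OppositeHopf.

(** * The modular property of the right integral *)

(** Under the tests [f(c -)] the slice of [Delta(w) (1 (x) y)] factors as [slice_T2 f c w ** y],
    with both factors in [A]. Non-degeneracy makes these tests sufficient. *)
Lemma tensor_eq_mul (K : numClosedFieldType) (A : star_algebra K) (V : lmodType K)
    (X Y : tensor A V) : nondegenerate_product A ->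
  (forall (f : A -> K^o) c, linear f ->
    lslice (fun x => f (c ** x)) X = lslice (fun x => f (c ** x)) Y) -> X = Y.
Proof.
move=> ndA h; apply: tensor_eq => f lf; apply: functional_eq => g lg.
rewrite -!slices_comm//; congr f; apply: (nondeg_eqr ndA) => c.
apply: functional_eq => f' lf'.
have lf'c : linear ((fun x => f' (c ** x)) : A -> K^o) by exact: linear_fmull.
by rewrite (slices_comm X lf'c lg) (slices_comm Y lf'c lg) h.
Qed.

Section Slicing.
Variables (K : comNzRingType) (U V W : lmodType K) (f : U -> K^o).
Hypothesis lf : linear f.

Lemma lslice_tmap (g : V -> W) (X : tensor U V) : linear g ->
  lslice f (tmap (fun u => u) g X) = g (lslice f X).
Proof.
move=> lg; apply: (tensor_ext (g := fun X => lslice f (tmap (fun u => u) g X))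
  (h := fun X => g (lslice f X))) X => [||u v].
- exact: lin_comp (lslice_linear lf) (linear_tmap (@lin_id _ _) lg).
- exact: lin_comp lg (lslice_linear lf).
- by rewrite (tmap_tens (@lin_id _ _) lg) !lslice_tens// linZ.
Qed.

Lemma lslice_tassocr (X : tensor U V) (w : W) :
  lslice f (tassocr (tens X w)) = tens (lslice f X) w.
Proof.
apply: (tensor_ext (g := fun X => lslice f (tassocr (tens X w)))
  (h := fun X => tens (lslice f X) w)) X => [||u v].
- apply: lin_comp (lslice_linear lf) _.
  exact: lin_comp (@tassocr_lin _ _ _ _) (@tens_linl _ _ _ _).
- exact: lin_comp (@tens_linl _ _ _ _) (lslice_linear lf).
- by rewrite tassocr_tens !lslice_tens// tensZl.
Qed.
End Slicing.

(** * Translates of a right integral and its slices *)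

Section RightInvariance.
Variables (K : numClosedFieldType) (A : multiplier_hopf_star_algebra K).
Local Notation AA := (tensor A A).
Local Notation T1 := (@mh_T1 K A).
Local Notation T2 := (@mh_T2 K A).
Local Notation T3 := (@hopf_T3 K A).
Implicit Types (a b c v w y z r t q : A) (X Y Z : AA).
Let ndA : nondegenerate_product A := mh_nondegenerate A.

(* [(f(c -) (x) iota) Delta(w)] and [(f (x) iota)(Delta(a)(w (x) 1))] *)
Definition slice_T2 (f : A -> K) (c w : A) : A := lslice f (T2 (tens c w)).
Definition slice_T3 (f : A -> K) (a w : A) : A := lslice f (T3 a w).

Lemma leg1r_cancel (X Y : AA) : (forall z, leg1r z X = leg1r z Y) -> X = Y.
Proof.
move=> h; apply: nondegAA_l => Z.
move: Z; apply: tensor_ext => [||z t]; try exact: tmul_linr.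
by rewrite -!leg21r h.
Qed.

Section OneFunctional.
Variable f : A -> K^o.
Hypothesis lf : linear f.

Lemma slice_T2_lin c : linear (slice_T2 f c).
Proof.
apply: lin_comp (lslice_linear lf) _.
exact: lin_comp (@T2_lin K A) (@tens_linr _ _ _ _).
Qed.
Lemma slice_T3_lin a : linear (slice_T3 f a).
Proof. by apply: lin_comp (lslice_linear lf) _; exact: (T3_bil A).2. Qed.

Lemma slice_T2E c w y :
  lslice (fun x => f (c ** x)) (T1 (tens w y)) = slice_T2 f c w ** y.
Proof. by rewrite -lslice1l// leg1l_T1 lslice2r. Qed.

(** Coassociativity with its first leg sliced: both members are [f(c w_1) w_2 (x) w_3 y]. *)
Lemma slice_coassoc c w y :
  tmap (slice_T2 f c) (fun x => x) (T1 (tens w y)) = T1 (tens (slice_T2 f c w) y).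
Proof.
have := congr1 (lslice f) (mh_coassoc c w y).
have -> (X : AA) : lslice f (tassocr (tmap T2 idfun (tassocl (tens c X)))) =
    tmap (slice_T2 f c) (fun x => x) X.
  apply: (tensor_ext
    (g := fun X => lslice f (tassocr (tmap T2 idfun (tassocl (tens c X)))))
    (h := fun X => tmap (slice_T2 f c) (fun x => x) X)) X => [||u v].
  - apply: lin_comp (lslice_linear lf) _.
    apply: lin_comp (@tassocr_lin _ _ _ _) _.
    apply: lin_comp (linear_tmap (@T2_lin K A) (@lin_id _ _)) _.
    exact: lin_comp (@tassocl_lin _ _ _ _) (@tens_linr _ _ _ _).
  - exact: linear_tmap (slice_T2_lin c) (@lin_id _ _).
  - rewrite tassocl_tens (tmap_tens (@T2_lin K A) (@lin_id _ _)).
    by rewrite lslice_tassocr// (tmap_tens (slice_T2_lin c) (@lin_id _ _)).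
move=> ->.
by rewrite (lslice_tmap lf _ (@T1_lin K A)) lslice_tassocr.
Qed.

End OneFunctional.

(* [w_1 (x) (w_2 y)_1 z (x) (w_2 y)_2 = w_1 (x) w_2 y_1 z (x) w_3 y_2] *)
Lemma T1_T3_coassoc w y z (s : seq (A * A)) :
  T3 y z = \sum_(p <- s) tens p.1 p.2 ->
  tmap (fun x => x) (T3^~ z) (T1 (tens w y)) =
  \sum_(p <- s) tassocr (tmap (fun x => T1 (tens x p.1)) (fun x => x) (T1
    (tens w p.2))).
Proof.
move=> sE; apply: (tensor_eq_mul ndA) => f c lf.
have lfc := linear_fmull lf c.
rewrite (lslice_tmap lfc _ ((T3_bil A).1 z)) (slice_T2E lf).
rewrite -DeltaL_T3 sE (lin_sum _ _ _ (@DeltaL_lin K A _)).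
rewrite (lin_sum _ _ _ (lslice_linear lfc)); apply: eq_bigr => -[r t] _ /=.
rewrite DeltaL_tens1 -(slice_coassoc lf).
have lT1r : linear (fun x => T1 (tens x r)).
  exact: lin_comp (@T1_lin K A) (@tens_linl _ _ _ _).
move: (T1 (tens w t)); apply: (tensor_ext
  (g := fun X => leg1r r (tmap (slice_T2 f c) (fun x => x) X))
  (h := fun X => lslice (fun x => f (c ** x))
     (tassocr (tmap (fun x => T1 (tens x r)) (fun x => x) X)))) => [||u v].
- exact: lin_comp (leg1r_lin r) (linear_tmap (slice_T2_lin lf c) (@lin_id _ _)).
- apply: lin_comp (lslice_linear lfc) _.
  exact: lin_comp (@tassocr_lin _ _ _ _) (linear_tmap lT1r (@lin_id _ _)).
- rewrite (tmap_tens (slice_T2_lin lf c) (@lin_id _ _)) (tmap_tens lT1r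
  (@lin_id _ _)).
  by rewrite leg_tens (lslice_tassocr lfc) (slice_T2E lf).
Qed.

Variable psi : A -> K^o.
Hypothesis lpsi : linear psi.
Hypothesis invpsi : forall a b, lslice psi (T1 (tens a b)) = psi a *: b.
Local Notation p := (slice_T2 psi).
Local Notation P := (slice_T3 psi).

Lemma lslice_DeltaL a w r : lslice psi (DeltaL a (tens w r)) = P a w ** r.
Proof. by rewrite DeltaL_tens3 lslice2r. Qed.

Let theta_bil a : bilinear_map (fun (w : A) (Y : AA) => leg1l (P a w) Y).
Proof.
split=> [Y|w]; last exact: leg1l_lin.
move: Y => /= Y c u u'; rewrite (slice_T3_lin lpsi).
move: Y; apply: (tensor_ext (g := fun Y => leg1l (c *: P a u + P a u') Y)
  (h := fun Y => c *: leg1l (P a u) Y + leg1l (P a u') Y)) => [||x y].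
- exact: leg1l_lin.
- move=> d X Y; rewrite !(leg1l_lin _ d) !scalerDr !scalerA mulrC.
  by rewrite -!addrA; congr (_ + _); rewrite addrCA.
- by rewrite !leg_tens sa_mulDl sa_mulZl tensDl tensZl.
Qed.
(** The map [w (x) r (x) t |-> psi(a_1 w) a_2 r (x) t], that is, left multiplication by [Delta(a)]
    on the first two legs followed by the slice of the first leg. *)
Let theta a : tensor A AA -> AA := tlift (fun w Y => leg1l (P a w) Y).
Let theta_lin a : linear (theta a). Proof. exact: tlift_linear (theta_bil a). Qed.
Let theta_tens a w Y : theta a (tens w Y) = leg1l (P a w) Y.
Proof. exact: tlift_tens (theta_bil a). Qed.
Let theta_assoc a Z t :
  theta a (tassocr (tens Z t)) = tens (lslice psi (DeltaL a Z)) t.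
Proof.
move: Z; apply: (tensor_ext (g := fun Z => theta a (tassocr (tens Z t)))
  (h := fun Z => tens (lslice psi (DeltaL a Z)) t)) => [||w r].
- apply: lin_comp (theta_lin a) _.
  exact: lin_comp (@tassocr_lin _ _ _ _) (@tens_linl _ _ _ _).
- apply: lin_comp (@tens_linl _ _ _ _) _.
  exact: lin_comp (lslice_linear lpsi) (@DeltaL_lin K A a).
- by rewrite tassocr_tens theta_tens leg_tens lslice_DeltaL.
Qed.

(** [theta a] applied to [T1_T3_coassoc] gives [P_a(w_1) w_2 y_1 z (x) w_3 y_2 = psi(a_1 w_1) a_2
    w_2 y_1 z (x) w_3 y_2], and right invariance at [a w_1] reduces this to
    [y_1 z (x) psi(a w_1) w_2 y_2]. *)
Lemma slice_T3_T1 a w y z :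
  leg1r z (T2 (tmap (P a) (fun x => x) (T1 (tens w y)))) = leg2l (p a w) (T3 y z).
Proof.
have [s sE] := tensor_sum (T3 y z).
have lT3 : linear (T3^~ z) by exact: (T3_bil A).1.
have lP := slice_T3_lin lpsi a.
have := congr1 (theta a) (T1_T3_coassoc w sE).
have -> (X : AA) : theta a (tmap (fun x => x) (T3^~ z) X) =
    leg1r z (T2 (tmap (P a) (fun x => x) X)).
  move: X; apply: (tensor_ext
    (g := fun X => theta a (tmap (fun x => x) (T3^~ z) X))
    (h := fun X => leg1r z (T2 (tmap (P a) (fun x => x) X)))) => [||u v].
  - exact: lin_comp (theta_lin a) (linear_tmap (@lin_id _ _) lT3).
  - apply: lin_comp (leg1r_lin z) _.
    exact: lin_comp (@T2_lin K A) (linear_tmap lP (@lin_id _ _)).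
  - rewrite (tmap_tens (@lin_id _ _) lT3) theta_tens.
    by rewrite (tmap_tens lP (@lin_id _ _)) leg1r_T2.
move=> ->; rewrite sE (lin_sum _ _ _ (theta_lin a)) (lin_sum _ _ _ (leg2l_lin _)).
apply: eq_bigr => -[r t] _ /=.
have lT1r : linear (fun x => T1 (tens x r)).
  exact: lin_comp (@T1_lin K A) (@tens_linl _ _ _ _).
have lpa := linear_fmull lpsi a.
transitivity (tens r (lslice (fun x => psi (a ** x)) (T1 (tens w t)))).
  move: (T1 (tens w t)); apply: (tensor_ext
    (g := fun X => theta a (tassocr (tmap (fun x => T1 (tens x r)) (fun x
      => x) X)))
    (h := fun X => tens r (lslice (fun x => psi (a ** x)) X))) => [||u v].
  - apply: lin_comp (theta_lin a) _.
    exact: lin_comp (@tassocr_lin _ _ _ _) (linear_tmap lT1r (@lin_id _ _)).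
  - exact: lin_comp (@tens_linr _ _ _ _) (lslice_linear lpa).
  - rewrite (tmap_tens lT1r (@lin_id _ _)) theta_assoc DeltaL_T1 invpsi.
    by rewrite (lslice_tens _ _ lpa) tensZl tensZr.
by rewrite (slice_T2E lpsi) leg_tens.
Qed.

(* [v P_a(w_1) (x) w_2 y], with [P_a(w) = psi(a_1 w) a_2], is obtained from
   [(1 (x) p_a(w)) (v (x) 1) Delta(y)] without reference to the antipode. *)
Lemma T2_slice_T3 a v w y :
  T2 (leg1l v (tmap (P a) (fun x => x) (T1 (tens w y)))) =
  leg2l (p a w) (T2 (tens v y)).
Proof.
rewrite T2_leg1l; apply: leg1r_cancel => z.
have c1 (X : AA) : leg1r z (leg1l v X) = leg1l v (leg1r z X).
  move: X; apply: tensor_ext => [||x t].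
  - exact: lin_comp (leg1r_lin z) (leg1l_lin v).
  - exact: lin_comp (leg1l_lin v) (leg1r_lin z).
  - by rewrite !leg_tens sa_mulA.
have c2 q (X : AA) : leg1r z (leg2l q X) = leg2l q (leg1r z X).
  move: X; apply: tensor_ext => [||x t].
  - exact: lin_comp (leg1r_lin z) (leg2l_lin q).
  - exact: lin_comp (leg2l_lin q) (leg1r_lin z).
  - by rewrite !leg_tens.
by rewrite c1 c2 slice_T3_T1 leg1r_T2 leg12l leg21l.
Qed.

Variable phi : A -> K^o.
Hypothesis lphi : linear phi.

Variable omega : A -> K^o.
Hypothesis lomega : linear omega.
Local Notation ev X := (omega (lslice phi X)).
Local Notation chain v a X := (ev (leg1l v (tmap (P a) (fun x => x) X))).
Let ev_lin : linear ((fun X => ev X) : AA -> K^o).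
Proof. exact: lin_comp lomega (lslice_linear lphi). Qed.
Let chain_lin v a : linear ((fun X => chain v a X) : AA -> K^o).
Proof.
apply: lin_comp ev_lin _; apply: lin_comp (leg1l_lin v) _.
exact: linear_tmap (slice_T3_lin lpsi a) (@lin_id _ _).
Qed.
Let chain_tens v a w y : chain v a (tens w y) = phi (v ** P a w) * omega y.
Proof.
rewrite (tmap_tens (slice_T3_lin lpsi a) (@lin_id _ _)) leg_tens lslice_tens//.
by rewrite linZ.
Qed.

(** The inverse [g] of [T2] recovers [v P_a(w_1) (x) w_2 y] from a tensor that depends on [a] only
    through products [p_a(w) t]. Each of these is the slice of [T1 (tens w t)] by [psi(a -)], and
    exchanging the slices exhibits [psi(a b)]. As [T1] is onto, [tens w y0] is a sum of such
    [w_1 (x) w_2 y], and [omega] removes [y0]. *)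
Lemma slice_T3_translate y0 v w : omega y0 = 1 ->
  exists b, forall a, phi (v ** P a w) = psi (a ** b).
Proof.
move=> oy; have [g gK Kg] := mh_T2_bij A.
have lg : linear g by exact: (linear_inverse (@T2_lin K A) gK Kg).
pose E (F : A -> K) := exists b, forall a, F a = psi (a ** b).
have E0 F : (forall a, F a = 0) -> E F.
  by move=> F0; exists 0 => a; rewrite F0 sa_mul0r (lin0 lpsi).
have ED F F1 F2 : (forall a, F a = F1 a + F2 a) -> E F1 -> E F2 -> E F.
  move=> FE [b1 h1] [b2 h2]; exists (b1 + b2) => a.
  by rewrite FE h1 h2 sa_mulDr (linD _ _ lpsi).
have lG : linear ((fun X => ev (g X)) : AA -> K^o) by exact: lin_comp ev_lin lg.
have st3 r X : E (fun a => ev (g (tens r (lslice (fun x => psi (a ** x)) X)))).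
  exists (rslice (fun t => ev (g (tens r t))) X) => a.
  rewrite (slices_comm (f := fun x => psi (a ** x)) (g := fun t => ev (g
    (tens r t))))//.
    exact: linear_fmull.
  exact: lin_comp lG (@tens_linr _ _ _ _).
have st2 w' Z : E (fun a => ev (g (leg2l (p a w') Z))).
  move: Z; apply: tensor_ind => [r t||X Y IHX IHY].
  - have [b bE] := st3 r (T1 (tens w' t)); exists b => a.
    by rewrite leg_tens -bE (slice_T2E lpsi).
  - by apply: E0 => a; rewrite (lin0 (leg2l_lin _)) (lin0 lG).
  - by apply: ED IHX IHY => a; rewrite (linD _ _ (leg2l_lin _)) (linD _ _ lG).
have st1 X : E (fun a => chain v a X).
  have [Y <-] := T1_surj X; move: Y; apply: tensor_ind => [w' y||X1 X2 IH1 IH2].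
  - have [b bE] := st2 w' (T2 (tens v y)); exists b => a.
    by rewrite -bE -T2_slice_T3 gK.
  - by apply: E0 => a; rewrite (lin0 (@T1_lin K A)) (lin0 (chain_lin v a)).
  - by apply: ED IH1 IH2 => a;
    rewrite (linD _ _ (@T1_lin K A)) (linD _ _ (chain_lin v a)).
have [b bE] := st1 (tens w y0); exists b => a.
by rewrite -bE chain_tens oy mulr1.
Qed.

(** The same chain read backwards: [psi(a b)] is inserted as a slice of [tens b t], where the [t]
    are the second legs of [T2 (tens z0 y0)]; surjectivity of [T1] and then of [T2] leads to the
    terms [phi(v P_a(w))]. *)
Lemma translate_slice_T3 y0 z0 b : omega y0 = 1 -> phi z0 = 1 ->
  exists s : seq (A * A), forall a, psi (a ** b) = \sum_(q <- s) phi
    (q.2 ** P a q.1).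
Proof.
move=> oy pz; have [g gK Kg] := mh_T2_bij A.
have lg : linear g by exact: (linear_inverse (@T2_lin K A) gK Kg).
pose D (F : A -> K) := exists s : seq (A * A),
  forall a, F a = \sum_(q <- s) phi (q.2 ** P a q.1).
have D0 F : (forall a, F a = 0) -> D F by move=> F0; exists [::] => a;
  rewrite F0 big_nil.
have DD F F1 F2 : (forall a, F a = F1 a + F2 a) -> D F1 -> D F2 -> D F.
  by move=> FE [s1 h1] [s2 h2]; exists (s1 ++ s2) => a;
    rewrite big_cat /= FE h1 h2.
have lG : linear ((fun X => ev (g X)) : AA -> K^o) by exact: lin_comp ev_lin lg.
have st1 v X : D (fun a => chain v a X).
  move: X; apply: tensor_ind => [w y||X1 X2 IH1 IH2].
  - exists [:: (omega y *: w, v)] => a; rewrite big_seq1 /= chain_tens.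
    rewrite (linZ _ _ (slice_T3_lin lpsi a)) sa_mulZr (linZ _ _ lphi).
    by rewrite mulrC.
  - by apply: D0 => a; rewrite (lin0 (chain_lin v a)).
  - by apply: DD IH1 IH2 => a; rewrite (linD _ _ (chain_lin v a)).
have st2 w Z : D (fun a => ev (g (leg2l (p a w) Z))).
  have [Y <-] := T2_surj Z; move: Y; apply: tensor_ind => [v y||X1 X2 IH1 IH2].
  - have [s sE] := st1 v (T1 (tens w y)); exists s => a.
    by rewrite -sE -T2_slice_T3 gK.
  - by apply: D0 => a;
    rewrite (lin0 (@T2_lin K A)) (lin0 (leg2l_lin _)) (lin0 lG).
  - by apply: DD IH1 IH2 => a;
    rewrite (linD _ _ (@T2_lin K A)) (linD _ _ (leg2l_lin _)) (linD _ _ lG).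
have st3 r X : D (fun a => ev (g (tens r (lslice (fun x => psi (a ** x)) X)))).
  have lr a : linear ((fun X => ev (g (tens r (lslice (fun x => psi
    (a ** x)) X)))) : AA -> K^o).
    apply: lin_comp lG _; apply: lin_comp (@tens_linr _ _ _ _) _.
    exact: lslice_linear (linear_fmull lpsi a).
  have [Y <-] := T1_surj X; move: Y; apply: tensor_ind => [w t||X1 X2 IH1 IH2].
  - have [s sE] := st2 w (tens r t); exists s => a.
    by rewrite -sE leg_tens (slice_T2E lpsi).
  - by apply: D0 => a; rewrite (lin0 (@T1_lin K A)) (lin0 (lr a)).
  - by apply: DD IH1 IH2 => a; rewrite (linD _ _ (@T1_lin K A)) (linD _ _ (lr a)).
have [s sE] := tensor_sum (T2 (tens z0 y0)).
have bE a : psi (a ** b) = \sum_(q <- s)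
    ev (g (tens q.1 (lslice (fun x => psi (a ** x)) (tens b q.2)))).
  transitivity (psi (a ** b) *: ev (g (T2 (tens z0 y0))) : K^o).
    by rewrite gK lslice_tens// linZ// oy pz /GRing.scale/= !mulr1.
  rewrite sE (lin_sum _ _ _ lG) scaler_sumr; apply: eq_bigr => q _.
  rewrite (lslice_tens _ _ (linear_fmull lpsi a)) tensZr.
  by rewrite -(linZ _ _ lG).
suff : D (fun a => psi (a ** b)) by [].
have : forall s' : seq (A * A), D (fun a => \sum_(q <- s')
    ev (g (tens q.1 (lslice (fun x => psi (a ** x)) (tens b q.2))))).
  elim=> [|q s' IH]; first by apply: D0 => a; rewrite big_nil.
  by apply: DD (st3 q.1 (tens b q.2)) IH => a; rewrite big_cons.
move=> /(_ s)[s' s'E]; exists s' => a.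
by rewrite bE s'E.
Qed.

End RightInvariance.

(* The modular automorphism of [psi], without naming it: [psi(x b)] is turned
   into sums of [(psi(- w) (x) phi(v -)) Delta(x)], then by left invariance of
   [phi] into [phi(d x)], then by right invariance of [psi] into [psi(b' x)]. *)
Section ModularProperty.
Variables (K : numClosedFieldType) (A : multiplier_hopf_star_algebra K).
Local Notation T1 := (@mh_T1 K A).
Local Notation T2 := (@mh_T2 K A).
Variables (psi phi : A -> K^o).
Hypotheses (lpsi : linear psi) (lphi : linear phi).
Hypothesis psiT1 : forall a b, lslice psi (T1 (tens a b)) = psi a *: b.
Hypothesis psiT4 : forall a b, lslice psi (hopf_T4 a b) = psi a *: b.
Hypothesis phiT2 : forall a b, rslice phi (T2 (tens b a)) = phi a *: b.
Variables (z1 z2 : A).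
Hypotheses (psi1 : psi z1 = 1) (phi1 : phi z2 = 1).

(** Expand [(z1 (x) 1) Delta(d)] as a sum of [(1 (x) q.2) Delta(q.1)] and evaluate [psi (x) phi] on
    its product with [Delta(a)]. Left invariance of [phi] gives [phi(d a)], because [psi z1 = 1];
    right invariance of [psi] gives the sum of the [psi(q.1 a) phi(q.2)]. *)
Lemma left_to_right_translate d : exists d', forall a, phi (d ** a) = psi
  (d' ** a).
Proof.
have [s sE] := T4_span (T2 (tens z1 d)).
exists (\sum_(q <- s) phi q.2 *: q.1) => a.
transitivity (phi (lslice psi (DeltaR a (T2 (tens z1 d))))).
  rewrite DeltaR_T2 -(slices_comm _ lpsi lphi) phiT2 (linZ _ _ lpsi) psi1.
  by rewrite /GRing.scale /= mulr1.
rewrite sE (lin_sum _ _ _ (@DeltaR_lin K A a)) (lin_sum _ _ _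
  (lslice_linear lpsi)).
rewrite (lin_sum _ _ _ lphi) (lin_sum _ _ _ (linmul_r a)) (lin_sum _ _ _ lpsi).
apply: eq_bigr => q _;
  rewrite DeltaR_T4 psiT4 (linZ _ _ lphi) sa_mulZl (linZ _ _ lpsi).
by rewrite /GRing.scale /= mulrC.
Qed.

(** [slice_T3_translate] for the opposite algebra, where [phi] is the right integral: the double
    slice [psi(a_1 w) phi(v a_2)] can be taken in either order, which exchanges the roles of the two
    integrals. *)
Lemma slice_to_left_translate v w : exists d, forall a,
  phi (v ** slice_T3 psi a w) = phi (d ** a).
Proof.
pose B := op_hopf A.
have invB (a b : B) : lslice phi (@mh_T1 K B (tens a b)) = phi a *: b.
  rewrite /= /op_T1 tflip_tens lslice_tflip//; exact: phiT2.
have [d dE]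
  := @slice_T3_translate K B phi lphi invB psi lpsi psi lpsi z1 w v psi1.
exists d => a; rewrite -[RHS]dE /slice_T3 op_T3E lslice_tflip//.
transitivity (psi (rslice phi (leg1r w (hopf_T4 a v)))).
  by rewrite -leg2l_T3 slices_comm// lslice2l.
by rewrite rslice1r.
Qed.

Lemma modular_right b : exists b', forall x, psi (x ** b) = psi (b' ** x).
Proof.
have [s sE] := translate_slice_T3 lpsi psiT1 lphi lpsi b psi1 phi1.
have : forall s' : seq (A * A), exists d, forall a,
    \sum_(q <- s') phi (q.2 ** slice_T3 psi a q.1) = psi (d ** a).
  elim=> [|q s' [d dE]].
    by exists 0 => a; rewrite big_nil sa_mul0l (lin0 lpsi).
  have [e eE] := slice_to_left_translate q.2 q.1.
  have [e' e'E] := left_to_right_translate e.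
  exists (e' + d) => a; rewrite big_cons dE eE e'E.
  by rewrite sa_mulDl (linD _ _ lpsi).
move=> /(_ s)[d dE]; exists d => x.
by rewrite sE dE.
Qed.

End ModularProperty.

(** * Boundedness of left multiplications *)

Section CauchySchwarz.
Variables (K : numClosedFieldType) (V : lmodType K) (f : V -> V -> K).
Hypothesis flin : forall y, linear ((f^~ y) : V -> K^o).
Hypothesis fherm : forall x y, f x y = (f y x)^*.
Hypothesis fpos : forall x, 0 <= f x x.

Lemma form_Dl x y z : f (x + y) z = f x z + f y z.
Proof. exact: linD (flin z). Qed.
Lemma form_Zl c x z : f (c *: x) z = c * f x z.
Proof. exact: linZ (flin z). Qed.
Lemma form_Dr x y z : f z (x + y) = f z x + f z y.
Proof. by rewrite fherm form_Dl rmorphD /= -!fherm. Qed.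
Lemma form_Zr c x z : f z (c *: x) = c^* * f z x.
Proof. by rewrite fherm form_Zl rmorphM /= -fherm. Qed.

Lemma form_CauchySchwarz x y : `|f x y| ^+ 2 <= f x x * f y y.
Proof.
have key (t : K) : t \is Num.real ->
    0 <= f x x - t * `|f x y| ^+ 2 *+ 2 + t ^+ 2 * `|f x y| ^+ 2 * f y y.
  move=> /CrealP tr; have := fpos (x + (- (t * f x y)) *: y).
  rewrite form_Dl !form_Dr !form_Zl !form_Zr rmorphN rmorphM /= tr -fherm.
  rewrite normCK (fherm y x); congr (0 <= _).
  by rewrite -fherm; move: (f x y) ((f x y)^*) (f x x) (f y y) => u u' v w; ring.
have n0 : 0 <= `|f x y| ^+ 2 by rewrite exprn_ge0.
have [y0|y0] := eqVneq (f y y) 0.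
  rewrite y0 mulr0; have [->//|nz] := eqVneq (`|f x y| ^+ 2) 0.
  (* For [f y y = 0] the polynomial is affine in [t]; at this [t] it equals [- (f x x + 2)], which
     is negative. *)
  have := key ((f x x + 1) / `|f x y| ^+ 2).
  rewrite ger0_real; last by rewrite mulr_ge0 ?invr_ge0 ?addr_ge0.
  move=> /(_ isT); rewrite y0 mulr0 addr0 mulfVK//.
  have -> : f x x - (f x x + 1) *+ 2 = - (1 + (f x x + 1)) by rewrite mulr2n;
    ring.
  by rewrite oppr_ge0 lt_geF// ltr_pwDl// addr_ge0.
have yp : 0 < f y y by rewrite lt_def y0 fpos.
have := key (f y y)^-1; rewrite ger0_real ?invr_ge0// => /(_ isT).
have -> : f x x - (f y y)^-1 * `|f x y| ^+ 2 *+ 2 +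
  (f y y)^-1 ^+ 2 * `|f x y| ^+ 2 * f y y =
    f x x - (f y y)^-1 * `|f x y| ^+ 2 by rewrite mulr2n; field.
rewrite subr_ge0.
by rewrite mulrC ler_pdivrMr.
Qed.

End CauchySchwarz.

Section HilbertBasics.
Variables (R : realType) (H : hilbert R).
Local Notation C := R[i].
Implicit Types (x y z : H).
Local Notation "'[ x , y ]" := (hdot H x y).

Lemma hdotC x y : '[x, y] = '[y, x]^*.
Proof. by rewrite hermC/= expr0 mul1r. Qed.
Lemma hdot_linl y : linear ((fun x => '[x, y]) : H -> C^o).
Proof. by move=> c u v; rewrite linearPl. Qed.
Lemma hdotDl x y z : '[x + y, z] = '[x, z] + '[y, z]. Proof. exact: linearDl. Qed.
Lemma hdotDr x y z : '[z, x + y] = '[z, x] + '[z, y]. Proof. exact: linearDr. Qed.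
Lemma hdotBl x y z : '[x - y, z] = '[x, z] - '[y, z]. Proof. exact: linearBl. Qed.
Lemma hdotBr x y z : '[z, x - y] = '[z, x] - '[z, y]. Proof. exact: linearBr. Qed.
Lemma hdotZl c x z : '[c *: x, z] = c * '[x, z]. Proof. exact: linearZl_LR. Qed.
Lemma hdotZr c x z : '[z, c *: x] = c^* * '[z, x]. Proof. exact: linearZr_LR. Qed.
Lemma hdot_ge0 x : 0 <= '[x, x]. Proof. by rewrite -hdotE exprn_ge0. Qed.

Lemma hdot_CS x y : `|'[x, y]| <= `|x| * `|y|.
Proof.
rewrite -(@ler_pXn2r _ 2)// ?nnegrE ?mulr_ge0// exprMn !hdotE.
exact: (form_CauchySchwarz hdot_linl hdotC hdot_ge0).
Qed.

End HilbertBasics.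

Section TensorSquareForm.
Variables (R : realType) (A : multiplier_hopf_star_algebra R[i]).
Local Notation C := R[i].
Local Notation AA := (tensor A A).
Local Notation T1 := (@mh_T1 C A).
Local Notation T2 := (@mh_T2 C A).
Variables (psi : A -> C^o) (H : hilbert R) (Lambda : {linear A -> H}).
Hypothesis lpsi : linear psi.
Hypothesis psiT1 : forall a b, lslice psi (T1 (tens a b)) = psi a *: b.
Hypothesis hL : forall a a', hdot H (Lambda a') (Lambda a) = psi (a^! ** a').
Implicit Types (a b c x y : A) (X Y : AA).

Definition form2 X Y : C := psi (lslice psi (tensor_mul (tensor_star Y) X)).

Lemma form2_tens x y x' y' :
  form2 (tens x y) (tens x' y') = psi (x'^! ** x) * psi (y'^! ** y).
Proof.
by rewrite /form2 tensor_star_tens tensor_mul_tens lslice_tens// (linZ _ _ lpsi).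
Qed.

Lemma form2_linl Y : linear ((form2^~ Y) : AA -> C^o).
Proof.
apply: lin_comp lpsi _; apply: lin_comp (lslice_linear lpsi) _.
exact: tmul_linr.
Qed.

Lemma form2C X Y : form2 X Y = (form2 Y X)^*.
Proof.
have anti Z (d : C) U V : form2 Z (d *: U + V) = d^* * form2 Z U + form2 Z V.
  by rewrite /form2 tensor_star_antilinear tmul_linl (lslice_linear lpsi) lpsi.
have lr Z : linear ((fun Y => (form2 Z Y)^* : C^o) : AA -> C^o).
  by move=> c U V; rewrite anti rmorphD rmorphM /= conjCK.
have [sX ->] := tensor_sum X; have [sY ->] := tensor_sum Y.
rewrite (lin_sum _ _ _ (form2_linl _)) (lin_sum _ _ _ (lr _)).
have lr2 Z : form2 Z (\sum_(p <- sY) tens p.1 p.2) = \sum_(p <- sY) form2 Z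
  (tens p.1 p.2).
  rewrite -[LHS]conjCK (lin_sum _ _ _ (lr Z)) rmorph_sum; apply: eq_bigr => q _.
  by rewrite /= conjCK.
apply: eq_bigr => p _; rewrite lr2 (lin_sum _ _ _ (form2_linl _)) rmorph_sum.
apply: eq_bigr => q _; rewrite !form2_tens rmorphM /= -!hL.
by rewrite [hdot H (Lambda p.1) _]hdotC [hdot H (Lambda p.2) _]hdotC.
Qed.

(* Gram-Schmidt on the first legs *)
Lemma form2_ge0 X : 0 <= form2 X X.
Proof.
have [s ->] := tensor_sum X; have [n] := ubnP (size s).
elim: n s => // n IH [|[u v] s].
  by rewrite big_nil /= (lin0 (form2_linl _)).
rewrite /= ltnS => sn; rewrite big_cons /=.
pose c (w : A) := psi (u^! ** w) / psi (u^! ** u).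
have cE w : psi (u^! ** (w - c w *: u)) = 0.
  rewrite sa_mulBr sa_mulZr (linB _ _ lpsi) (linZ _ _ lpsi) /c.
  (* If [psi (u^! ** u) = 0], the division in [c] returns 0; but then [Lambda u = 0] and the
     orthogonality holds anyway. *)
  have [u0|u0] := eqVneq (psi (u^! ** u)) 0; last first.
    by rewrite /GRing.scale /= divfK// subrr.
  rewrite u0 scaler0 subr0 -hL.
  have /eqP : `|Lambda u| ^+ 2 = 0 by rewrite hdotE hL.
  by rewrite sqrf_eq0 normr_eq0 => /eqP ->; rewrite linear0r.
pose v' := v + \sum_(p <- s) c p.1 *: p.2.
pose s' := [seq (p.1 - c p.1 *: u, p.2) | p <- s].
have E : tens u v + \sum_(p <- s) tens p.1 p.2 =
    tens u v' + \sum_(p <- s') tens p.1 p.2 :> AA.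
  rewrite big_map /= /v' tensDr -addrA; congr (_ + _).
  rewrite (lin_sum _ _ _ (@tens_linr _ _ _ u)) -big_split /=;
    apply: eq_bigr => p _.
  by rewrite (linB _ _ (@tens_linl _ _ _ p.2)) tensZl tensZr addrC subrK.
rewrite E.
have cross : form2 (\sum_(p <- s') tens p.1 p.2) (tens u v') = 0.
  rewrite (lin_sum _ _ _ (form2_linl _)) big_map big1// => p _ /=.
  by rewrite form2_tens cE mul0r.
rewrite (form_Dl form2_linl) !(form_Dr form2_linl form2C) cross.
rewrite (form2C (tens u v') (\sum_(p
  <- s') _)) cross rmorph0 addr0 add0r addr_ge0//.
  by rewrite form2_tens -!hL mulr_ge0// hdot_ge0.
by apply: IH; rewrite size_map.
Qed.

(** The adjoint of [T1 (tens x y)] times [T1 (tens x y)] is [(1 (x) y^!) Delta(x^! x) (1 (x) y)],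
    and right invariance integrates the first leg to a scalar. *)
Lemma form2_T1 x y : form2 (T1 (tens x y)) (T1 (tens x y)) = psi
  (x^! ** x) * psi (y^! ** y).
Proof.
have -> : form2 (T1 (tens x y)) (T1 (tens x y)) =
    psi (lslice psi (tensor_mul (hopf_T4 x^! y^!) (T1 (tens x y)))).
  by rewrite /hopf_T4 !sa_starK.
rewrite T4mull DeltaL_T1 lslice2l// psiT1 sa_mulZr (linZ _ _ lpsi).
by [].
Qed.

Lemma form2_T1_tens x y x' y' : form2 (T1 (tens x y)) (tens x' y') =
  psi (y'^! ** (slice_T2 psi x'^! x ** y)).
Proof.
by rewrite /form2 tensor_star_tens -leg21l leg1l_T1 lslice2l// lslice2r.
Qed.

(** Cauchy-Schwarz for [form2] between [T1 (tens x y)] and [tens x' (p ** y)]: the second leg of the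
    test tensor makes the pairing equal to [|Lambda (p ** y)|^2], one factor of which cancels
    against the norm of that leg. *)
Lemma slice_T2_bounded x x' y :
  `|Lambda (slice_T2 psi x'^! x ** y)|
    <= `|Lambda x| * `|Lambda x'| * `|Lambda y|.
Proof.
set p := slice_T2 _ _ _.
have := form_CauchySchwarz form2_linl form2C form2_ge0
  (T1 (tens x y)) (tens x' (p ** y)).
rewrite form2_T1_tens -/p form2_T1 form2_tens -!hL -!hdotE normrX normr_id.
set n := `|Lambda (p ** y)|; have n_ge0 : 0 <= n by exact: normr_ge0.
rewrite -!exprMn ler_pXn2r// ?nnegrE ?mulr_ge0//.
have [n0|n0] := eqVneq n 0; first by rewrite n0 !mulr_ge0.
have np : 0 < n by rewrite lt_def n0 normr_ge0.
rewrite expr2 mulrA ler_pM2r// => /le_trans; apply.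
by rewrite mulrAC.
Qed.

Lemma lmul_bounded z0 c : psi z0 = 1 ->
  exists2 k : C, 0 <= k & forall y, `|Lambda (c ** y)| <= k * `|Lambda y|.
Proof.
move=> pz; have [Y YE] := T2_surj (tens z0 c).
have -> : c = lslice psi (T2 Y) by rewrite YE lslice_tens// pz scale1r.
move: Y {YE}; apply: tensor_ind => [a b||Y1 Y2 [k1 k10 h1] [k2 k20 h2]].
- exists (`|Lambda b| * `|Lambda a^!|); first by rewrite mulr_ge0.
  by move=> y; rewrite -{1}[a]sa_starK; exact: slice_T2_bounded.
- exists 0 => // y; rewrite (lin0 (@T2_lin _ A)) (lin0 (lslice_linear lpsi)).
  by rewrite sa_mul0l linear0 normr0 mul0r.
- exists (k1 + k2); first exact: addr_ge0.
  move=> y; rewrite (linD _ _ (@T2_lin _ A)) (linD _ _ (lslice_linear lpsi)).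
  rewrite sa_mulDl linearD mulrDl; apply: le_trans (ler_normD _ _) _.
  exact: lerD.
Qed.

End TensorSquareForm.

(** * Projections in Hilbert space *)

Section RealGeometry.
Variables (R : realType) (H : hilbert R).
Local Notation C := R[i].
Implicit Types (x y z : H).

(** [nr] and [rd] take values in [R], where infima exist and linear arithmetic applies; complex
    identities are recovered by letting a scalar act on one argument. *)
Definition nr x : R := complex.Re `|x|.
Definition rd x y : R := complex.Re (hdot H x y).

Lemma ReD (a b : C) : complex.Re (a + b) = complex.Re a + complex.Re b.
Proof. by case: a; case: b. Qed.
Lemma ReN (a : C) : complex.Re (- a) = - complex.Re a.
Proof. by case: a. Qed.
Lemma ReB (a b : C) : complex.Re (a - b) = complex.Re a - complex.Re b.
Proof. by rewrite ReD ReN. Qed.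
Lemma Re_conj (a : C) : complex.Re (a^*)%R = complex.Re a.
Proof. by case: a. Qed.
Lemma ReZ (c : R) (a : C) : complex.Re (c%:C%C * a) = c * complex.Re a.
Proof. by case: a => a b /=; rewrite mul0r subr0. Qed.
Lemma Re_sum (I : Type) (s : seq I) (P : pred I) (F : I -> C) :
  complex.Re (\sum_(i <- s | P i) F i) = \sum_(i <- s | P i) complex.Re (F i).
Proof. by apply: (big_morph _ ReD). Qed.
Lemma Re_le (a : C) : `|complex.Re a| <= complex.Re `|a|.
Proof. by have := normc_ge_Re a; rewrite lecE => /andP[]. Qed.
Lemma le_Re (a b : C) : a <= b -> complex.Re a <= complex.Re b.
Proof. by rewrite lecE => /andP[]. Qed.

Lemma nrE x : `|x| = (nr x)%:C%C.
Proof. by rewrite /nr RRe_real// normr_real. Qed.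
Lemma nr_ge0 x : 0 <= nr x.
Proof. by have := normr_ge0 x; rewrite nrE ler0c. Qed.
Lemma nr_sqr x : nr x ^+ 2 = rd x x.
Proof.
by rewrite /rd -hdotE nrE -rmorphXn.
Qed.
Lemma nrD x y : nr (x + y) <= nr x + nr y.
Proof. by have := ler_normD x y; rewrite !nrE -rmorphD lecR. Qed.
Lemma nrN x : nr (- x) = nr x.
Proof. by rewrite /nr normrN. Qed.
Lemma nrBC x y : nr (x - y) = nr (y - x).
Proof. by rewrite -nrN opprB. Qed.
Lemma nrZ (c : C) x : nr (c *: x) = complex.Re `|c| * nr x.
Proof.
by rewrite /nr normrZ -ReZ; congr complex.Re; congr (_ * _).
Qed.
Lemma nr0 : nr 0 = 0. Proof. by rewrite /nr normr0. Qed.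
Lemma nr_eq0 x : nr x = 0 -> x = 0.
Proof. by move=> h; apply/eqP; rewrite -normr_eq0 nrE h. Qed.
Lemma nr_tri x y z : nr (x - z) <= nr (x - y) + nr (y - z).
Proof. by apply: le_trans (nrD _ _); rewrite addrA subrK. Qed.
Lemma nr_subD x y : nr x <= nr y + nr (x - y).
Proof. by apply: le_trans (nrD _ _); rewrite addrC subrK. Qed.

Lemma rdC x y : rd x y = rd y x.
Proof. by rewrite /rd hdotC Re_conj. Qed.
Lemma rdDl x y z : rd (x + y) z = rd x z + rd y z.
Proof. by rewrite /rd hdotDl ReD. Qed.
Lemma rdDr x y z : rd z (x + y) = rd z x + rd z y.
Proof. by rewrite /rd hdotDr ReD. Qed.
Lemma rdBl x y z : rd (x - y) z = rd x z - rd y z.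
Proof. by rewrite /rd hdotBl ReB. Qed.
Lemma rdBr x y z : rd z (x - y) = rd z x - rd z y.
Proof. by rewrite /rd hdotBr ReB. Qed.
Lemma rdZl (c : R) x z : rd (c%:C%C *: x) z = c * rd x z.
Proof. by rewrite /rd hdotZl ReZ. Qed.
Lemma rdZr (c : R) x z : rd z (c%:C%C *: x) = c * rd z x.
Proof. by rewrite rdC rdZl rdC. Qed.
Lemma rd0l x : rd 0 x = 0. Proof. by rewrite /rd linear0l. Qed.
Lemma rd0r x : rd x 0 = 0. Proof. by rewrite rdC rd0l. Qed.
Lemma rd_ge0 x : 0 <= rd x x. Proof. by rewrite -nr_sqr exprn_ge0// nr_ge0. Qed.
Lemma rd_suml (I : Type) (s : seq I) (P : pred I) (F : I -> H) z :
  rd (\sum_(i <- s | P i) F i) z = \sum_(i <- s | P i) rd (F i) z.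
Proof. by rewrite /rd linear_sumlz Re_sum. Qed.

Lemma hdot_nr x y : complex.Re `|hdot H x y| <= nr x * nr y.
Proof. by have := hdot_CS x y; rewrite !nrE -rmorphM /= => /le_Re. Qed.
Lemma rd_CS x y : `|rd x y| <= nr x * nr y.
Proof. exact: le_trans (Re_le _) (hdot_nr x y). Qed.
Lemma rd_le x y : rd x y <= nr x * nr y.
Proof. exact: le_trans (ler_norm _) (rd_CS x y). Qed.

Lemma rd_hdot0 x y : hdot H x y = 0 -> rd x y = 0.
Proof. by rewrite /rd => ->. Qed.

Lemma le_eps (k x y : R) : (forall e : R, 0 < e -> x <= y + k * e) -> x <= y.
Proof.
move=> h; apply/ler_addgt0Pr => e e0.
have k1 : 0 < `|k| + 1 by rewrite ltr_wpDl.
apply: le_trans (h (e / (`|k| + 1)) _) _; first by rewrite divr_gt0.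
rewrite lerD2l mulrCA -[leRHS]mulr1 ler_pM2l// ler_pdivrMr// mul1r.
by rewrite (le_trans (ler_norm _))// lerDl.
Qed.

Lemma nr_eps (k : R) x : (forall e : R, 0 < e -> nr x <= k * e) -> x = 0.
Proof.
move=> h; apply: nr_eq0; apply/eqP; rewrite eq_le nr_ge0 andbT.
by apply: (@le_eps k) => e e0; rewrite add0r h.
Qed.

Lemma inv_natS_lt (e : R) : 0 < e -> exists N : nat, forall n, (N <= n)%N
  -> n.+1%:R^-1 < e.
Proof.
by move=> e0; have [N _ hN] := near_infty_natSinv_lt (PosNum e0);
  exists N => n /hN.
Qed.

Lemma nr_complete (u : nat -> H) :
  (forall e : R, 0 < e -> exists N : nat, forall m n, (N <= m)%N -> (N <= n)%N ->
     nr (u m - u n) < e) ->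
  exists l, forall e : R, 0 < e -> exists N : nat, forall n, (N <= n)%N -> nr
    (u n - l) < e.
Proof.
move=> cu; have reC (e : C) : 0 < e -> exists2 r : R, 0 < r & e = r%:C%C.
  move=> e0; exists (complex.Re e); last by rewrite RRe_real// gtr0_real.
  by move: e0; rewrite ltcE => /andP[].
have /cvg_ex[l ul] : cvg (u @ \oo).
  apply: cauchy_cvg; apply: cauchy_exP => _ /reC[e e0 ->].
  have [N hN] := cu e e0; exists (u N); exists N => // n /= Nn.
  rewrite -ball_normE /= nrE ltcR; exact: hN.
exists l => e e0; move/cvgrPdist_lt: ul => /(_ e%:C%C).
rewrite ltcR => /(_ e0).
by move=> [N _ hN]; exists N => n /hN /=; rewrite nrE ltcR nrBC.
Qed.

End RealGeometry.

Section Projection.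
Variables (R : realType) (H : hilbert R) (I : finType) (D : lmodType R[i]).
Variable f : D -> I -> H.
Hypothesis lf : forall i, linear (f^~ i).
Local Notation Q g := (\sum_(i : I) rd (g i) (g i)).

Let Q_ge0 (g : I -> H) : 0 <= Q g.
Proof. by apply: sumr_ge0 => i _; exact: rd_ge0. Qed.
Let Q_coord (g : I -> H) i : nr (g i) ^+ 2 <= Q g.
Proof.
rewrite (bigD1 i)//= nr_sqr lerDl; apply: sumr_ge0 => j _; exact: rd_ge0.
Qed.

(** The orthogonal projection onto the closure of the range of [f] in the power of [H] indexed by
    [I]. The several coordinates make it serve both for approximation at finitely many vectors at
    once and for projections onto graphs. *)
Lemma projection (xi : I -> H) : exists u : I -> H,
  (forall e : R, 0 < e -> exists x, forall i, nr (u i - f x i) < e) /\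
  (forall y, \sum_i hdot H (xi i - u i) (f y i) = 0).
Proof.
pose S := [set Q (fun i => xi i - f x i) | x in [set: D]].
have Sinf : has_inf S.
  split; first by exists (Q (fun i => xi i - f 0 i)), 0.
  by exists 0 => _ [x _ <-]; exact: Q_ge0.
set d := inf S.
have dle x : d <= Q (fun i => xi i - f x i).
  by apply: ge_inf; [exact: Sinf.2|exists x].
have /choice[x xP] : forall k : nat, exists x,
    Q (fun i => xi i - f x i) < d + k.+1%:R^-1.
  move=> k; have [|_ [x _ <-] hx] := @inf_adherent _ S k.+1%:R^-1 _ Sinf.
    by rewrite invr_gt0.
  by exists x.
(* Parallelogram identity: the midpoint of [x m] and [x n] cannot do better than [d]. *)
have par m n : Q (fun i => f (x m) i - f (x n) i) <= 2 * (m.+1%:R^-1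
  + n.+1%:R^-1).
  have E : Q (fun i => f (x m) i - f (x n) i) =
      2 * Q (fun i => xi i - f (x m) i) + 2 * Q (fun i => xi i - f (x n) i)
      - 4 * Q (fun i => xi i - f ((2^-1)%:C%C *: (x m + x n)) i).
    rewrite !mulr_sumr -sumrN -!big_split /=; apply: eq_bigr => i _.
    rewrite (linZ _ _ (lf i)) (linD _ _ (lf i)).
    rewrite !(rdBl, rdBr, rdDl, rdDr, rdZl, rdZr).
    rewrite ![rd (f _ i) (xi i)]rdC [rd (f (x n) i) (f (x m) i)]rdC.
    by field.
  have par_real (a b c d' s t : R) : d' <= a -> b < d' + s -> c < d' + t ->
      2 * b + 2 * c - 4 * a <= 2 * (s + t) by lra.
  by rewrite E; exact: par_real (dle _) (xP m) (xP n).
have /choice[u uP] : forall i, exists l, forall e : R, 0 < e ->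
    exists N : nat, forall n, (N <= n)%N -> nr (f (x n) i - l) < e.
  move=> i; apply: nr_complete => e e0.
  have e4 : 0 < e ^+ 2 / 4 by rewrite divr_gt0// exprn_gt0.
  have [N hN] := inv_natS_lt e4; exists N => m n Nm Nn.
  rewrite -(@ltr_pXn2r _ 2)// ?nnegrE ?nr_ge0//; last exact: ltW.
  apply: le_lt_trans (Q_coord (fun i => f (x m) i - f (x n) i) i) _.
  apply: le_lt_trans (par m n) _; move: (hN m Nm) (hN n Nn).
  by move: (m.+1%:R^-1) (n.+1%:R^-1) => a b; lra.
have conv e : 0 < e -> exists N : nat, forall n, (N <= n)%N -> forall i,
    nr (f (x n) i - u i) < e.
  move=> e0; have /choice[N NP] i := uP i e e0.
  exists (\max_i N i) => n Nn i; apply: NP.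
  by apply: leq_trans Nn; exact: leq_bigmax.
exists u; split=> [e e0|y].
  have [N hN] := conv e e0; exists (x N) => i.
  by rewrite nrBC; exact: hN.
(* First variation: [x k] is compared with [x k + t z], where [k] is so large that the defect of
   minimality is below [t ^+ 2]. *)
have step z : \sum_i rd (xi i - u i) (f z i) <= 0.
  set q := \sum_i _.
  apply: (@le_eps _ (1 + Q (f z) + \sum_i nr (f z i))) => t t0.
  have [N1 h1] := conv t t0.
  have t2 : 0 < t ^+ 2 by rewrite exprn_gt0.
  have [N2 h2] := inv_natS_lt t2.
  pose k := maxn N1 N2.
  have hk1 i := h1 k (leq_maxl _ _) i.
  have hk2 := h2 k (leq_maxr _ _).
  have qk : q <= \sum_i rd (xi i - f (x k) i) (f z i) + t * \sum_i nr (f z i).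
    rewrite mulr_sumr -big_split /=; apply: ler_sum => i _.
    rewrite -lerBlDl -rdBl opprB [X in rd X]addrC subrKA.
    apply: le_trans (rd_le _ _) _; rewrite ler_wpM2r ?nr_ge0//.
    exact/ltW/hk1.
  have E : Q (fun i => xi i - f (x k + t%:C%C *: z) i) =
      Q (fun i => xi i - f (x k) i) - 2 * t * \sum_i rd (xi i - f (x k) i) (f z i)
      + t ^+ 2 * Q (f z).
    rewrite !mulr_sumr -sumrN -!big_split /=; apply: eq_bigr => i _.
    rewrite (linD _ _ (lf i)) (linZ _ _ (lf i)).
    rewrite !(rdBl, rdBr, rdDl, rdDr, rdZl, rdZr).
    rewrite [rd (f (x k) i) (xi i)]rdC [rd (f z i) (xi i)]rdC [rd (f z i) (f
      (x k) i)]rdC.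
    by ring.
  have real_step (q1 q2 q3 q4 r : R) : r < t ^+ 2 -> q1 < d + r ->
      d <= q1 - 2 * t * q2 + t ^+ 2 * q3 -> q <= q2 + t * q4 -> 0 <= q3 ->
      q <= 0 + (1 + q3 + q4) * t.
    move=> hr h1' h2' h3' q30.
    have : t * (2 * q2) <= t * (t * (1 + q3)) by lra.
    rewrite ler_pM2l// => h; have : 0 <= t * q3 by rewrite mulr_ge0// ltW.
    by lra.
  have := dle (x k + t%:C%C *: z); rewrite E => hd.
  exact: real_step hk2 (xP k) hd qk (Q_ge0 (f z)).
have stepc (c : R[i]) : \sum_i rd (xi i - u i) (c *: f y i) = 0.
  apply/eqP; rewrite eq_le; apply/andP; split.
    by have := step (c *: y); under eq_bigr do rewrite (linZ _ _ (lf _)).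
  rewrite -oppr_le0 -sumrN.
  have := step ((- c) *: y); under eq_bigr do rewrite (linZ _ _ (lf _)).
  apply: le_trans; rewrite le_eqVlt; apply/orP; left; apply/eqP.
  by apply: eq_bigr => i _; rewrite scaleNr /rd linearNr ReN.
(* Taking the complex sum itself as the scalar turns the vanishing of a real part into
   [|s|^2 = 0]. *)
set s := \sum_i _; have := stepc s.
have -> : \sum_i rd (xi i - u i) (s *: f y i) = complex.Re (s^* * s).
  rewrite /rd -Re_sum; congr complex.Re; rewrite /s mulr_sumr.
  by apply: eq_bigr => i _; rewrite hdotZr.
rewrite mulrC -normCK => h0.
apply/eqP; rewrite -normr_eq0 -sqrf_eq0; apply/eqP.
by rewrite -[LHS]RRe_real ?h0// ger0_real// exprn_ge0.
Qed.

End Projection.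

(** * The GNS representation *)

Section BoundedOperators.
Variables (R : realType) (H : hilbert R).
Local Notation C := R[i].
Implicit Types (S T : H -> H) (x y z : H).

Lemma bounded_nr T : bounded_operator T ->
  exists2 k : R, 0 < k & forall x, nr (T x) <= k * nr x.
Proof.
move=> [_ [k kP]]; exists (`|complex.Re k| + 1); first by rewrite ltr_wpDl.
move=> x; have := le_Re (kP x); rewrite !nrE mulrC ReZ mulrC => /le_trans; apply.
rewrite ler_wpM2r ?nr_ge0// (le_trans (ler_norm _))// lerDl; exact: ler01.
Qed.

Lemma nr_bounded T (k : R) : linear T -> (forall x, nr (T x) <= k * nr x) ->
  bounded_operator T.
Proof.
move=> lT kP; split=> //; exists k%:C%C => x.
by rewrite !nrE -rmorphM lecR.
Qed.

Lemma bounded_linear T : bounded_operator T -> linear T.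
Proof. by case. Qed.

Lemma opnorm_le1 T : bounded_operator T ->
  (opnorm T <= 1 <-> forall x, nr (T x) <= nr x).
Proof.
move=> bT; have lT := bounded_linear bT; split=> [T1 x|T1].
  have [k k0 kP] := bounded_nr bT.
  have [x0|x0] := eqVneq (nr x) 0.
    by rewrite (nr_eq0 x0) (lin0 lT).
  have xp : 0 < nr x by rewrite lt_def x0 nr_ge0.
  (* [sup] takes a default value on a set without upper bound, so the boundedness of [T] is what
     gives [opnorm T <= 1] its content. *)
  have ub : has_ubound [set complex.Re `|T x| | x in [set x : H | `|x| <= 1]].
    exists k => _ [y /= y1 <-]; have := kP y; rewrite /nr => /le_trans; apply.
    by have := le_Re y1; rewrite -[X in _ -> _ <= X]mulr1 ler_pM2l.
  pose z := (nr x)^-1%:C%C *: x.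
  have nz : nr z = 1.
    by rewrite nrZ normc_def /= expr0n addr0 sqrtr_sqr ger0_norm ?mulVf//
      invr_ge0 nr_ge0.
  have : complex.Re `|T z| <= 1.
    apply: le_trans T1; apply: ub_le_sup => //; exists z => //=.
    by rewrite nrE nz.
  rewrite /z (linZ _ _ lT) -/(nr _) nrZ normc_def /= expr0n addr0 sqrtr_sqr.
  by rewrite ger0_norm ?invr_ge0 ?nr_ge0// mulrC ler_pdivrMr// mul1r.
apply: ge_sup => [|_ [x /= x1 <-]];
  first by exists (complex.Re `|T 0|), 0 => //=; rewrite normr0.
by apply: le_trans (T1 x) _; have := le_Re x1.
Qed.

End BoundedOperators.

Section DenseRange.
Variables (R : realType) (H : hilbert R) (A : lmodType R[i]) (L : A -> H).
Local Notation C := R[i].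
Hypotheses (lL : linear L) (dL : dense (range L)).

Lemma dense_approx (x : H) (e : R) : 0 < e -> exists a, nr (x - L a) < e.
Proof.
move=> e0; have eC : 0 < e%:C%C :> C by rewrite ltcR.
have [|y [/interior_subset xa [a _ aE]]] := dL _ (open_interior (ball x e%:C%C)).
  by exists x; exact: nbhsx_ballx.
by exists a; move: xa; rewrite -aE -ball_normE /= nrE ltcR.
Qed.

Lemma dense_zero (F : H -> R) (k : R) :
  (forall x y, F x - F y <= k * nr (x - y)) -> (forall a, F (L a) <= 0) ->
  forall x, F x <= 0.
Proof.
move=> Fk F0 x; apply: (@le_eps _ `|k|) => e e0; rewrite add0r.
have [a ha] := dense_approx x e0.
have := Fk x (L a); rewrite lerBlDr => /le_trans; apply.
rewrite -[leRHS]addr0 lerD//; apply: le_trans (ler_norm _) _.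
rewrite normrM [`|nr _|]ger0_norm ?nr_ge0// ler_wpM2l//.
exact: ltW.
Qed.

Lemma dense_orth (z : H) : (forall a, hdot H z (L a) = 0) -> z = 0.
Proof.
move=> zL; apply: (@nr_eps _ _ 1) => e e0; rewrite mul1r.
have [->|z0] := eqVneq (nr z) 0; first exact: ltW.
have zp : 0 < nr z by rewrite lt_def z0 nr_ge0.
rewrite -(@ler_pM2l _ (nr z))// -expr2 nr_sqr.
have [a ha] := dense_approx z e0.
have -> : rd z z = rd z (z - L a) by rewrite rdBr (rd_hdot0 (zL a)) subr0.
by apply: le_trans (rd_le _ _) _; rewrite ler_pM2l// ltW.
Qed.

Lemma dense_eq (S T : H -> H) : bounded_operator S -> bounded_operator T ->
  (forall a, S (L a) = T (L a)) -> S = T.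
Proof.
move=> bS bT ST; apply/funext => x.
have [k k0 kP] := bounded_nr bS; have [l l0 lP] := bounded_nr bT.
apply/eqP; rewrite -subr_eq0; apply/eqP/(@nr_eps _ _ (k + l)) => e e0.
have [a ha] := dense_approx x e0.
have -> : S x - T x = S (x - L a) - T (x - L a).
  rewrite (linB _ _ (bounded_linear bS)) (linB _ _ (bounded_linear bT)) ST.
  by rewrite opprB addrA subrK.
apply: le_trans (nrD _ _) _; rewrite nrN mulrDl; apply: lerD.
  by apply: le_trans (kP _) _; rewrite ler_pM2l// ltW.
by apply: le_trans (lP _) _; rewrite ler_pM2l// ltW.
Qed.

Lemma bounded_extension (f : A -> H) (k : R) : linear f -> 0 <= k ->
  (forall a, nr (f a) <= k * nr (L a)) ->
  exists T : H -> H, [/\ linear T, forall x, nr (T x) <= k * nr x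
                       & forall a, T (L a) = f a].
Proof.
move=> lf k0 fk.
have fB a b : nr (f a - f b) <= k * nr (L a - L b).
  by rewrite -(linB _ _ lf) -(linB _ _ lL).
(* [G] is the closure of the graph of [L a |-> f a]; the constant [K] absorbs the factors produced
   by linear combinations. *)
pose G K x w := forall e : R, 0 < e -> exists a, nr (x - L a) <= K * e /\ nr
  (w - f a) <= K * e.
have Guniq K K' x w w' : G K x w -> G K' x w' -> w = w'.
  move=> Gw Gw'; apply/eqP; rewrite -subr_eq0; apply/eqP.
  apply: (@nr_eps _ _ ((1 + k) * (K + K'))) => e e0.
  have [a [a1 a2]] := Gw e e0; have [b [b1 b2]] := Gw' e e0.
  apply: le_trans (nr_tri _ (f a) _) _.
  have h1 : nr (f a - w') <= k * (K * e + K' * e) + K' * e.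
    apply: le_trans (nr_tri _ (f b) _) _; rewrite [nr (f b - _)]nrBC;
      apply: lerD => //.
    apply: le_trans (fB _ _) _; rewrite ler_wpM2l//.
    by apply: le_trans (nr_tri _ x _) _; rewrite [nr (L a - _)]nrBC lerD.
  by apply: le_trans (lerD a2 h1) _; rewrite le_eqVlt; apply/orP; left;
    apply/eqP; ring.
have Gex x : exists w, G 1 x w.
  have /choice[a aP] (n : nat) : exists a, nr (x - L a) < n.+1%:R^-1.
    by apply: dense_approx; rewrite invr_gt0.
  have [|w wP] := @nr_complete R H (fun n => f (a n)).
    move=> e e0; have e2 : 0 < e / (2 * (k + 1)).
      by rewrite divr_gt0// mulr_gt0// ltr_wpDl.
    have [N hN] := inv_natS_lt e2; exists N => m n Nm Nn.
    apply: le_lt_trans (fB _ _) _.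
    have h1 : nr (L (a m) - L (a n)) < e / (k + 1).
      apply: le_lt_trans (nr_tri _ x _) _; rewrite nrBC.
      have -> : e / (k + 1) = e / (2 * (k + 1)) + e / (2 * (k + 1)).
        by field; rewrite gt_eqF// ltr_wpDl.
      by apply: ltrD; apply: lt_trans (aP _) _; apply: hN.
    apply: le_lt_trans (_ : _ <= k * (e / (k + 1))) _;
      first by rewrite ler_wpM2l// ltW.
    by rewrite mulrCA -[ltRHS]mulr1 ltr_pM2l// ltr_pdivrMr ?ltr_wpDl// mul1r
      ltrDl.
  exists w => e e0; have [N1 h1] := wP e e0; have [N2 h2] := inv_natS_lt e0.
  exists (a (maxn N1 N2)); rewrite mul1r; split; apply: ltW.
    by apply: lt_trans (aP _) _; apply: h2; rewrite leq_maxr.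
  by rewrite nrBC; apply: h1; rewrite leq_maxl.
have /choice[T TP] := Gex.
exists T; split.
- move=> c x y.
  apply: (Guniq 1 (complex.Re `|c| + 1) (c *: x + y)) => // e e0.
  have [a [a1 a2]] := TP x e e0; have [b [b1 b2]] := TP y e e0.
  rewrite !mul1r in a1 a2 b1 b2.
  have c0 : 0 <= complex.Re `|c| by have := le_Re (normr_ge0 c).
  have E (u v u' v' : H) : c *: u + v - (c *: u' + v') = c *: (u - u') + (v - v').
    by rewrite opprD addrACA scalerBr.
  exists (c *: a + b); rewrite lL lf !E mulrDl mul1r.
  by split; (apply: le_trans (nrD _ _) _); rewrite nrZ lerD// ler_wpM2l.
- move=> x; apply: (@le_eps _ (1 + k)) => e e0.
  have [a [a1 a2]] := TP x e e0; rewrite !mul1r in a1 a2.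
  apply: le_trans (nr_subD _ (f a)) _.
  have : nr (f a) <= k * (nr x + e).
    apply: le_trans (fk a) _; rewrite ler_wpM2l//.
    by apply: le_trans (nr_subD _ x) _; rewrite nrBC lerD2l.
  by move=> /lerD/(_ a2)/le_trans; apply; rewrite le_eqVlt; apply/orP; left;
    apply/eqP; ring.
- move=> a; apply: (Guniq 1 1 (L a)) => // e e0.
  by exists a; rewrite !subrr nr0 mul1r ltW.
Qed.

End DenseRange.

Section GNSRepresentation.
Variables (R : realType) (A : star_algebra R[i]) (psi : A -> R[i]).
Variables (H : hilbert R) (Lambda : {linear A -> H}).
Local Notation C := R[i].
Hypothesis hL : forall a a', hdot H (Lambda a') (Lambda a) = psi (a^! ** a').
Hypothesis hdense : dense (range Lambda).
Hypothesis hbound : forall c, exists k : R, forall x,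
  nr (Lambda (c ** x)) <= k * nr (Lambda x).
Local Notation pi := (gns_rep Lambda).
Implicit Types (a b c : A) (x y z : H).

Let lL : linear Lambda. Proof. exact: linearP. Qed.

Lemma gns_repP c : bounded_operator (pi c) /\ forall a, pi c (Lambda a) = Lambda
  (c ** a).
Proof.
have [k kP] := hbound c.
have [|||T [lT bT TL]] := @bounded_extension R H A Lambda lL hdense
    (fun a => Lambda (c ** a)) (Num.max k 0).
- exact: lin_comp lL (linmul_l c).
- by rewrite le_max lexx orbT.
- by move=> a; apply: le_trans (kP a) _; rewrite ler_wpM2r ?nr_ge0// le_max lexx.
rewrite /gns_rep; case: xgetP => [S _ //|/(_ T) []]; split=> //.
exact: nr_bounded lT bT.
Qed.

Lemma pi_bounded c : bounded_operator (pi c). Proof. exact: (gns_repP c).1. Qed.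
Lemma pi_Lambda c a : pi c (Lambda a) = Lambda (c ** a). Proof. exact:
  (gns_repP c).2. Qed.
Lemma pi_lin c : linear (pi c). Proof. exact: bounded_linear (pi_bounded c). Qed.

Lemma bounded_comp (S T : H -> H) : bounded_operator S -> bounded_operator T ->
  bounded_operator (fun x => S (T x)).
Proof.
move=> bS bT; have [k k0 kP] := bounded_nr bS; have [l l0 lP] := bounded_nr bT.
apply: (@nr_bounded _ _ _ (k * l)).
  exact: lin_comp (bounded_linear bS) (bounded_linear bT).
by move=> x; apply: le_trans (kP _) _; rewrite -mulrA ler_pM2l.
Qed.

Lemma bounded_lincomb (c : C) (S T : H -> H) : bounded_operator S
  -> bounded_operator T ->
  bounded_operator (fun x => c *: S x + T x).
Proof.
move=> bS bT; have [k k0 kP] := bounded_nr bS; have [l l0 lP] := bounded_nr bT.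
have lS := bounded_linear bS; have lT := bounded_linear bT.
apply: (@nr_bounded _ _ _ (complex.Re `|c| * k + l)).
  move=> d x y; rewrite lS lT !scalerDr !scalerA mulrC -!addrA; congr (_ + _).
  by rewrite addrCA.
move=> x; apply: le_trans (nrD _ _) _;
  rewrite nrZ mulrDl lerD// -mulrA ler_wpM2l//.
by have := le_Re (normr_ge0 c).
Qed.

Lemma piM a b x : pi (a ** b) x = pi a (pi b x).
Proof.
have /funeqP := dense_eq hdense (pi_bounded (a ** b)) (bounded_comp
  (pi_bounded a) (pi_bounded b))
  (fun c => ltac:(by rewrite !pi_Lambda sa_mulA)).
exact.
Qed.

Lemma pi_lincomb (k : C) a b x : pi (k *: a + b) x = k *: pi a x + pi b x.
Proof.
have /funeqP := dense_eq hdense (pi_bounded (k *: a + b)) (bounded_lincomb k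
  (pi_bounded a) (pi_bounded b))
  (fun c => ltac:(by rewrite !pi_Lambda sa_mulDl sa_mulZl linearP)).
exact.
Qed.
Lemma pi_linl x : linear (pi^~ x).
Proof. by move=> k a b; exact: pi_lincomb. Qed.

Lemma pi_adj a x y : hdot H (pi a x) y = hdot H x (pi a^! y).
Proof.
have h1 b c : hdot H (pi a (Lambda b)) (Lambda c) = hdot H (Lambda b) (pi a^!
  (Lambda c)).
  by rewrite !pi_Lambda !hL sa_starM sa_starK sa_mulA.
have [k k0 kP] := bounded_nr (pi_bounded a).
have [l l0 lP] := bounded_nr (pi_bounded a^!).
(* Real parts suffice: multiplying [y] by the difference [w] of the two members turns that
   difference into [|w|^2]. *)
suff key (d : C) : rd (pi a x) (d *: y) - rd x (pi a^! (d *: y)) = 0.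
  have : hdot H (pi a x) y - hdot H x (pi a^! y) = 0.
    set w := _ - _; have := key w;
      rewrite (linZ _ _ (pi_lin _)) /rd !hdotZr -ReB -mulrBr.
    rewrite -/w mulrC -normCK => h0.
    apply/eqP; rewrite -normr_eq0 -sqrf_eq0; apply/eqP.
    by rewrite -[LHS](RRe_real (x := _)) ?h0// ger0_real// exprn_ge0.
  by move/eqP; rewrite subr_eq0 => /eqP.
move: (d *: y) => {}y.
(* One inequality suffices by [x |-> - x]; it extends by density, in [u] and then in [v]. *)
suff le0 u v : rd (pi a u) v - rd u (pi a^! v) <= 0.
  apply/eqP; rewrite eq_le le0/= -oppr_le0; have := le0 (- x) y.
  by rewrite -scaleN1r (linZ _ _ (pi_lin _)) !scaleN1r /rd !linearNl !ReN -opprD.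
move: u; apply: (dense_zero hdense (F := fun u => rd (pi a u) v - rd u (pi a^! v))
   (k := k * nr v + nr (pi a^! v))) => [x1 x2|b].
  have -> : rd (pi a x1) v - rd x1 (pi a^! v) - (rd (pi a x2) v - rd x2
    (pi a^! v)) =
      rd (pi a (x1 - x2)) v + rd (x2 - x1) (pi a^! v).
    by rewrite (linB _ _ (pi_lin _)) !rdBl; ring.
  rewrite mulrDl; apply: lerD; last by rewrite mulrC nrBC; exact: rd_le.
  apply: le_trans (rd_le _ _) _; rewrite mulrAC ler_wpM2r ?nr_ge0//; exact: kP.
move: v; apply: (dense_zero hdense (F := fun v => rd (pi a (Lambda b)) v - rd
  (Lambda b) (pi a^! v))
   (k := nr (pi a (Lambda b)) + nr (Lambda b) * l)) => [x1 x2|c].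
  have -> : rd (pi a (Lambda b)) x1 - rd (Lambda b) (pi a^! x1) -
      (rd (pi a (Lambda b)) x2 - rd (Lambda b) (pi a^! x2)) =
      rd (pi a (Lambda b)) (x1 - x2) + rd (Lambda b) (pi a^! (x2 - x1)).
    by rewrite (linB _ _ (pi_lin _)) !rdBr; ring.
  rewrite mulrDl; apply: lerD; first exact: rd_le.
  apply: le_trans (rd_le _ _) _; rewrite -mulrA ler_wpM2l ?nr_ge0// nrBC;
    exact: lP.
by rewrite /rd h1 subrr.
Qed.

End GNSRepresentation.

Lemma eq_eps (R : realType) (k x y : R) :
  (forall e, 0 < e -> `|x - y| <= k * e) -> x = y.
Proof.
move=> h; apply/eqP; rewrite -subr_eq0 -normr_eq0 eq_le normr_ge0 andbT.
by apply: (@le_eps _ k) => e e0; rewrite add0r h.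
Qed.

(** * Strong approximation in the von Neumann algebra *)

Section VonNeumannAlgebra.
Variables (R : realType) (A : star_algebra R[i]) (psi : A -> R[i]).
Variables (H : hilbert R) (Lambda : {linear A -> H}).
Local Notation C := R[i].
Hypothesis hL : forall a a', hdot H (Lambda a') (Lambda a) = psi (a^! ** a').
Hypothesis hdense : dense (range Lambda).
Hypothesis hbound : forall c, exists k : R, forall x,
  nr (Lambda (c ** x)) <= k * nr (Lambda x).
Hypothesis hsq : forall x : A, exists s : seq (A * A), x = \sum_(p
  <- s) p.1 ** p.2.
Local Notation pi := (gns_rep Lambda).
Local Notation M := (gns_vN_algebra Lambda).
Implicit Types (a b c : A) (x y z : H) (S T P : H -> H).

Let lL : linear Lambda. Proof. exact: linearP. Qed.
Let pib := pi_bounded hdense hbound.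
Let piL := pi_Lambda hdense hbound.
Let pil := pi_lin hdense hbound.
Let pill := pi_linl hdense hbound.
Let piMul := piM hdense hbound.
Let piadj := pi_adj hL hdense hbound.

Lemma pi_nondeg z : (forall a, pi a z = 0) -> z = 0.
Proof.
move=> z0; apply: (dense_orth hdense) => x.
have h b c : hdot H z (Lambda (b ** c)) = 0.
  by rewrite -piL -[b]sa_starK -piadj z0 linear0l.
have [s ->] := hsq x; rewrite (lin_sum _ _ _ lL) linear_sumr big1// => p _.
exact: h.
Qed.

(** Let [r] be the residual of projecting [eta] onto the closure of the tuples [pi b (eta_i)]. The
    sum of the [|pi a r_i|^2] pairs [r] with [pi (a^! ** a) r], a difference of two elements of that
    closure, hence is 0; as [a] is arbitrary, [pi_nondeg] gives [r = 0]. A single [b] thus works for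
    all the vectors. *)
Lemma approx_identity (I : finType) (eta : I -> H) (e : R) : 0 < e ->
  exists b, forall i, nr (eta i - pi b (eta i)) < e.
Proof.
move=> e0.
have [u [uc uo]] := projection (f := fun b i => pi b (eta i)) (fun i => pill
  (eta i)) eta.
suff ru i : eta i = u i.
  by have [b bP] := uc e e0; exists b => i; rewrite {1}ru; exact: bP.
apply/eqP; rewrite -subr_eq0; apply/eqP; apply: pi_nondeg => a.
pose r i := eta i - u i; rewrite -/(r i).
have [k k0 kP] := bounded_nr (pib (a^! ** a)).
have S0 : \sum_i nr (pi a (r i)) ^+ 2 <= 0.
  apply: (@le_eps _ (\sum_i nr (r i) * k)) => d d0; rewrite add0r.
  have [b bP] := uc d d0.
  have E j : nr (pi a (r j)) ^+ 2 = rd (r j) (pi (a^! ** a) (eta j)) -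
      rd (r j) (pi (a^! ** a ** b) (eta j))
      + rd (r j) (pi (a^! ** a) (pi b (eta j) - u j)).
    have -> : nr (pi a (r j)) ^+ 2 = rd (r j) (pi (a^! ** a) (r j)).
      by rewrite nr_sqr /rd piadj piMul.
    rewrite (piMul (a^! ** a)) (linB (pi b (eta j)) (u j) (pil _)) !rdBr.
    have -> : pi (a^! ** a) (r j) = pi (a^! ** a) (eta j) - pi (a^! ** a) (u j).
      exact: (linB _ _ (pil _)).
    by rewrite rdBr; ring.
  under eq_bigr do rewrite E.
  rewrite !big_split /= sumrN.
  have z0 c : \sum_j rd (r j) (pi c (eta j)) = 0.
    by rewrite /rd -Re_sum uo.
  rewrite !z0 subr0 add0r mulr_suml; apply: ler_sum => j _.
  apply: le_trans (rd_le _ _) _; rewrite -mulrA ler_wpM2l ?nr_ge0//.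
  by apply: le_trans (kP _) _; rewrite ler_pM2l// nrBC ltW.
apply: nr_eq0; apply/eqP; rewrite -sqrf_eq0 eq_le exprn_ge0 ?nr_ge0// andbT.
apply: le_trans S0; rewrite (bigD1 i)//= lerDl; apply: sumr_ge0 => j _.
by rewrite exprn_ge0// nr_ge0.
Qed.

(** The operators [pi a] form a subspace, so weak approximation implies strong approximation: the
    residual [r] is orthogonal to all tuples [pi a (x_i)], and a weak approximation of [T] tested at
    the pairs [(x_i, r_i)] shows that [T x] is orthogonal to [r] up to any error. *)
Lemma strong_approx T n (x : 'I_n -> H) (e : R) : M T -> 0 < e ->
  exists a, forall i, nr (T (x i) - pi a (x i)) < e.
Proof.
move=> [bT wT] e0.
have [u [uc uo]] := projection (f := fun b i => pi b (x i)) (fun i => pill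
  (x i)) (fun i => T (x i)).
suff ru i : T (x i) = u i.
  by have [b bP] := uc e e0; exists b => i; rewrite ru; exact: bP.
pose r i := T (x i) - u i.
have z0 c : \sum_j rd (r j) (pi c (x j)) = 0 by rewrite /rd -Re_sum uo.
have S0 : \sum_i nr (r i) ^+ 2 <= 0.
  apply: (@le_eps _ (\sum_i (1 + nr (r i)))) => d d0; rewrite add0r.
  have [b bP] := uc d d0.
  have dC : 0 < d%:C%C :> C by rewrite ltcR.
  have [_ [a _ <-] aP] := wT n x r d%:C%C dC.
  have E j : nr (r j) ^+ 2 <= (1 + nr (r j)) * d
      + (rd (r j) (pi a (x j)) - rd (r j) (pi b (x j))).
    have -> : nr (r j) ^+ 2 = (rd (T (x j)) (r j) - rd (pi a (x j)) (r j))
        + rd (r j) (pi b (x j) - u j)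
        + (rd (r j) (pi a (x j)) - rd (r j) (pi b (x j))).
      rewrite nr_sqr [rd (pi a _) _]rdC rdBr.
      have -> : rd (r j) (r j) = rd (r j) (T (x j)) - rd (r j)
        (u j) by rewrite -rdBr.
      by rewrite [rd (T _) _]rdC; ring.
    rewrite lerD2r mulrDl mul1r; apply: lerD.
      rewrite /rd -ReB; apply: le_trans (ler_norm _) (le_trans (Re_le _) _).
      by have := le_Re (ltW (aP j)).
    apply: le_trans (rd_le _ _) _; rewrite ler_wpM2l ?nr_ge0// nrBC; exact/ltW/bP.
  apply: le_trans (ler_sum _ (fun j _ => E j)) _.
  rewrite mulr_suml big_split /= -[leRHS]addr0 lerD2l.
  by rewrite big_split /= sumrN !z0 subrr.
apply/eqP; rewrite -subr_eq0 -/(r i); apply/eqP.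
apply: nr_eq0; apply/eqP; rewrite -sqrf_eq0 eq_le exprn_ge0 ?nr_ge0// andbT.
apply: le_trans S0; rewrite (bigD1 i)//= lerDl; apply: sumr_ge0 => j _.
by rewrite exprn_ge0// nr_ge0.
Qed.

Lemma strong_approx_vN T : bounded_operator T ->
  (forall n (x : 'I_n -> H) (e : R), 0 < e ->
     exists2 S, M S & forall i, nr (T (x i) - S (x i)) < e) -> M T.
Proof.
move=> bT h; split=> // n x y e e0.
have eR : 0 < complex.Re e by move: e0; rewrite ltcE => /andP[].
pose s := 1 + \sum_i nr (y i).
have sp : 0 < s by rewrite ltr_pwDl// sumr_ge0// => i _; exact: nr_ge0.
have ys i : nr (y i) <= s.
  rewrite /s (bigD1 i)//= addrCA lerDl addr_ge0// sumr_ge0// => j _;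
    exact: nr_ge0.
have d0 : 0 < complex.Re e / (2 * s) by rewrite divr_gt0// mulr_gt0.
have [S MS SP] := h n x _ d0.
have [a aP] := strong_approx x MS d0.
exists (pi a); first by exists a.
move=> i; rewrite -hdotBl.
apply: le_lt_trans (hdot_CS _ _) _; rewrite !nrE -rmorphM.
have -> : e = (complex.Re e)%:C%C by rewrite RRe_real// gtr0_real.
rewrite ltcR; apply: le_lt_trans (_ : _ <= nr (T (x i) - pi a (x i)) * s) _.
  by rewrite ler_wpM2l ?nr_ge0.
have -> : complex.Re e = complex.Re e / s * s by rewrite divfK ?gt_eqF.
rewrite ltr_pM2r//.
apply: le_lt_trans (nr_tri _ (S (x i)) _) _.
have -> : complex.Re e / s = complex.Re e / (2 * s) + complex.Re e / (2 * s).
  by field; rewrite gt_eqF.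
exact: ltrD (SP i) (aP i).
Qed.

Lemma weak_closure_vN (N : set (H -> H)) : N `<=` M
  -> weak_operator_closure N `<=` M.
Proof.
move=> NM T [bT wT]; split=> // n x y e e0.
have e2 : 0 < e / 2 by rewrite divr_gt0.
have [S NS SP] := wT n x y _ e2; have [_ /(_ n x y _ e2)[S' NS' SP']] := NM _ NS.
exists S' => // i; apply: le_lt_trans (ler_distD (hdot H (S (x i)) (y i)) _ _) _.
by rewrite [e]splitr ltrD.
Qed.

Lemma pi_vN a : M (pi a).
Proof.
split=> [|n x y e e0]; first exact: pib.
by exists (pi a) => [|i]; [exists a|rewrite subrr normr0].
Qed.

Lemma vN_bounded T : M T -> bounded_operator T. Proof. by case. Qed.

Lemma vN_lincomb (c : C) S T : M S -> M T -> M (c *: S + T).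
Proof.
move=> MS MT.
have bST : bounded_operator (c *: S + T).
  exact: (bounded_lincomb c (vN_bounded MS) (vN_bounded MT)).
apply: strong_approx_vN => // n x e e0.
have cp : 0 < complex.Re `|c| + 1.
  by rewrite ltr_wpDl//; have := le_Re (normr_ge0 c).
have e1 : 0 < e / (2 * (complex.Re `|c| + 1)) by rewrite divr_gt0// mulr_gt0.
have e2 : 0 < e / 2 by rewrite divr_gt0.
have [a aP] := strong_approx x MS e1; have [b bP] := strong_approx x MT e2.
exists (pi (c *: a + b)); first exact: pi_vN.
move=> i; rewrite pill.
have -> : (c *: S + T) (x i) - (c *: pi a (x i) + pi b (x i)) =
    c *: (S (x i) - pi a (x i)) + (T (x i) - pi b (x i)).
  by rewrite scalerBr opprD addrACA.
apply: le_lt_trans (nrD _ _) _; rewrite nrZ [e]splitr; apply: ler_ltD (bP i).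
apply: le_trans (_ : (complex.Re `|c| + 1) * nr (S (x i) - pi a (x i)) <= _).
  by rewrite ler_wpM2r ?nr_ge0// lerDl ler01.
have -> : e / 2 = (complex.Re `|c| + 1) * (e / (2 * (complex.Re `|c| + 1))).
  by field; rewrite gt_eqF.
by rewrite ler_pM2l// ltW.
Qed.

Lemma vN0 : M 0.
Proof.
have -> : (0 : H -> H) = pi 0; last exact: pi_vN.
by apply/funext => x; rewrite (lin0 (pill x)).
Qed.

Lemma vN_commute T P x : M T -> bounded_operator P ->
  (forall a y, P (pi a y) = pi a (P y)) -> P (T x) = T (P x).
Proof.
move=> MT bP Pc; have [k k0 kP] := bounded_nr bP.
apply/eqP; rewrite -subr_eq0; apply/eqP; apply: (@nr_eps _ _ (k + 1)) => e e0.
(* [x] and [P x] are treated by the same [pi a], which commutes with [P]. *)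
have [a aP] := strong_approx (fun i : 'I_2 => if i == ord0 then x else P x) MT e0.
have a1 := aP ord0; have a2 := aP ord_max; rewrite /= in a1 a2.
apply: le_trans (nr_tri _ (P (pi a x)) _) _; rewrite mulrDl mul1r; apply: lerD.
  rewrite -(linB _ _ (bounded_linear bP)); apply: le_trans (kP _) _.
  by rewrite ler_pM2l// ltW.
by rewrite Pc nrBC ltW.
Qed.

Lemma pi_r_commute (eta : H) P a x : is_pi_r Lambda eta P -> P (pi a x) = pi a
  (P x).
Proof.
move=> [bP Pe].
have /funeqP := dense_eq hdense (bounded_comp bP (pib a)) (bounded_comp
  (pib a) bP)
  (fun c => ltac:(by rewrite /= piL !Pe piMul)).
exact.
Qed.

End VonNeumannAlgebra.

(** * Positive operators and commuting contractions *)

Section ContractionInequality.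
Variables (R : realType) (H : hilbert R) (P : H -> H).
Local Notation C := R[i].
Hypothesis lP : linear P.
Hypothesis Pcontr : forall x, nr (P x) <= nr x.
Implicit Types (x y z : H) (S : H -> H).

Definition unit_interval S := [/\ linear S, forall y z, rd (S y) z = rd y (S z),
  forall y, 0 <= rd (S y) y, forall y, rd (S y) y <= rd y y
  & forall y, P (S y) = S (P y)].

Definition sub_square S : H -> H := fun y => S y - S (S y).

(* [S - S^2 = S (1 - S) S + (1 - S) S (1 - S)] *)
Lemma sub_square_unit S : unit_interval S -> unit_interval (sub_square S).
Proof.
move=> [lS sS S0 S1 PS]; split.
- move=> c x y; rewrite /sub_square !lS opprD addrACA scalerBr.
  by congr (_ + _); rewrite -scalerBr.
- by move=> y z; rewrite /sub_square rdBl rdBr !sS.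
- move=> y; rewrite /sub_square.
  have -> : rd (S y - S (S y)) y = rd (S y) (S y) - rd (S (S y)) (S y)
      + rd (S (y - S y)) (y - S y).
    rewrite (linB _ _ lS) !rdBl !rdBr !sS.
    by rewrite [rd y (S (S y))]rdC !sS; ring.
  by rewrite addr_ge0// subr_ge0.
- move=> y; apply: le_trans (S1 y); rewrite /sub_square rdBl lerBlDr lerDl sS.
  exact: rd_ge0.
- by move=> y; rewrite /sub_square (linB _ _ lP) !PS.
Qed.

Let it S n := iter n sub_square S.
Let it_unit S n : unit_interval S -> unit_interval (it S n).
Proof. by move=> US; elim: n => //= n IH; exact: sub_square_unit. Qed.
Let it_sum S n z : unit_interval S ->
  rd (S z) z = \sum_(j < n) nr (it S j z) ^+ 2 + rd (it S n z) z.
Proof.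
move=> US; elim: n => [|n IH]; first by rewrite big_ord0 add0r.
rewrite big_ord_recr /= IH -addrA; congr (_ + _).
have [_ sS _ _ _] := it_unit n US.
by rewrite {1}/sub_square rdBl [rd (it S n (it S n z)) z]sS nr_sqr addrC subrK.
Qed.

(* Riesz: [S] is approximated by sums of squares of operators commuting with
   [P], for which the inequality is clear. *)
Lemma unit_interval_contraction S z : unit_interval S ->
  rd (S (P z)) (P z) <= rd (S z) z.
Proof.
move=> US; apply: (@le_eps _ (nr (P z))) => e e0.
(* By [it_sum] the squares [|S_j (P z)|^2] have bounded partial sums. The remainder has to be small
   at [P z]; at [z] its sign suffices. *)
have [n ne] : exists n, nr (it S n (P z)) < e.
  apply: contrapT => h; have {}h n : e <= nr (it S n (P z)).
    by rewrite leNgt; apply/negP => hn; apply: h; exists n.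
  have [_ _ S0 _ _] := US.
  pose B := rd (S (P z)) (P z) / e ^+ 2.
  have e2 : 0 < e ^+ 2 by rewrite exprn_gt0.
  have B0 : 0 <= B by rewrite divr_ge0// ltW.
  have := it_sum (Num.truncn B).+1 (P z) US => E.
  have [_ _ /(_ (P z)) h1 _ _] := it_unit (Num.truncn B).+1 US.
  have : (Num.truncn B).+1%:R * e ^+ 2 <= rd (S (P z)) (P z).
    rewrite E -[leLHS]addr0 lerD//.
    rewrite -[X in X%:R * _]card_ord mulr_natl -sumr_const; apply: ler_sum => j _.
    by rewrite ler_pXn2r// nnegrE ?nr_ge0// ltW.
  rewrite -ler_pdivlMr// -/B leNgt => /negP; apply.
  by have /andP[] := truncn_itv B0.
rewrite (it_sum n (P z) US) (it_sum n z US).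
have [_ _ /(_ z) h1 _ PS] := it_unit n US.
rewrite -addrA; apply: lerD.
  apply: ler_sum => j _; rewrite ler_pXn2r// ?nnegrE ?nr_ge0//.
  by have [_ _ _ _ PS'] := it_unit j US; rewrite -PS'.
apply: le_trans (rd_le _ _) _; rewrite mulrC.
rewrite -[leLHS]add0r lerD// ler_wpM2l ?nr_ge0//; exact: ltW.
Qed.

End ContractionInequality.

Section PositiveOperators.
Variables (R : realType) (H : hilbert R).
Local Notation C := R[i].
Implicit Types (x y z : H) (T P : H -> H).

Lemma positive_rd T x : positive_operator T -> 0 <= rd (T x) x.
Proof. by move=> pT; have := le_Re (pT x). Qed.

(** [D] measures the failure of symmetry. Its imaginary part vanishes because the diagonal values of
    the form are real, and replacing [y] by a multiple by the imaginary unit settles the real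
    part. *)
Lemma positive_hermitian T x y : linear T -> positive_operator T ->
  hdot H (T x) y = hdot H x (T y).
Proof.
move=> lT pT.
have im0 z : complex.Im (hdot H (T z) z) = 0 by exact: ger0_Im (pT z).
pose D u v := hdot H (T u) v - (hdot H (T v) u)^*.
have DE u v c : D u (c *: v) = c^* * D u v.
  by rewrite /D hdotZr (linZ _ _ lT) hdotZl rmorphM mulrBr.
have imD u v : complex.Im (D u v) = complex.Im (hdot H (T (u + v)) (u + v)).
  have ImD (p q : C) : complex.Im (p + q) = complex.Im p
    + complex.Im q by case: p; case: q.
  rewrite (linD _ _ lT) !hdotDl !hdotDr /D !ImD !im0 add0r addr0.
  by case: (hdot H (T v) u) => p q; rewrite /= opprK.
have imD0 u v : complex.Im (D u v) = 0 by rewrite imD im0.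
suff : D x y = 0.
  by rewrite /D => /eqP; rewrite subr_eq0 => /eqP ->; rewrite -hdotC.
apply/eqP; rewrite eq_complex /= imD0 eqxx andbT.
have := imD0 x ('i%C *: y); rewrite DE; case: (D x y) => p q /=.
by rewrite mul0r add0r mulN1r => /eqP; rewrite oppr_eq0.
Qed.

Lemma positive_contraction T P z : bounded_operator T -> positive_operator T ->
  bounded_operator P -> (forall x, nr (P x) <= nr x) ->
  (forall x, P (T x) = T (P x)) -> rd (T (P z)) (P z) <= rd (T z) z.
Proof.
move=> bT pT bP Pc PT; have [k k0 kP] := bounded_nr bT.
have lT := bounded_linear bT; have lP := bounded_linear bP.
pose S x := k^-1%:C%C *: T x.
have US : unit_interval P S.
  split.
  - by move=> c x y; rewrite /S lT scalerDr !scalerA mulrC.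
  - by move=> y w; rewrite rdZl rdZr /rd (positive_hermitian _ _ lT pT).
  - by move=> y; rewrite rdZl mulr_ge0 ?positive_rd// invr_ge0 ltW.
  - move=> y; rewrite rdZl mulrC ler_pdivrMr// -nr_sqr expr2 mulrC mulrA.
    by apply: le_trans (rd_le _ _) _; rewrite ler_wpM2r ?nr_ge0.
  - by move=> y; rewrite /S (linZ _ _ lP) PT.
have := unit_interval_contraction lP Pc z US.
by rewrite /S !rdZl ler_pM2l// invr_gt0.
Qed.

End PositiveOperators.

(** * Right bounded vectors *)

Section RightBounded.
Variables (R : realType) (A : star_algebra R[i]) (psi : A -> R[i]).
Variables (H : hilbert R) (Lambda : {linear A -> H}).
Local Notation C := R[i].
Hypothesis hL : forall a a', hdot H (Lambda a') (Lambda a) = psi (a^! ** a').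
Hypothesis hdense : dense (range Lambda).
Hypothesis hbound : forall c, exists k : R, forall x,
  nr (Lambda (c ** x)) <= k * nr (Lambda x).
Hypothesis hsq : forall x : A, exists s : seq (A * A), x = \sum_(p
  <- s) p.1 ** p.2.
Local Notation pi := (gns_rep Lambda).
Local Notation is_pi_r := (is_pi_r Lambda).
Implicit Types (a b c : A) (S T P : H -> H).

Let lL : linear Lambda. Proof. exact: linearP. Qed.
Let pib := pi_bounded hdense hbound.
Let piL := pi_Lambda hdense hbound.
Let pil := pi_lin hdense hbound.
Let pill := pi_linl hdense hbound.
Let piMul := piM hdense hbound.
Let piadj := pi_adj hL hdense hbound.

Lemma pi_r_ex eta (k : R) : 0 <= k -> (forall a, nr (pi a eta) <= k * nr
  (Lambda a)) ->
  exists2 P, is_pi_r eta P & forall x, nr (P x) <= k * nr x.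
Proof.
move=> k0 kP.
have [P [lP bP PL]] := bounded_extension lL hdense (pill eta) k0 kP.
by exists P => //; split=> //; exact: nr_bounded lP bP.
Qed.

(** * Regularized least squares in the commutant *)

Section Tikhonov.
Variables (I : finType) (eta : I -> H) (T : I -> H -> H) (s : R).
Hypothesis Teta : forall i, is_pi_r (eta i) (T i).
Hypothesis s0 : 0 < s.

Let bT i : bounded_operator (T i). Proof. by have [] := Teta i. Qed.
Let lT i : linear (T i). Proof. exact: bounded_linear. Qed.

(* [zeta] minimizes [s sum_i |eta_i - T_i zeta|^2 + |zeta|^2]. *)
Lemma tikhonov_min : exists zeta : H, forall y,
  hdot H zeta y = s%:C%C * \sum_i hdot H (eta i - T i zeta) (T i y).
Proof.
pose t := Num.sqrt s; have t0 : 0 < t by rewrite sqrtr_gt0.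
have tt : t%:C%C * t%:C%C = s%:C%C :> C by rewrite -rmorphM -expr2 sqr_sqrtr//
  ltW.
pose f y (o : option I) := if o is Some i then t%:C%C *: T i y else y.
have lf o : linear (f^~ o).
  case: o => [i|]; rewrite /f; last by [].
  by move=> c x y; rewrite lT scalerDr !scalerA mulrC.
pose xi (o : option I) := if o is Some i then t%:C%C *: eta i else 0.
have [u [uc uo]] := projection lf xi; exists (u None).
(* The [T i] are bounded, so the tuples [(y, t T_i y)] form a closed subspace and the projection is
   again such a tuple. *)
have uS i : u (Some i) = t%:C%C *: T i (u None).
  have [k k0 kP] := bounded_nr (bT i).
  apply/eqP; rewrite -subr_eq0; apply/eqP;
    apply: (@nr_eps _ _ (1 + t * k)) => e e0.
  have [x xP] := uc e e0.
  apply: le_trans (nr_tri _ (f x (Some i)) _) _; rewrite mulrDl mul1r;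
    apply: lerD.
    exact/ltW/xP.
  rewrite /f -scalerBr nrZ normc_def /= expr0n addr0 sqrtr_sqr ger0_norm;
    last exact: ltW.
  rewrite -mulrA ler_pM2l// -(linB _ _ (lT i)); apply: le_trans (kP _) _.
  by rewrite ler_pM2l// nrBC; exact/ltW/(xP None).
move=> y; have := uo y; rewrite (bigD1 None)//= sub0r linearNl => /eqP.
rewrite addrC subr_eq0 => /eqP <-; rewrite mulr_sumr.
rewrite (reindex_omap (Some : I -> option I) id) => [|[i|]]//=.
apply: eq_big => [i|i _]; first by rewrite eqxx.
rewrite uS -scalerBr hdotZl hdotZr mulrA; congr (_ * _).
by rewrite -tt; congr (_ * _); rewrite conj_Creal// ger0_real// ler0c ltW.
Qed.

Variable zeta : H.
Hypothesis zetaE : forall y,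
  hdot H zeta y = s%:C%C * \sum_i hdot H (eta i - T i zeta) (T i y).

Lemma tikhonov_rd y : rd zeta y = s * \sum_i rd (eta i - T i zeta) (T i y).
Proof. by rewrite /rd zetaE ReZ Re_sum. Qed.

(** Since the [T i] commute with [pi a], the Euler equation becomes
    [pi a zeta = s G (Lambda a - pi a zeta)] in weak form, with [G] the sum of the [T_i^* T_i]. The
    two bounds that follow are those of [s G (1 + s G)^-1]. *)
Lemma tikhonov_pi a y : rd (pi a zeta) y =
  s * \sum_i rd (T i (Lambda a - pi a zeta)) (T i y).
Proof.
have h : hdot H (pi a zeta) y =
    s%:C%C * \sum_i hdot H (T i (Lambda a - pi a zeta)) (T i y).
  rewrite piadj zetaE; congr (_ * _); apply: eq_bigr => i _.
  have [_ TL] := Teta i.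
  rewrite (pi_r_commute hdense hbound _ _ (Teta i)) -piadj; congr (hdot H _ _).
  rewrite (linB _ _ (lT i)) TL (linB _ _ (pil a)).
  by rewrite (pi_r_commute hdense hbound _ _ (Teta i)).
by rewrite /rd h ReZ Re_sum.
Qed.

Lemma tikhonov_residual a :
  s * \sum_i nr (T i (Lambda a - pi a zeta)) ^+ 2 = rd (pi a zeta)
    (Lambda a - pi a zeta).
Proof. by rewrite tikhonov_pi; under eq_bigr do rewrite nr_sqr. Qed.

Lemma tikhonov_contraction : exists2 P, is_pi_r zeta P & forall x, nr (P x)
  <= nr x.
Proof.
have [a|P PP Pb] := @pi_r_ex zeta 1 ler01; last first.
  by exists P => // x; have := Pb x; rewrite mul1r.
rewrite mul1r; set w := pi a zeta.
have : 0 <= rd w (Lambda a - w).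
  by rewrite -tikhonov_residual mulr_ge0 ?(ltW s0)// sumr_ge0// => i _;
    rewrite exprn_ge0// nr_ge0.
rewrite rdBr subr_ge0 -nr_sqr => h.
have [->|w0] := eqVneq (nr w) 0; first exact: nr_ge0.
have wp : 0 < nr w by rewrite lt_def w0 nr_ge0.
by rewrite -(ler_pM2l wp) -expr2 (le_trans h)// rd_le.
Qed.

Lemma tikhonov_residual_le a :
  s * \sum_i nr (T i (Lambda a - pi a zeta)) ^+ 2 <= nr (Lambda a) ^+ 2.
Proof.
rewrite tikhonov_residual; set w := pi a zeta.
have := rd_ge0 (Lambda a - w); have := rd_ge0 w; have := rd_ge0 (Lambda a).
rewrite nr_sqr !(rdBl, rdBr) [rd w (Lambda a)]rdC.
by move: (rd _ _) (rd _ _) (rd _ _) => p q r; lra.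
Qed.

Lemma tikhonov_le y : s * \sum_i nr (eta i - T i zeta) ^+ 2 <=
  s * \sum_i nr (eta i - T i y) ^+ 2 + nr y ^+ 2.
Proof.
have E i : nr (eta i - T i y) ^+ 2 = nr (eta i - T i zeta) ^+ 2
    - 2 * rd (eta i - T i zeta) (T i (y - zeta)) + nr (T i (y - zeta)) ^+ 2.
  rewrite (linB _ _ (lT i)) !nr_sqr !(rdBl, rdBr).
  rewrite [rd (T i zeta) (eta i)]rdC [rd (T i y) (eta i)]rdC [rd (T i y)
    (T i zeta)]rdC.
  by ring.
under [X in _ <= _ * X + _]eq_bigr do rewrite E.
rewrite !big_split /= sumrN -mulr_sumr.
have := tikhonov_rd (y - zeta).
have n1 : 0 <= s * \sum_i nr (T i (y - zeta)) ^+ 2.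
  by rewrite mulr_ge0 ?(ltW s0)// sumr_ge0// => i _; rewrite exprn_ge0// nr_ge0.
have h1 := rd_ge0 (y - zeta); have h2 := rd_ge0 zeta.
move: h1; rewrite (nr_sqr y) !(rdBl, rdBr) [rd zeta y]rdC => h1 hp.
move: n1; rewrite !mulrDr mulrN [s * (2 * _)]mulrCA -hp; move: h1 h2.
by move: (rd y y) (rd y zeta) (rd zeta zeta) (s * _) (s * _)
  => p q r m n h1 h2 n1; lra.
Qed.

End Tikhonov.

Lemma right_bounded_unit (I : finType) (eta : I -> H) (T : I -> H -> H) (e : R) :
  (forall i, is_pi_r (eta i) (T i)) -> 0 < e ->
  exists zeta P, [/\ is_pi_r zeta P, forall x, nr (P x) <= nr x
    & forall i, nr (eta i - T i zeta) < e].
Proof.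
move=> Teta e0; pose n : R := #|I|%:R + 1.
have n0 : 0 < n by rewrite ltr_wpDl.
have en : 0 < e / n by rewrite divr_gt0.
have [b bP] := approx_identity hL hdense hbound hsq eta en.
(* [Lambda b] is the competitor of [zeta]: [T_i (Lambda b) = pi b eta_i] is within [e / n] of
   [eta_i], and [s] makes the penalty [|Lambda b|^2 / s] less than [e^2 / 2]. As [n] is the number
   of vectors plus one, [(n - 1) (e / n)^2 <= e^2 / 2]. *)
pose s := 2 * (nr (Lambda b) ^+ 2 + 1) / e ^+ 2.
have e2 : 0 < e ^+ 2 by rewrite exprn_gt0.
have q0 : 0 <= nr (Lambda b) ^+ 2 by rewrite exprn_ge0// nr_ge0.
have s0 : 0 < s by rewrite divr_gt0// mulr_gt0// ltr_wpDl.
have [zeta zE] := tikhonov_min Teta s0.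
have [P PP Pc] := tikhonov_contraction Teta s0 zE.
exists zeta, P; split=> // i.
rewrite -(@ltr_pXn2r _ 2)// ?nnegrE ?nr_ge0//; last exact: ltW.
have := tikhonov_le Teta s0 zE (Lambda b).
rewrite -ler_pdivlMl// mulrDr mulKf ?gt_eqF// => h.
apply: le_lt_trans (_ : _ <= \sum_i nr (eta i - T i zeta) ^+ 2) _.
  by rewrite (bigD1 i)//= lerDl sumr_ge0// => j _; rewrite exprn_ge0// nr_ge0.
apply: le_lt_trans h _.
have h1 : \sum_i nr (eta i - T i (Lambda b)) ^+ 2 <= (n - 1) * (e / n) ^+ 2.
  rewrite /n addrK mulr_natl -sumr_const; apply: ler_sum => j _.
  have [_ ->] := Teta j.
  by rewrite ler_pXn2r// ?nnegrE ?nr_ge0// ltW.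
have h2 : (n - 1) * (e / n) ^+ 2 <= e ^+ 2 / 2.
  rewrite expr_div_n mulrA ler_pdivrMr ?exprn_gt0// [leLHS]mulrC -[leRHS]mulrA
    ler_pM2l//.
  have : 0 <= (n - 1) ^+ 2 by rewrite sqr_ge0.
  by rewrite !expr2 => h2; lra.
have h3 : s^-1 * nr (Lambda b) ^+ 2 < e ^+ 2 / 2.
  rewrite /s invf_div mulrAC ltr_pdivrMr ?mulr_gt0// ?ltr_wpDl//.
  have -> : e ^+ 2 / 2 * (2 * (nr (Lambda b) ^+ 2 + 1)) = e ^+ 2 * nr
    (Lambda b) ^+ 2 + e ^+ 2.
    by field.
  by rewrite ltrDl.
rewrite [X in _ < X]splitr; apply: ler_ltD h3; exact: le_trans h1 h2.
Qed.

(** * Resolvents of right multiplications *)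

Section Resolvent.
Variables b b' : A.
Hypothesis adj : forall x y,
  hdot H (Lambda (x ** b)) (Lambda y) = hdot H (Lambda x) (Lambda (y ** b')).

Variable t : R.
Hypothesis t0 : 0 < t.
Let tC (x y : H) : hdot H x (t%:C%C *: y) = t%:C%C * hdot H x y.
Proof. by rewrite hdotZr conj_Creal// ger0_real// ler0c ltW. Qed.

(* [u = (1 + t^2 Q Q^* )^-1 (Lambda b)] where [Q] is the right multiplication by
   [b] and [Q^*] extends the right multiplication by [b']. *)
Lemma resolvent : exists u v : H,
  (forall e, 0 < e -> exists x, nr (u - Lambda x) < e /\
     nr (v - t%:C%C *: Lambda (x ** b')) < e) /\
  (forall y, hdot H (Lambda b - u) (Lambda y) = t%:C%C * hdot H v (Lambda
    (y ** b'))).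
Proof.
(* The range of [f] is the graph of [t] times the right multiplication by [b']. Projecting
   [(Lambda b, 0)] onto its closure gives [(u, v)] with [v = t Q^* u] and, in weak form,
   [Lambda b - u = t Q v]. *)
pose f (x : A) (i : bool) := if i then Lambda x else t%:C%C *: Lambda (x ** b').
have lf i : linear (f^~ i).
  case: i => //= c x y; rewrite /f sa_mulDl sa_mulZl lL.
  by rewrite scalerDr !scalerA mulrC.
have [u [uc uo]] := projection lf (fun i => if i then Lambda b else 0).
exists (u true), (u false); split=> [e /uc[x xP]|y].
  by exists x; split; [exact: (xP true)|exact: (xP false)].
have := uo y; rewrite big_bool /= sub0r tC linearNl mulrN => /eqP.
by rewrite subr_eq0 => /eqP.
Qed.

Variables (u v : H).
Hypothesis uc : forall e, 0 < e -> exists x, nr (u - Lambda x) < e /\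
     nr (v - t%:C%C *: Lambda (x ** b')) < e.
Hypothesis uo : forall y,
  hdot H (Lambda b - u) (Lambda y) = t%:C%C * hdot H v (Lambda (y ** b')).

Let U a := pi a u.
Let V a := pi a v.
(** An affine identity valid at all pairs [(Lambda z, t Lambda (z b'))] passes to [(U a, V a)],
    since these pairs are stable under [pi a] and approach [(u, v)]. *)
Let lim a (F : A -> R) (x y : H) (r : R) :
  (forall z, F z = rd x (Lambda z) + rd y (t%:C%C *: Lambda (z ** b')) + r) ->
  (forall z, F z = 0) -> rd x (U a) + rd y (V a) + r = 0.
Proof.
move=> FE F0; have [k k0 kP] := bounded_nr (pib a).
apply: (@eq_eps _ (k * (nr x + nr y))) => e e0; rewrite subr0.
have [z [z1 z2]] := uc e0.
have := F0 (a ** z); rewrite FE => h.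
have -> : rd x (U a) + rd y (V a) + r =
    rd x (pi a (u - Lambda z)) + rd y (pi a (v - t%:C%C *: Lambda (z ** b'))).
  rewrite !(linB _ _ (pil a)) (linZ _ _
    (pil a)) !piL sa_mulA !rdBr -/(U a) -/(V a).
  by move: h; lra.
apply: le_trans (ler_normD _ _) _; rewrite mulrDr mulrDl; apply: lerD.
  apply: le_trans (rd_CS _ _) _;
    rewrite [leRHS]mulrAC [leLHS]mulrC ler_wpM2r ?nr_ge0//.
  by apply: le_trans (kP _) _; rewrite ler_pM2l// ltW.
apply: le_trans (rd_CS _ _) _;
  rewrite [leRHS]mulrAC [leLHS]mulrC ler_wpM2r ?nr_ge0//.
by apply: le_trans (kP _) _; rewrite ler_pM2l// ltW.
Qed.

Let uoa a y : rd (Lambda (a ** b) - U a) (Lambda y) = t * rd (V a) (Lambda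
  (y ** b')).
Proof.
rewrite /rd -ReZ; congr complex.Re.
by rewrite -piL -(linB _ _ (pil a)) piadj piL uo /V piadj piL sa_mulA.
Qed.

Let e1 a : rd (Lambda (a ** b) - U a) (U a) = rd (V a) (V a).
Proof.
have := @lim a (fun z => rd (Lambda (a ** b) - U a) (Lambda z) - t * rd (V a)
  (Lambda (z ** b')))
  (Lambda (a ** b) - U a) (- V a) 0.
have rdNl (x y : H) : rd (- x) y = - rd x y by rewrite /rd linearNl ReN.
rewrite !rdNl addr0 => h; apply/eqP; rewrite -subr_eq0; apply/eqP; apply: h => z.
  by rewrite rdNl rdZr addr0.
by rewrite uoa subrr.
Qed.

Let e2 a : t * rd (Lambda (a ** b)) (U a) = rd (Lambda a) (V a).
Proof.
have := @lim a (fun z => t * rd (Lambda (a ** b)) (Lambda z) - t * rd (Lambda a)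
  (Lambda (z ** b')))
  (t%:C%C *: Lambda (a ** b)) (- Lambda a) 0.
have rdNl (x y : H) : rd (- x) y = - rd x y by rewrite /rd linearNl ReN.
rewrite !rdNl rdZl addr0 => h; apply/eqP; rewrite -subr_eq0; apply/eqP;
  apply: h => z.
  by rewrite rdNl rdZr rdZl addr0.
by rewrite /rd adj subrr.
Qed.

Let e3 a (c : A) : rd (V a) (Lambda (c ** b')) = t * rd (U a) (Lambda
  (c ** b' ** b)).
Proof.
have := @lim a (fun z => rd (- (t%:C%C *: Lambda (c ** b' ** b))) (Lambda z)
    + rd (Lambda (c ** b')) (t%:C%C *: Lambda (z ** b')))
  (- (t%:C%C *: Lambda (c ** b' ** b))) (Lambda (c ** b')) 0.
have rdNl (x y : H) : rd (- x) y = - rd x y by rewrite /rd linearNl ReN.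
move=> h; have : rd (- (t%:C%C *: Lambda (c ** b' ** b))) (U a) + rd (Lambda
  (c ** b')) (V a) + 0 = 0.
  apply: h => z; first by rewrite addr0.
  by rewrite rdNl rdZl rdZr [in X in - _ + X]/rd -adj -/(rd _ _) addNr.
rewrite addr0 rdNl rdZl [rd _ (U a)]rdC [rd _ (V a)]rdC => /eqP.
by rewrite addrC subr_eq0 => /eqP.
Qed.

(** Conceptually [pi_r(u)] is [(1 + t^2 Q Q^* )^-1 Q]. By [e1] and [e2], both [t |V|^2] and
    [t |U|^2] are at most [t <Lambda (a b), U> = <Lambda a, V>]; the first bound gives
    [t |V| <= |Lambda a|], and the second then gives the claim. *)
Let Ub a : nr (U a) <= t^-1 * nr (Lambda a).
Proof.
have h1 := e1 a; have h2 := e2 a; have h3 := rd_le (Lambda a) (V a).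
rewrite rdBl -!nr_sqr in h1; move: h1 h2 h3.
have := nr_ge0 (U a); have := nr_ge0 (V a); have := nr_ge0 (Lambda a).
move: (nr (U a)) (nr (V a)) (nr (Lambda a)) (rd _ _) (rd _ _)
  => p q r n m r0 q0 p0 h1 h2 h3.
have tq : t * q <= r.
  have [->|qn] := eqVneq q 0; first by rewrite mulr0.
  have qp : 0 < q by rewrite lt_def qn.
  rewrite -(ler_pM2r qp); apply: le_trans h3; rewrite -h2 -mulrA ler_pM2l//.
  by rewrite -expr2 -h1 lerBlDr lerDl sqr_ge0.
rewrite ler_pdivlMl// -(@ler_pXn2r _ 2)// ?nnegrE ?mulr_ge0//; last exact: ltW.
apply: le_trans (_ : t * (t * m) <= _).
  by rewrite exprMn expr2 -mulrA !ler_pM2l// -subr_ge0 h1 sqr_ge0.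
rewrite h2; apply: le_trans (_ : t * (r * q) <= _); first by rewrite ler_pM2l.
by rewrite mulrCA expr2 ler_wpM2l.
Qed.

Lemma resolvent_near : nr (Lambda b - u) <= t * nr (Lambda (b ** b')).
Proof.
have h1 : rd (Lambda b - u) (Lambda b) = t * rd v (Lambda (b ** b')).
  by rewrite /rd uo ReZ.
have h2 : rd (Lambda b - u) u = rd v v.
  apply: (@eq_eps _ (nr (Lambda b - u) + nr v)) => e e0.
  have [z [z1 z2]] := uc e0.
  have h : rd (Lambda b - u) (Lambda z) = rd v (t%:C%C *: Lambda (z ** b')).
    by rewrite rdZr /rd uo ReZ.
  have -> : rd (Lambda b - u) u - rd v v =
      rd (Lambda b - u) (u - Lambda z) - rd v (v - t%:C%C *: Lambda (z ** b')).
    by rewrite !rdBr h; ring.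
  apply: le_trans (ler_normB _ _) _; rewrite mulrDl; apply: lerD.
    by apply: le_trans (rd_CS _ _) _; rewrite ler_wpM2l ?nr_ge0// ltW.
  by apply: le_trans (rd_CS _ _) _; rewrite ler_wpM2l ?nr_ge0// ltW.
have E : nr (Lambda b - u) ^+ 2 = t * rd v (Lambda (b ** b')) - nr v ^+ 2.
  by rewrite !nr_sqr rdBr h1 h2.
rewrite -(@ler_pXn2r _ 2)// ?nnegrE ?nr_ge0//;
  last by rewrite mulr_ge0 ?nr_ge0// ltW.
rewrite E exprMn; have h3 := rd_le v (Lambda (b ** b')).
have : t * rd v (Lambda (b ** b')) <= t * (nr v * nr (Lambda
  (b ** b'))) by rewrite ler_pM2l.
move: (rd _ _) (nr v) (nr (Lambda _)) => p q r h4.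
(* Completing the square: [t q r - q^2 <= (t r)^2 / 4]. *)
have : 0 <= (2 * q - t * r) ^+ 2 by rewrite sqr_ge0.
have : 0 <= (t * r) ^+ 2 by rewrite sqr_ge0.
by rewrite !expr2 => g1 g2; nra.
Qed.

(** The estimate says that the adjoint of [P] at [Lambda c] is within [t |Lambda (c b' b)|] of
    [Lambda (c b')]. At [x = Lambda a] the left member is [t^2 <U a, Lambda (c b' b)>] by [uoa] and
    [e3], and [Ub] costs one factor [t]. *)
Lemma resolvent_right_bounded : exists2 P, is_pi_r u P &
  forall (c : A) x, rd x (Lambda (c ** b')) - rd (P x) (Lambda c) <=
    t * nr (Lambda (c ** b' ** b)) * nr x.
Proof.
have [|P PP Pb] := @pi_r_ex u t^-1 _ Ub; first by rewrite invr_ge0 ltW.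
exists P => // c x; rewrite -subr_le0.
set k := t * _; have k0 : 0 <= k by rewrite mulr_ge0 ?nr_ge0// ltW.
have [bP PL] := PP; have lP := bounded_linear bP.
move: x; apply: (dense_zero hdense (F := fun x => rd x (Lambda (c ** b')) - rd
  (P x) (Lambda c) - k * nr x)
  (k := nr (Lambda (c ** b')) + t^-1 * nr (Lambda c) + k)) => [x y|a].
  have -> : rd x (Lambda (c ** b')) - rd (P x) (Lambda c) - k * nr x -
      (rd y (Lambda (c ** b')) - rd (P y) (Lambda c) - k * nr y) =
      rd (x - y) (Lambda (c ** b')) + rd (P (y - x)) (Lambda c) + k *
        (nr y - nr x).
    by rewrite !(linB _ _ lP) !rdBl; ring.
  rewrite !mulrDl; apply: lerD; last first.
    by rewrite ler_wpM2l// lerBlDl nrBC nr_subD.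
  apply: lerD; first by rewrite mulrC; exact: rd_le.
  apply: le_trans (rd_le _ _) _; rewrite mulrAC ler_wpM2r ?nr_ge0// nrBC;
    exact: Pb.
have h := uoa a c; rewrite rdBl e3 in h.
have E : rd (Lambda (a ** b)) (Lambda c) = rd (Lambda a) (Lambda
  (c ** b')) by rewrite /rd adj.
rewrite PL -/(U a) subr_le0 -E.
have -> : rd (Lambda (a ** b)) (Lambda c) - rd (U a) (Lambda c) =
    t * (t * rd (U a) (Lambda (c ** b' ** b))) by rewrite h.
rewrite /k -mulrA ler_pM2l//;
  apply: le_trans (_ : t * (t^-1 * nr (Lambda a) * nr (Lambda (c ** b' ** b)))
    <= _).
  by rewrite ler_pM2l// (le_trans (rd_le _ _))// ler_wpM2r ?nr_ge0// Ub.
by rewrite !mulrA mulfV ?gt_eqF// mul1r mulrC.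
Qed.

End Resolvent.

Hypothesis hmod : forall b, exists b', forall x y,
  hdot H (Lambda (x ** b)) (Lambda y) = hdot H (Lambda x) (Lambda (y ** b')).

Lemma right_bounded_dense z e : 0 < e -> exists eta P, is_pi_r eta P /\ nr
  (z - eta) < e.
Proof.
move=> e0; have e2 : 0 < e / 2 by rewrite divr_gt0.
have [b bz] := dense_approx hdense z e2.
have [b' adj] := hmod b.
pose k := 2 * (nr (Lambda (b ** b')) + 1).
have k0 : 0 < k by rewrite mulr_gt0// ltr_wpDl// nr_ge0.
have t0 : 0 < e / k by rewrite divr_gt0.
have [u [v [uc uo]]] := resolvent b b' t0.
have [P PP _] := resolvent_right_bounded adj t0 uc uo.
exists u, P; split=> //; apply: le_lt_trans (nr_tri _ (Lambda b) _) _.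
rewrite [e]splitr; apply: ltr_leD => //.
apply: le_trans (resolvent_near t0 uc uo) _.
rewrite mulrAC ler_pdivrMr//.
have -> : e / 2 * k = e * (nr (Lambda (b ** b')) + 1) by rewrite /k; field.
by rewrite ler_pM2l// lerDl ler01.
Qed.

End RightBounded.

(** * Increasing nets of positive operators *)

Section PositiveForms.
Variables (R : realType) (H : hilbert R).
Local Notation C := R[i].
Implicit Types (x y z : H) (S T B : H -> H).

Lemma positive_CS T x y : linear T -> positive_operator T ->
  nr (T x) ^+ 4 <= rd (T x) x * rd (T (T x)) (T x).
Proof.
move=> lT pT.
have fl v : linear ((fun u => hdot H (T u) v) : H -> C^o).
  by move=> c u w; rewrite lT linearPl.
have fh u v : hdot H (T u) v = (hdot H (T v) u)^*.
  by rewrite (positive_hermitian _ _ lT pT) -hdotC.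
have := form_CauchySchwarz fl fh pT x (T x); rewrite -hdotE.
have reP z : hdot H (T z) z = (rd
  (T z) z)%:C%C by rewrite /rd RRe_real// ger0_real.
by rewrite !reP normrX normr_id nrE -!rmorphXn -rmorphM lecR -exprM.
Qed.

(** The inequality [T^2 <= k T] for [0 <= T <= k], by Cauchy-Schwarz for the form of [T] at [x] and
    [T x]. *)
Lemma positive_sqr T (k : R) x : linear T -> positive_operator T ->
  (forall y, rd (T y) y <= k * nr y ^+ 2) -> nr (T x) ^+ 2 <= k * rd (T x) x.
Proof.
move=> lT pT Tk; have [->|n0] := eqVneq (nr (T x) ^+ 2) 0.
  have [k0|k0] := leP 0 k; first by rewrite mulr_ge0// positive_rd.
  have := Tk x; have := positive_rd x pT => h1 h2.
  suff -> : rd (T x) x = 0 by rewrite mulr0.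
  apply/eqP; rewrite eq_le h1 andbT; apply: le_trans h2 _.
  by rewrite mulr_le0_ge0 ?exprn_ge0 ?nr_ge0// ltW.
have np : 0 < nr (T x) ^+ 2 by rewrite lt_def n0 exprn_ge0// nr_ge0.
rewrite -(ler_pM2r np) -exprD; apply: le_trans (positive_CS x x lT pT) _.
rewrite mulrAC mulrC ler_wpM2r ?positive_rd//; exact: Tk.
Qed.

Lemma bounded_form T : bounded_operator T ->
  exists2 k : R, 0 < k & forall y, rd (T y) y <= k * nr y ^+ 2.
Proof.
move=> /bounded_nr[k k0 kP]; exists k => // y.
by apply: le_trans (rd_le _ _) _; rewrite expr2 mulrA ler_wpM2r ?nr_ge0.
Qed.

Lemma positive_null T x : bounded_operator T -> positive_operator T ->
  rd (T x) x <= 0 -> T x = 0.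
Proof.
move=> bT pT T0; have [k k0 kP] := bounded_form bT.
have := positive_sqr x (bounded_linear bT) pT kP.
move=> /le_trans/(_ (_ : _ <= 0)) h; apply: nr_eq0; apply/eqP.
by rewrite -sqrf_eq0 eq_le exprn_ge0 ?nr_ge0// andbT h// mulr_ge0_le0// ltW.
Qed.

Lemma operator_le_rd S T x : operator_le S T -> rd (S x) x <= rd (T x) x.
Proof. by move=> h; rewrite -subr_ge0 -rdBl; exact: (positive_rd x h). Qed.

Lemma operator_le_trans S T B : operator_le S T -> operator_le T B
  -> operator_le S B.
Proof.
move=> h1 h2 x; have := addr_ge0 (h1 x) (h2 x).
by rewrite -hdotDl [X in hdot H X x]addrC subrKA.
Qed.

Lemma operator_le_refl S : operator_le S S.
Proof. by move=> x; rewrite [X in hdot H X x](subrr (S x)) linear0l. Qed.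

Lemma positive_Re T x : complex.Im (hdot H (T x) x) = 0 -> 0 <= rd (T x) x ->
  0 <= hdot H (T x) x.
Proof. by move=> h1 h2; rewrite lecE h1 eqxx. Qed.

Lemma Im_hdot_le x y : `|complex.Im (hdot H x y)| <= nr x * nr y.
Proof.
apply: le_trans (hdot_nr x y); case: (hdot H x y) => p q /=.
by rewrite -sqrtr_sqr ler_wsqrtr// lerDr sqr_ge0.
Qed.

Lemma quad_continuous T (k e : R) x y : linear T -> 0 < k -> (forall z, nr (T z)
  <= k * nr z) ->
  0 < e -> e <= 1 -> nr (x - y) < e ->
  rd (T x) x <= rd (T y) y + k * (2 * nr x + 1) * e.
Proof.
move=> lT k0 kP e0 e1 xy.
have -> : rd (T x) x = rd (T y) y + (rd (T (x - y)) x + rd (T y) (x - y)).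
  by rewrite (linB _ _ lT) rdBl rdBr; ring.
rewrite lerD2l; apply: le_trans (lerD (rd_le _ _) (rd_le _ _)) _.
have ny : nr y <= nr x + 1.
  by apply: le_trans (nr_subD _ x) _; rewrite nrBC lerD2l (le_trans (ltW xy)).
have h1 : nr (T (x - y)) * nr x <= k * e * nr x.
  by rewrite ler_wpM2r ?nr_ge0// (le_trans (kP _))// ler_pM2l// ltW.
have h2 : nr (T y) * nr (x - y) <= k * (nr x + 1) * e.
  apply: ler_pM; rewrite ?nr_ge0//; last exact: ltW.
  by apply: le_trans (kP _) _; rewrite ler_pM2l.
apply: le_trans (lerD h1 h2) _.
by rewrite le_eqVlt; apply/orP; left; apply/eqP; ring.
Qed.

End PositiveForms.

Section Vigier.
Variables (R : realType) (H : hilbert R).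
Local Notation C := R[i].
Variables (D : set (H -> H)) (T : H -> H).
Hypothesis Dne : D !=set0.
Hypothesis Dlin : forall S, D S -> linear S.
Hypothesis Dpos : forall S, D S -> positive_operator S.
Hypothesis Ddir : forall S1 S2, D S1 -> D S2 ->
  exists2 S, D S & operator_le S1 S /\ operator_le S2 S.
Hypothesis DT : forall S, D S -> operator_le S T.
Hypothesis bT : bounded_operator T.

(** [S - S0] lies between 0 and [T], so [positive_sqr] applies to it: strong convergence of the net
    is reduced to that of the increasing numbers [<S x, x>]. *)
Let form_bound : exists2 k : R, 0 < k & forall S0 S, D S0 -> D S
  -> operator_le S0 S ->
  forall x, nr (S x - S0 x) ^+ 2 <= k * (rd (S x) x - rd (S0 x) x).
Proof.
have [k k0 kP] := bounded_form bT; exists k => // S0 S D0 DS S0S x.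
have lB : linear (S - S0).
  have lS := Dlin DS; have lS0 := Dlin D0.
  move=> c u v; rewrite [LHS](_ : _ = S (c *: u + v) - S0 (c *: u + v))//.
  by rewrite lS lS0 opprD addrACA -scalerBr.
have := positive_sqr x lB S0S => /(_ k);
  rewrite [(S - S0) x](_ : _ = S x - S0 x)// rdBl.
apply=> y; apply: le_trans (kP y).
rewrite [(S - S0) y](_ : _ = S y - S0 y)// rdBl lerBlDr.
by rewrite (le_trans (operator_le_rd y (DT DS)))// lerDl positive_rd//;
  exact: Dpos.
Qed.

Let cauchy_net x (e : R) : 0 < e -> exists2 S0, D S0 &
  forall S, D S -> operator_le S0 S -> nr (S x - S0 x) < e.
Proof.
move=> e0; have [k k0 kP] := form_bound.
pose E := [set rd (S x) x | S in D].
have Esup : has_sup E.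
  have [S DS] := Dne; split; first by exists (rd (S x) x), S.
  by exists (rd (T x) x) => _ [S' DS' <-]; exact/operator_le_rd/DT.
have d0 : 0 < e ^+ 2 / k by rewrite divr_gt0// exprn_gt0.
have [_ [S0 DS0 <-] hS0] := sup_adherent d0 Esup.
exists S0 => // S DS S0S; rewrite -(@ltr_pXn2r _ 2)// ?nnegrE ?nr_ge0//;
  last exact: ltW.
apply: le_lt_trans (kP _ _ DS0 DS S0S x) _; rewrite mulrC -ltr_pdivlMr//.
have : rd (S x) x <= sup E by apply: ub_le_sup; [exact: Esup.2|exists S].
by move: hS0; lra.
Qed.

Let net_limit x : exists w, forall e : R, 0 < e -> exists2 S0, D S0 &
  forall S, D S -> operator_le S0 S -> nr (S x - w) < e.
Proof.
have /choice[s sP] (n : nat) : exists S0, D S0 /\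
    forall S, D S -> operator_le S0 S -> nr (S x - S0 x) < n.+1%:R^-1.
  have [|S0 DS0 h] := @cauchy_net x n.+1%:R^-1; first by rewrite invr_gt0.
  by exists S0.
have [|w wP] := @nr_complete R H (fun n => s n x).
  move=> e e0; have e2 : 0 < e / 2 by rewrite divr_gt0.
  have [N hN] := inv_natS_lt e2; exists N => m n Nm Nn.
  have [S DS [mS nS]] := Ddir (sP m).1 (sP n).1.
  apply: le_lt_trans (nr_tri _ (S x) _) _; rewrite nrBC [e]splitr; apply: ltrD.
    exact: lt_trans ((sP m).2 _ DS mS) (hN _ Nm).
  exact: lt_trans ((sP n).2 _ DS nS) (hN _ Nn).
exists w => e e0; have e2 : 0 < e / 2 by rewrite divr_gt0.
have [N1 h1] := wP _ e2; have [N2 h2] := inv_natS_lt e2.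
pose n := maxn N1 N2; exists (s n); first exact: (sP n).1.
move=> S DS nS; apply: le_lt_trans (nr_tri _ (s n x) _) _; rewrite [e]splitr;
  apply: ltrD.
  exact: lt_trans ((sP n).2 _ DS nS) (h2 _ (leq_maxr _ _)).
exact: h1 (leq_maxl _ _).
Qed.

(** Directedness merges the members of the net found for single vectors. Approximation on finite
    sets of vectors is the form in which [T0] is shown to belong to [M]. *)
Lemma vigier : exists T0 : H -> H, [/\ bounded_operator T0, positive_operator T0,
  forall S, D S -> operator_le S T0
  & forall (s : seq H) (e : R), 0 < e ->
      exists2 S, D S & forall x, x \in s -> nr (S x - T0 x) < e].
Proof.
have /choice[T0 T0P] := net_limit.
have joint (s : seq H) (e : R) : 0 < e -> exists2 S0, D S0 &
    forall S, D S -> operator_le S0 S -> forall x, x \in s -> nr (S x - T0 x) < e.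
  move=> e0; elim: s => [|y s [S1 D1 h1]]; first by have [S DS] := Dne; exists S.
  have [S2 D2 h2] := T0P y e e0.
  have [S0 D0 [l1 l2]] := Ddir D1 D2.
  exists S0 => // S DS S0S x; rewrite inE => /orP[/eqP ->|xs].
    by apply: h2 => //; exact: operator_le_trans l2 S0S.
  by apply: h1 => //; exact: operator_le_trans l1 S0S.
have near (s : seq H) (e : R) : 0 < e ->
    exists2 S, D S & forall x, x \in s -> nr (S x - T0 x) < e.
  move=> /(joint s)[S DS h]; exists S => //;
    exact: h DS (@operator_le_refl _ _ S).
have [k k0 kP] := bounded_form bT.
have Dk S x : D S -> nr (S x) <= k * nr x.
  move=> DS; have Sk y : rd (S y) y <= k * nr y ^+ 2.
    exact: le_trans (operator_le_rd y (DT DS)) (kP y).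
  have := positive_sqr x (Dlin DS) (Dpos DS) Sk => h.
  rewrite -(@ler_pXn2r _ 2)// ?nnegrE ?nr_ge0//;
    last by rewrite mulr_ge0 ?nr_ge0// ltW.
  by apply: le_trans h _; rewrite exprMn expr2 -mulrA ler_pM2l.
have T0b x : nr (T0 x) <= k * nr x.
  apply: (@le_eps _ 1) => e e0; have [S DS h] := near [:: x] e e0.
  apply: le_trans (nr_subD _ (S x)) _; rewrite mul1r; apply: lerD (Dk S x DS) _.
  by rewrite nrBC ltW// h// inE.
have T0l : linear T0.
  move=> c x y; apply/eqP; rewrite -subr_eq0; apply/eqP.
  apply: (@nr_eps _ _ (1 + (complex.Re `|c| + 1))) => e e0.
  have [S DS h] := near [:: c *: x + y; x; y] e e0.
  have hx := h x; have hy := h y; have hz := h (c *: x + y).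
  rewrite !inE !eqxx !orbT in hx hy hz.
  have {}hx := hx isT; have {}hy := hy isT; have {}hz := hz isT.
  apply: le_trans (nr_tri _ (S (c *: x + y)) _) _; rewrite nrBC !mulrDl !mul1r.
  apply: lerD; first exact: ltW.
  have -> : S (c *: x + y) - (c *: T0 x + T0 y) = c *: (S x - T0 x) +
    (S y - T0 y).
    by rewrite (Dlin DS) opprD addrACA -scalerBr.
  apply: le_trans (nrD _ _) _; rewrite nrZ; apply: lerD; last exact: ltW.
  by rewrite ler_wpM2l ?(ltW hx)//; have := le_Re (normr_ge0 c).
have T0re S x : D S -> rd (S x) x <= rd (T0 x) x.
  move=> DS; apply: (@le_eps _ (nr x)) => e e0.
  have [S1 D1 h1] := joint [:: x] e e0.
  have [S2 D2 [l1 l2]] := Ddir DS D1.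
  have := h1 S2 D2 l2 x; rewrite inE eqxx => /(_ isT) h.
  apply: le_trans (operator_le_rd x l1) _; rewrite -lerBlDl -rdBl.
  by apply: le_trans (rd_le _ _) _; rewrite mulrC ler_wpM2l ?nr_ge0// ltW.
have T0im x : complex.Im (hdot H (T0 x) x) = 0.
  apply: (@eq_eps _ (nr x)) => e e0; rewrite subr0.
  have [S DS h] := near [:: x] e e0.
  have := h x; rewrite inE eqxx => /(_ isT) {}h.
  have -> : complex.Im (hdot H (T0 x) x) = complex.Im (hdot H (T0 x - S x) x).
    rewrite hdotBl; have := ger0_Im (Dpos DS x).
    by case: (hdot H (S x) x) => p q /= ->; case: (hdot H (T0 x) x) => p' q' /=;
      rewrite subr0.
  apply: le_trans (Im_hdot_le _ _) _; rewrite mulrC ler_wpM2l ?nr_ge0// nrBC;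
    exact: ltW.
exists T0; split=> //.
- exact: nr_bounded T0l T0b.
- move=> x; apply: positive_Re => //.
  by have [S DS] := Dne; apply: le_trans (T0re S x DS); apply: positive_rd;
    exact: Dpos.
- move=> S DS x; rewrite [(T0 - S) x](_ : _ = T0 x - S x)// lecE.
  rewrite -[complex.Re (hdot H _ _)]/(rd _ _) rdBl subr_ge0 T0re// andbT hdotBl.
  have := ger0_Im (Dpos DS x); have := T0im x.
  by case: (hdot H (S x) x) => p q; case: (hdot H (T0 x) x) => p' q' /= -> ->;
    rewrite subr0.
Qed.

End Vigier.

(** * The weight *)

Section LinearSpan.
Variables (R : realType) (H : hilbert R) (N : set (H -> H)).
Local Notation C := R[i].

Lemma linear_span0 : linear_span N 0.
Proof.
exists 0%N, (fun=> 0), (fun=> 0); split; first by case.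
by rewrite big_ord0.
Qed.

Lemma linear_span_cons (c : C) S T : N S -> linear_span N T ->
  linear_span N (c *: S + T).
Proof.
move=> NS [n [d [F [NF ->]]]].
exists n.+1, (fun i => if unlift ord0 i is Some j then d j else c),
  (fun i => if unlift ord0 i is Some j then F j else S); split.
  by move=> i; case: unliftP.
rewrite big_ord_recl unlift_none; congr (_ + _); apply: eq_bigr => i _.
by rewrite liftK.
Qed.

End LinearSpan.

Section GNSWeight.
Variables (R : realType) (A : star_algebra R[i]) (psi : A -> R[i]).
Variables (H : hilbert R) (Lambda : {linear A -> H}).
Local Notation C := R[i].
Hypothesis hL : forall a a', hdot H (Lambda a') (Lambda a) = psi (a^! ** a').
Hypothesis hdense : dense (range Lambda).
Hypothesis hbound : forall c, exists k : R, forall x,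
  nr (Lambda (c ** x)) <= k * nr (Lambda x).
Hypothesis hsq : forall x : A, exists s : seq (A * A), x = \sum_(p
  <- s) p.1 ** p.2.
Hypothesis hmod : forall b, exists b', forall x y,
  hdot H (Lambda (x ** b)) (Lambda y) = hdot H (Lambda x) (Lambda (y ** b')).
Local Notation pi := (gns_rep Lambda).
Local Notation M := (gns_vN_algebra Lambda).
Local Notation is_pi_r := (is_pi_r Lambda).
Local Notation psi1 := (gns_weight Lambda).
Implicit Types (a b c : A) (S T P : H -> H).

Let lL : linear Lambda. Proof. exact: linearP. Qed.
Let pil := pi_lin hdense hbound.
Let pill := pi_linl hdense hbound.
Let piMul := piM hdense hbound.
Let piadj := pi_adj hL hdense hbound.

Definition contractive_pi_r (eta : H) P := is_pi_r eta P /\ forall x, nr (P x)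
  <= nr x.

Lemma gns_weight_ge eta P T : contractive_pi_r eta P -> ((rd (T eta) eta)%:E
  <= psi1 T)%E.
Proof.
move=> [Pe Pc]; apply: ereal_sup_ubound; exists eta => //.
by exists P => //; apply/opnorm_le1 => //; have [] := Pe.
Qed.

Lemma gns_weight_le T (y : \bar R) :
  (forall eta P, contractive_pi_r eta P -> ((rd (T eta) eta)%:E <= y)%E) ->
  (psi1 T <= y)%E.
Proof.
move=> h; apply: ge_ereal_sup => _ [eta [P Pe Pn] <-].
by apply: (h eta P); split=> //; apply/opnorm_le1 => //; have [] := Pe.
Qed.

Lemma contractive_pi_r0 : contractive_pi_r 0 (fun=> 0).
Proof.
split=> [|x]; last by rewrite nr0 nr_ge0.
split=> [|a]; last by rewrite (lin0 (pil a)).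
apply: (@nr_bounded _ _ _ 0) => [c x y|x]; first by rewrite scaler0 addr0.
by rewrite nr0 mul0r.
Qed.

Let M_bounded T : M T -> bounded_operator T. Proof. by case. Qed.
Let M_linear T : M T -> linear T. Proof. by move=> /M_bounded/bounded_linear. Qed.

Lemma gns_weight_ge0 T : (0 <= psi1 T)%E.
Proof. by have := gns_weight_ge T contractive_pi_r0; rewrite rd0r. Qed.

Lemma vN_contraction T eta P z : positive_part M T -> contractive_pi_r eta P ->
  rd (T (P z)) (P z) <= rd (T z) z.
Proof.
move=> [MT pT] [Pe Pc]; have [bP _] := Pe.
apply: positive_contraction => //; first exact: M_bounded.
move=> x; apply: (vN_commute hdense hbound x MT bP) => a y.
exact: (pi_r_commute hdense hbound a y Pe).
Qed.

(** If [P1 zeta] is close to [eta1] and [P2 zeta] to [eta2], then [vN_contraction] replaces both by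
    the common vector [zeta]. *)
Lemma gns_weight_superadditive S T eta1 P1 eta2 P2 :
  positive_part M S -> positive_part M T ->
  contractive_pi_r eta1 P1 -> contractive_pi_r eta2 P2 ->
  ((rd (S eta1) eta1 + rd (T eta2) eta2)%R%:E <= psi1 (S + T)%R)%E.
Proof.
move=> MS MT c1 c2; have [[MS' _] [MT' _]] := (MS, MT).
have [k k0 kP] := bounded_nr (M_bounded MS');
  have [l l0 lP] := bounded_nr (M_bounded MT').
pose K := k * (2 * nr eta1 + 1) + l * (2 * nr eta2 + 1).
have K0 : 0 < K.
  by rewrite addr_gt0// mulr_gt0// ltr_wpDl// mulr_ge0// nr_ge0.
apply/lee_addgt0Pr => e e0.
pose d := Num.min 1 (e / K).
have d0 : 0 < d by rewrite lt_min ltr01 divr_gt0.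
have d1 : d <= 1 by rewrite ge_min lexx.
have de : d * K <= e by rewrite -ler_pdivlMr// ge_min lexx orbT.
have [i|zeta [P [PP Pc near]]]
  := @right_bounded_unit R A psi H Lambda hL hdense hbound hsq
  bool (fun i => if i then eta1 else eta2) (fun i => if i then P1 else P2) d _ d0.
  by case: i; [exact: c1.1|exact: c2.1].
have n1 := near true; have n2 := near false; rewrite /= in n1 n2.
have := gns_weight_ge (S + T) (conj PP Pc).
rewrite [(S + T) zeta](_ : _ = S zeta + T zeta)// rdDl => h.
apply: le_trans (leeD2r _ h); rewrite -EFinD lee_fin.
have q1 := quad_continuous (M_linear MS') k0 kP d0 d1 n1.
have q2 := quad_continuous (M_linear MT') l0 lP d0 d1 n2.
have v1 := vN_contraction zeta MS c1; have v2 := vN_contraction zeta MT c2.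
apply: le_trans (lerD q1 q2) _; rewrite addrACA; apply: lerD; first exact: lerD.
by rewrite -mulrDl mulrC.
Qed.

Lemma gns_weight_add S T : positive_part M S -> positive_part M T ->
  psi1 (S + T) = (psi1 S + psi1 T)%E.
Proof.
move=> MS MT; apply/eqP; rewrite eq_le; apply/andP; split.
  apply: gns_weight_le => eta P c.
  rewrite [(S + T) eta](_ : _ = S eta + T eta)// rdDl EFinD.
  by apply: leeD; exact: gns_weight_ge c.
have sup := fun eta1 P1 eta2 P2
  => @gns_weight_superadditive S T eta1 P1 eta2 P2 MS MT.
move: (gns_weight_ge0 (S + T)) sup; case: (psi1 (S + T)) => [r|_ _|//];
  last by rewrite leey.
move=> r0 sup.
have hT eta1 P1 : contractive_pi_r eta1 P1 -> (psi1 T <= (r - rd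
  (S eta1) eta1)%:E)%E.
  move=> c1; apply: gns_weight_le => eta2 P2 c2.
  by have := sup _ _ _ _ c1 c2; rewrite !lee_fin lerBrDl.
(* The zero vector gives [psi1 T <= r], so that [psi1 T] is finite and may be subtracted. *)
have := hT _ _ contractive_pi_r0; move: (gns_weight_ge0 T) hT.
case: (psi1 T) => [t|//|//] _ hT _.
have : (psi1 S <= (r - t)%:E)%E.
  apply: gns_weight_le => eta P c; have := hT _ _ c.
  by rewrite !lee_fin lerBrDr lerBrDl.
by move=> /(leeD2r t%:E)/le_trans; apply; rewrite -EFinD lee_fin subrK.
Qed.

Lemma gns_weight_scale (c : R) T : 0 <= c ->
  psi1 (c%:C%C *: T) = (c%:E * psi1 T)%E.
Proof.
move=> c0.
have E eta (d : R) : rd ((d%:C%C *: T) eta) eta = d * rd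
  (T eta) eta by rewrite rdZl.
have [->|cn] := eqVneq c 0.
  rewrite mul0e; apply/eqP; rewrite eq_le gns_weight_ge0 andbT.
  by apply: gns_weight_le => eta P _; rewrite E mul0r.
have cp : 0 < c by rewrite lt_def cn.
apply/eqP; rewrite eq_le; apply/andP; split.
  apply: gns_weight_le => eta P c1; rewrite E EFinM.
  by apply: lee_wpmul2l; [rewrite lee_fin|exact: gns_weight_ge c1].
have h : (psi1 T <= c^-1%:E * psi1 (c%:C%C *: T)%R)%E.
  apply: gns_weight_le => eta P c1.
  have -> : rd (T eta) eta = c^-1 * rd ((c%:C%C *: T) eta) eta by rewrite E mulKf.
  rewrite EFinM; apply: lee_wpmul2l; last exact: gns_weight_ge c1.
  by rewrite lee_fin invr_ge0.
have := lee_wpmul2l (_ : 0 <= c%:E)%E h; rewrite lee_fin => /(_ c0).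
by rewrite muleA -EFinM mulfV// mul1e.
Qed.

Lemma gns_weight_is_weight : is_weight M psi1.
Proof.
split=> [T _|S T|c T c0 _]; first exact: gns_weight_ge0.
- exact: gns_weight_add.
- exact: gns_weight_scale.
Qed.

Lemma gns_weight_faithful : faithful_weight M psi1.
Proof.
move=> T [MT pT] T0.
have bT := M_bounded MT; have lT := M_linear MT.
(* Rescaling makes every right bounded vector contractive, and [T] vanishes where its form does. *)
have null eta P : is_pi_r eta P -> T eta = 0.
  move=> [bP PL]; have [k k0 kP] := bounded_nr bP; have lP := bounded_linear bP.
  have kC : k^-1%:C%C != 0 :> C by rewrite fmorph_eq0 invr_eq0 gt_eqF.
  have nk x : nr (k^-1%:C%C *: x : H) = k^-1 * nr x.
    by rewrite nrZ normc_def /= expr0n addr0 sqrtr_sqr ger0_norm// invr_ge0 ltW.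
  have c : contractive_pi_r (k^-1%:C%C *: eta) (fun x => k^-1%:C%C *: P x).
    split=> [|x]; last by rewrite nk ler_pdivrMl.
    split=> [|a]; last by rewrite PL (linZ _ _ (pil a)).
    apply: (@nr_bounded _ _ _ 1) => [d x y|x];
      last by rewrite nk mul1r ler_pdivrMl.
    by rewrite lP scalerDr !scalerA mulrC.
  have := gns_weight_ge T c; rewrite T0 lee_fin => /(positive_null bT pT).
  by rewrite (linZ _ _ lT) => /eqP; rewrite scaler_eq0 (negPf kC) => /eqP.
have [k k0 kP] := bounded_nr bT.
apply/funext => z; apply: (@nr_eps _ _ k) => e e0.
have [eta [P [Pe ze]]] := right_bounded_dense hL hdense hbound hmod z e0.
rewrite -[T z](subr0 (T z)) -(null _ _ Pe) -(linB _ _ lT).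
by apply: le_trans (kP _) _; rewrite ler_pM2l// ltW.
Qed.

Lemma gns_weight_mono S T : operator_le S T -> (psi1 S <= psi1 T)%E.
Proof.
move=> ST; apply: gns_weight_le => eta P c.
by apply: le_trans (gns_weight_ge T c); rewrite lee_fin operator_le_rd.
Qed.

Lemma gns_weight_normal : normal_weight M psi1.
Proof.
move=> D T Dne DM Ddir [MT pT] DT Tlub.
apply/eqP; rewrite eq_le; apply/andP; split; last first.
  by apply: ge_ereal_sup => _ [S DS <-]; exact/gns_weight_mono/DT.
have [T0 [bT0 pT0 DT0 near]] := vigier Dne (fun S DS => M_linear (DM S DS).1)
  (fun S DS => (DM S DS).2) Ddir DT (M_bounded MT).
have MT0 : M T0.
  apply: (strong_approx_vN hdense hbound) => // n x e e0.
  have [S DS h] := near [seq x i | i <- enum 'I_n] e e0.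
  exists S; first exact: (DM S DS).1.
  by move=> i; rewrite nrBC; apply: h; rewrite map_f// mem_enum.
(* [T] is least among the upper bounds in [M], whence the need for [MT0]. *)
have TT0 : operator_le T T0 by apply: Tlub.
apply: gns_weight_le => eta P c.
apply/lee_addgt0Pr => e e0.
have n0 : 0 < nr eta + 1 by rewrite ltr_wpDl// nr_ge0.
have [|S DS h] := near [:: eta] (e / (nr eta + 1)); first by rewrite divr_gt0.
have := h eta; rewrite inE eqxx => /(_ isT) {}h.
apply: (@le_trans _ _ (psi1 S + e%:E)%E); last first.
  by apply: leeD2r; apply: ereal_sup_ubound; exists S.
apply: (@le_trans _ _ ((rd (S eta) eta)%:E + e%:E)%E); last first.
  exact: leeD2r (gns_weight_ge S c).
rewrite -EFinD lee_fin; apply: le_trans (operator_le_rd eta TT0) _.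
rewrite -lerBlDl -rdBl; apply: le_trans (rd_le _ _) _; rewrite nrBC.
apply: le_trans (ler_wpM2r (nr_ge0 _) (ltW h)) _.
by rewrite mulrAC -mulrA ger_pMr// ler_pdivrMr// mul1r lerDl.
Qed.

Lemma rd_pi_sqr a x : rd (pi (a^! ** a) x) x = nr (pi a x) ^+ 2.
Proof. by rewrite nr_sqr /rd piMul piadj sa_starK. Qed.

Lemma pi_sqr_positive a : positive_part M (pi (a^! ** a)).
Proof.
split=> [|x]; first exact: pi_vN.
by rewrite piMul piadj sa_starK hdot_ge0.
Qed.

Lemma gns_weight_pi_le a : (psi1 (pi (a^! ** a)) <= (nr (Lambda a) ^+ 2)%:E)%E.
Proof.
apply: gns_weight_le => eta P [[_ PL] Pc].
by rewrite lee_fin rd_pi_sqr -PL ler_pXn2r// nnegrE nr_ge0.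
Qed.

Lemma polarization a b : a^! ** b =
  \sum_(z <- [:: 1; -1; 'i%C;
    - 'i%C : C]) (z / 4) *: ((b + z *: a)^! ** (b + z *: a)).
Proof.
have c1 : (1 : C)^* = 1 by rewrite rmorph1.
have cm1 : (-1 : C)^* = -1 by rewrite rmorphN1.
have ci : ('i%C : C)^* = - 'i%C by apply/eqP; rewrite eq_complex /= oppr0 !eqxx.
have cmi : (- 'i%C : C)^* = 'i%C by rewrite -ci conjCK.
have ii : ('i%C : C) * 'i%C = -1 by rewrite -expr2 sqr_i.
have E (z : C) : (z / 4) *: ((b + z *: a)^! ** (b + z *: a)) =
    (z / 4) *: (b^! ** b) + (z * z / 4) *: (b^! ** a) + (z * z^* / 4) *:
      (a^! ** b)
    + (z * z * z^* / 4) *: (a^! ** a).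
  rewrite starD starZ sa_mulDl !sa_mulDr !sa_mulZl !sa_mulZr !scalerDr !scalerA
    !addrA.
  congr (_ + _ + _ + _); congr (_ *: _); by ring.
under eq_bigr do rewrite E.
rewrite !big_split /= -!scaler_suml !big_cons !big_nil.
rewrite c1 cm1 ci cmi !mulrNN ii !(mulrN, mulNr) ii !opprK ?mul1r.
have -> : 1 + (- 1 + ('i%C + (- 'i%C + 0))) = 0 :> C by ring.
have -> : 1 + (1 + (-1 + (-1 + 0))) = 0 :> C by ring.
have -> : 1 + (1 + (1 + (1 + 0))) = 4 :> C by ring.
have -> : (4 : C) *:
  (4^-1 : C^o) = 1 by rewrite /GRing.scale /= mulfV// pnatr_eq0.
by rewrite !scale0r scale1r !add0r addr0.
Qed.

(** By [hsq] and polarization [A] is spanned by the elements [a^! ** a], whose weight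
    [gns_weight_pi_le] bounds. *)
Lemma pi_span a : linear_span [set T | positive_part M T /\ (psi1 T < +oo)%E]
  (pi a).
Proof.
have [s ->] : exists s : seq (C * A), a = \sum_(p <- s) p.1 *: (p.2^! ** p.2).
  have [s ->] := hsq a; elim: s => [|p s [s' IH]]; first by exists [::];
    rewrite !big_nil.
  exists ([seq (z / 4, p.2 + z *: p.1^!) | z <- [:: 1; -1; 'i%C; - 'i%C]] ++ s').
  rewrite big_cat big_map /= -polarization sa_starK big_cons IH.
  by [].
elim: s => [|p s IH].
  rewrite big_nil; have -> : pi 0 = 0 by apply/funext => x;
    rewrite (lin0 (pill x)).
  exact: linear_span0.
rewrite big_cons.
have -> : pi (p.1 *: (p.2^! ** p.2) + \sum_(q <- s) q.1 *: (q.2^! ** q.2)) =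
    p.1 *: pi (p.2^! ** p.2) + pi (\sum_(q <- s) q.1 *: (q.2^! ** q.2)).
  by apply/funext => x; rewrite pill.
apply: linear_span_cons => //; split; first exact: pi_sqr_positive.
by apply: le_lt_trans (gns_weight_pi_le _) _; rewrite ltry.
Qed.

Lemma gns_weight_semifinite : semifinite_weight M psi1.
Proof.
apply/seteqP; split=> [T|T [bT wT]].
  apply: (weak_closure_vN) => S [n [c [F [FM ->]]]].
  have {}FM i : M (F i) by have [[]] := FM i.
  elim: n c F FM => [|n IH] c F FM.
    by rewrite big_ord0; exact: (vN0 hdense hbound).
  rewrite big_ord_recl; apply: (vN_lincomb hdense hbound) => //.
  by apply: IH => i.
split=> // n x y e e0; have [_ [a _ <-] h] := wT n x y e e0.
by exists (pi a) => //; exact: pi_span.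
Qed.

Lemma gns_weight_pi a : psi1 (pi (a^! ** a)) = (nr (Lambda a) ^+ 2)%:E.
Proof.
apply/eqP; rewrite eq_le gns_weight_pi_le /=.
have [s aE] := hsq a.
pose n := size s; pose c (i : 'I_n) := (tnth (in_tuple s) i).1.
pose b' (i : 'I_n) := (tnth (in_tuple s) i).2.
(* [hmod] read from the other side: the factors [b' i] of [Lambda a] have to play the role of the
   adjoint multipliers in the resolvent estimate. *)
have /choice[b bP] (i : 'I_n) : exists b, forall x y,
    hdot H (Lambda (x ** b)) (Lambda y) = hdot H (Lambda x) (Lambda (y ** b' i)).
  have [b h] := hmod (b' i); exists b => x y.
  by rewrite hdotC -h -hdotC.
have LaE : Lambda a = \sum_i Lambda (c i ** b' i).
  by rewrite aE (lin_sum _ _ _ lL) big_tnth.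
pose x := Lambda a.
pose K := \sum_i (nr (Lambda (c i)) * nr x + nr (Lambda (c i ** b' i ** b i)) *
  (2 * nr x)).
have K0 : 0 <= K.
  by apply: sumr_ge0 => i _; rewrite addr_ge0// !mulr_ge0// nr_ge0.
apply/lee_addgt0Pr => e e0.
pose t := e / (2 * (K + 1)).
have K1 : 0 < K + 1 by rewrite ltr_wpDl.
have t0 : 0 < t by rewrite divr_gt0// mulr_gt0.
have tK : 2 * t * K <= e.
  rewrite /t; have -> : 2 * (e / (2 * (K + 1))) * K = e * (K / (K + 1)) by field;
    rewrite gt_eqF.
  by rewrite ger_pMr// ler_pdivrMr// mul1r lerDl.
have ex (i : 'I_n) : exists uP : H * (H -> H), is_pi_r uP.1 uP.2 /\
    forall z, rd z (Lambda (c i ** b' i)) - rd (uP.2 z) (Lambda (c i)) <=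
      t * nr (Lambda (c i ** b' i ** b i)) * nr z.
  have [u [v [uc uo]]] := resolvent Lambda (b i) (b' i) t0.
  have [P PP Pb] := resolvent_right_bounded hL hdense hbound (bP i) t0 uc uo.
  by exists (u, P); split=> // z; exact: Pb.
have [uP uPP] := choice ex.
(* With [s = t^-2] the residual bound becomes [|T_i z| <= t |x|], of the same order in [t] as the
   error of the resolvent estimate. *)
have st0 : 0 < (t ^+ 2)^-1 by rewrite invr_gt0 exprn_gt0.
have Teta i := (uPP i).1.
have [zeta zE] := tikhonov_min Teta st0.
have [P PP Pc] := tikhonov_contraction hL hdense hbound Teta st0 zE.
have res := tikhonov_residual_le hL hdense hbound Teta zE a.
pose w := pi a zeta; rewrite -/w -/x in res; pose z := x - w.
have wx : nr w <= nr x by have [_ PL] := PP; rewrite /w -PL.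
have zx : nr z <= 2 * nr x.
  by apply: le_trans (nrD _ _) _; rewrite nrN mulr_natl mulr2n lerD2l.
have Tz i : nr ((uP i).2 z) <= t * nr x.
  rewrite -(@ler_pXn2r _ 2)// ?nnegrE ?nr_ge0//;
    last by rewrite mulr_ge0 ?nr_ge0// ltW.
  rewrite exprMn -ler_pdivrMl ?exprn_gt0//; apply: le_trans res;
    rewrite ler_pM2l//.
  rewrite (bigD1 i)//= lerDl sumr_ge0// => j _; rewrite exprn_ge0// nr_ge0//.
(* The resolvent estimate moves the factor [b' i] onto [z], which then enters only through [T_i z]
   and an error of order [t]. *)
have zxK : rd z x <= t * K.
  rewrite /x LaE rdC rd_suml /K mulr_sumr; apply: ler_sum => i _; rewrite rdC.
  have := (uPP i).2 z; rewrite lerBlDl => /le_trans; apply; rewrite mulrDr;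
    apply: lerD.
    apply: le_trans (rd_le _ _) _; rewrite mulrCA mulrC.
    by rewrite ler_wpM2l ?nr_ge0.
  by rewrite -mulrA ler_pM2l// ler_wpM2l ?nr_ge0.
have := gns_weight_ge (pi (a^! ** a)) (conj PP Pc); rewrite rd_pi_sqr -/w => h.
apply: le_trans (leeD2r _ h); rewrite -EFinD lee_fin -/x.
have sqrE (y v : H) : nr v ^+ 2 = nr y ^+ 2 - 2 * rd (y - v) y + nr (y - v) ^+ 2.
  by rewrite !nr_sqr !(rdBl, rdBr) [rd v y]rdC; ring.
rewrite (sqrE x w) -/z; have : 0 <= nr z ^+ 2 by rewrite exprn_ge0// nr_ge0.
by move: zxK tK; move: (nr z ^+ 2) (nr x ^+ 2) (rd z x) => p q r; lra.
Qed.

End GNSWeight.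

Theorem theorem3p3 (R : realType) (A : multiplier_hopf_star_algebra R[i])
    (exists_left : exists phi : {scalar A},
       left_integral phi /\ positive_functional phi)
    (psi : {scalar A})
    (psi_integral : right_integral psi) (psi_pos : positive_functional psi)
    (H : hilbert R) (Lambda : {linear A -> H})
    (HLambda : gns_completion psi Lambda) :
  let M := gns_vN_algebra Lambda in
  let psi1 := gns_weight Lambda in
  [/\ is_weight M psi1, faithful_weight M psi1, normal_weight M psi1
    & semifinite_weight M psi1] /\
  forall a : A, psi1 (gns_rep Lambda (a^! ** a)) = (complex.Re (psi (a^! ** a)))%:E.
Proof.
have [phi [[[z2 phiz2] phiI] _]] := exists_left.
have [[z1 psiz1] psiI] := psi_integral.
have [hL hdense] := HLambda.
have lpsi : linear (psi : A -> R[i]^o) by exact: linearP.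
have lphi : linear (phi : A -> R[i]^o) by exact: linearP.
have psiT1 a b := right_integral_T1 b (psiI a).
have psiT4 a b := right_integral_T4 b (psiI a).
have phiT2 a b := left_integral_T2 b (phiI a).
have psi1 : psi ((psi z1)^-1 *: z1) = 1.
  by rewrite (linZ _ _ lpsi) /GRing.scale /= mulVf.
have phi1 : phi ((phi z2)^-1 *: z2) = 1.
  by rewrite (linZ _ _ lphi) /GRing.scale /= mulVf.
have hbound c : exists k : R, forall x, nr (Lambda (c ** x)) <= k * nr (Lambda x).
  have [k k0 kP] := lmul_bounded lpsi psiT1 hL c psi1.
  exists (complex.Re k) => x; have := le_Re (kP x).
  by rewrite -[k]RRe_real ?ger0_real// nrE ReZ.
have hsq x : exists s : seq (A * A), x = \sum_(p <- s) p.1 ** p.2.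
  apply: (@mul_span _ A z1); apply: contra_neq psiz1 => ->.
  exact: lin0 lpsi.
have hmod b : exists b', forall x y,
    hdot H (Lambda (x ** b)) (Lambda y) = hdot H (Lambda x) (Lambda (y ** b')).
  (* [<Lambda (x b), Lambda y> = psi(y^! x b) = psi(d y^! x)], and [d y^!] is the adjoint of
     [y d^!]. *)
  have [d dE] := modular_right lpsi lphi psiT1 psiT4 phiT2 psi1 phi1 b.
  exists d^! => x y; rewrite !hL sa_starM sa_starK sa_mulA dE.
  by rewrite sa_mulA.
split.
  split.
  - exact: gns_weight_is_weight hL hdense hbound hsq.
  - exact: gns_weight_faithful hL hdense hbound hmod.
  - exact: gns_weight_normal hdense hbound.
  - exact: gns_weight_semifinite hL hdense hbound hsq.
move=> a; rewrite (gns_weight_pi hL hdense hbound hsq hmod).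
by rewrite nr_sqr /rd hL.
Qed.
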